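(* Each of the rules $\mathsf{ai}{\uparrow}$, $\mathsf{ss}{\uparrow}$, $\mathsf{p}{\uparrow}$ is admissible for $\mathsf{GS}$; that is, for each of these rules and each instance $X\longrightarrow Y$ of it, $\vdash_{\mathsf{GS}} X$ implies $\vdash_{\mathsf{GS}} Y$.
   Context: Atoms: fix a countable set $\mathcal V$ of propositional variables and a disjoint copy $\overline{\mathcal V}=\{\overline a: a\in\mathcal V\}$; atoms are elements of $\mathcal V\cup\overline{\mathcal V}$, with $\overline{\overline a}=a$. A graph is a finite simple undirected graph $G=(V_G,E_G)$ whose vertices are each labelled by an atom; graphs are identified up to label-preserving isomorphism. $\emptyset$ is the empty graph; an atom $a$ also denotes the one-vertex graph labelled $a$. For graphs $G,H$ on disjoint vertex sets, $G\sqcup H$ (par) is their disjoint union and $G\otimes H$ (tensor) is their disjoint union plus all edges between $V_G$ and $V_H$. The dual $\overline G$ has the same vertices, complementary edge set, and dualized labels. A context is a graph $C$ with a subset $R\subseteq V_C$; $C[M]_R$ is $C\sqcup M$ plus all edges between $V_M$ and $R$. A module of $G$ is an induced subgraph $M$ such that each vertex outside $M$ is adjacent to all of $M$ or none of it; $P$ is prime if $|V_P|\ge2$ and its only modules are $\emptyset$, singletons and $P$. For $G$ with vertices $v_1,\dots,v_n$, $G\langle H_1,\dots,H_n\rangle$ replaces each $v_i$ by $H_i$, keeps edges inside each $H_i$, and joins $H_i$ to $H_j$ ($i\neq j$) completely iff $v_iv_j\in E_G$; $\overline G\langle\cdots\rangle$ uses the same vertex order. Rules (premise $\longrightarrow$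 conclusion): $\mathsf{ai}{\downarrow}$: $\emptyset\longrightarrow\overline a\sqcup a$; $\mathsf{ss}{\downarrow}$: $B[A]_S\longrightarrow B\sqcup A$ with $S\subseteq V_B$, $S\ne\emptyset$, $A\ne\emptyset$; $\mathsf{p}{\downarrow}$: $(M_1\sqcup N_1)\otimes\cdots\otimes(M_n\sqcup N_n)\longrightarrow\overline P\langle M_1,\dots,M_n\rangle\sqcup P\langle N_1,\dots,N_n\rangle$ with $P$ prime, $n=|V_P|\ge4$, all $M_i\ne\emptyset$; $\mathsf{ai}{\uparrow}$: $a\otimes\overline a\longrightarrow\emptyset$; $\mathsf{ss}{\uparrow}$: $B\otimes A\longrightarrow B[A]_S$ with $S\subseteq V_B$, $S\ne V_B$, $A\ne\emptyset$; $\mathsf{p}{\uparrow}$: $P\langle M_1,\dots,M_n\rangle\otimes\overline P\langle N_1,\dots,N_n\rangle\longrightarrow(M_1\otimes N_1)\sqcup\cdots\sqcup(M_n\otimes N_n)$ with $P$ prime, $n=|V_P|\ge4$, all $M_i\ne\emptyset$. $\mathsf{GS}=\{\mathsf{ai}{\downarrow},\mathsf{ss}{\downarrow},\mathsf{p}{\downarrow}\}$. A derivation in a system $\mathsf S$ from $G$ to $H$ is a finite sequence $G=G_0,\dots,G_k=H$ where each step is a label-preserving isomorphism or replaces $C[X]_R$ by $C[Y]_R$ for a context and an instance $X\longrightarrow Y$ of a rule of $\mathsf S$. A proof is a derivation from $\emptyset$; $\vdash_{\mathsf S}G$ means $G$ has a proof in $\mathsf S$. *)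

(* Defs.v *)
From mathcomp Require Import all_boot.
From Stdlib Require Import Relation_Operators.

Set Implicit Arguments.
Unset Strict Implicit.
Unset Printing Implicit Defensive.

(* [inl a] is the variable [a], [inr a] its dual copy. *)
Definition atom (V : Type) : Type := (V + V)%type.

Definition dual_atom (V : Type) (a : atom V) : atom V :=
  match a with inl v => inr v | inr v => inl v end.

Record graph (V : Type) := Graph {
  vertex :> finType;
  edge : rel vertex;
  label : vertex -> atom V;
  edge_sym : symmetric edge;
  edge_irrefl : irreflexive edge
}.

Section Graphs.

Variable V : Type.
Implicit Types G H B A C M P : graph V.

Definition isomorphic G H : Prop :=
  exists f : G -> H,
    [/\ bijective f,
        forall x y, edge (f x) (f y) = edge x y
      & forall x, label (f x) = label x].

Definition nonempty G : bool := 0 < #|G|.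

Definition empty_graph : graph V :=
  @Graph V void (fun _ _ => false) (of_void (atom V))
    (fun _ _ => erefl) (fun _ => erefl).

Definition atom_graph (a : atom V) : graph V :=
  @Graph V unit (fun _ _ => false) (fun _ => a)
    (fun _ _ => erefl) (fun _ => erefl).

Definition sum_label G H (u : G + H) : atom V :=
  match u with inl x => label x | inr y => label y end.

(* [C[M]_R]; the two extreme choices of [R] give [par] and [tensor]. *)
Definition plug_edge C (R : {set C}) M (u v : C + M) : bool :=
  match u, v with
  | inl x, inl y => edge x y
  | inr x, inr y => edge x y
  | inl x, inr _ | inr _, inl x => x \in R
  end.

Lemma plug_edge_sym C (R : {set C}) M : symmetric (@plug_edge C R M).
Proof. by case=> x [] y //=; exact: edge_sym. Qed.

Lemma plug_edge_irrefl C (R : {set C}) M : irreflexive (@plug_edge C R M).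
Proof. by case=> x /=; exact: edge_irrefl. Qed.

Definition plug C (R : {set C}) M : graph V :=
  Graph (@sum_label C M) (plug_edge_sym R (M := M)) (plug_edge_irrefl R (M := M)).

Definition par G H : graph V := plug (set0 : {set G}) H.

Definition tensor G H : graph V := plug [set: G] H.

Definition dual_edge G (x y : G) : bool := (x != y) && ~~ edge x y.

Lemma dual_edge_sym G : symmetric (@dual_edge G).
Proof. by move=> x y; rewrite /dual_edge eq_sym edge_sym. Qed.

Lemma dual_edge_irrefl G : irreflexive (@dual_edge G).
Proof. by move=> x; rewrite /dual_edge eqxx. Qed.

Definition dual G : graph V :=
  Graph (fun x : G => dual_atom (label x)) (@dual_edge_sym G) (@dual_edge_irrefl G).

Definition is_module G (M : {set G}) : Prop :=
  forall x : G, x \notin M ->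
    (forall y, y \in M -> edge x y) \/ (forall y, y \in M -> ~~ edge x y).

Definition prime_graph P : Prop :=
  2 <= #|P| /\
  forall M : {set P}, is_module M ->
    [\/ M = set0, exists x, M = [set x] | M = [set: P]].

(* Disjoint union of a finite family [H], where [H i] and [H j] for [i != j]
   are completely joined if [e i j] holds and not joined otherwise. *)
Section Join.

Variables (I : finType) (e : rel I) (e_sym : symmetric e) (H : I -> graph V).

Definition join_edge (u v : {i : I & H i}) : bool :=
  if tag u == tag v then edge (tagged u) (tagged_as u v) else e (tag u) (tag v).

Lemma join_edge_sym : symmetric join_edge.
Proof.
case=> i x [j y]; rewrite /join_edge /= eq_sym.
case: (eqVneq j i) => [eji | _]; last exact: e_sym.
by case: i / eji x => x; rewrite !tagged_asE edge_sym.
Qed.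

Lemma join_edge_irrefl : irreflexive join_edge.
Proof. by case=> i x; rewrite /join_edge /= eqxx tagged_asE edge_irrefl. Qed.

Definition join_family : graph V :=
  Graph (fun u : {i : I & H i} => label (tagged u))
        join_edge_sym join_edge_irrefl.

End Join.

(* The family is indexed by the vertices of [G] themselves, so that
   [compose G H] and [compose (dual G) H] use the same indexing. *)
Definition compose G (H : G -> graph V) : graph V :=
  join_family (@edge_sym V G) H.

Definition big_par (I : finType) (H : I -> graph V) : graph V :=
  @join_family I (fun _ _ => false) (fun _ _ => erefl) H.

Definition big_tensor (I : finType) (H : I -> graph V) : graph V :=
  @join_family I (fun _ _ => true) (fun _ _ => erefl) H.

(* A rule, or a system of rules, is the relation between the premises and the
   conclusions of its instances, without surrounding context. *)
Definition rule := graph V -> graph V -> Prop.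

Inductive ai_down : rule :=
| AiDown (a : atom V) :
    ai_down empty_graph (par (atom_graph (dual_atom a)) (atom_graph a)).

Inductive ss_down : rule :=
| SsDown B A (S : {set B}) :
    S != set0 -> nonempty A -> ss_down (plug S A) (par B A).

Inductive p_down : rule :=
| PDown P (M N : P -> graph V) :
    prime_graph P -> 4 <= #|P| -> (forall i, nonempty (M i)) ->
    p_down (big_tensor (fun i => par (M i) (N i)))
           (par (@compose (dual P) M) (@compose P N)).

Inductive ai_up : rule :=
| AiUp (a : atom V) :
    ai_up (tensor (atom_graph a) (atom_graph (dual_atom a))) empty_graph.

Inductive ss_up : rule :=
| SsUp B A (S : {set B}) :
    S != [set: B] -> nonempty A -> ss_up (tensor B A) (plug S A).

Inductive p_up : rule :=
| PUp P (M N : P -> graph V) :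
    prime_graph P -> 4 <= #|P| -> (forall i, nonempty (M i)) ->
    p_up (tensor (@compose P M) (@compose (dual P) N))
         (big_par (fun i => tensor (M i) (N i))).

Definition GS : rule := fun X Y => [\/ ai_down X Y, ss_down X Y | p_down X Y].

Inductive step (S : rule) : graph V -> graph V -> Prop :=
| StepIso G H : isomorphic G H -> step S G H
| StepRule C (R : {set C}) X Y : S X Y -> step S (plug R X) (plug R Y).

Definition derivation (S : rule) : graph V -> graph V -> Prop :=
  clos_refl_trans_1n (graph V) (step S).

Definition provable (S : rule) G : Prop := derivation S empty_graph G.

Definition admissible (r S : rule) : Prop :=
  forall X Y, r X Y -> provable S X -> provable S Y.

End Graphs.

(* Main.v *)
Require Import Defs.
From mathcomp Require Import all_boot.
From mathcomp Require Import zify.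
From Stdlib Require Import Relation_Operators.
From Stdlib Require Operators_Properties.

Set Implicit Arguments.
Unset Strict Implicit.
Unset Printing Implicit Defensive.

(* Read from conclusion to premise, a rule of GS either deletes a dual pair or
   adds edges.  It therefore decreases the number of ordered nonadjacent pairs
   of vertices, the measure for all inductions on proofs.

   Splitting.  Suppose [par K W] is provable and W = P<W_1,...,W_n> with P
   prime and connected.  Then K may be replaced by one of
   - a graph P'<K_1,...,K_n>, P' the dual of P, with all [par K_i W_i] provable;
   - a graph [par KX KY] such that, for some i, [par KX W_i] and [par KY W-]
     are provable, where W- is W without the block W_i.
   "Replaced" is meant semantically: whatever is provable next to the
   replacement is provable next to K.  This dispenses with the provable contexts
   of the syntactic formulation.  The last rule of the proof is analysed; the
   delicate case is ss, detaching A from B, with W inside the redex.  Then let U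
   be the component of W in the premise, with a prime quotient in which A lies
   in a single block, and split U by the induction hypothesis.

   Cut.  From [par H G] and [par K (dual G)] one gets [par H K], by induction on
   the number of vertices of G: either G or its dual is connected and splits.

   The factors of a provable tensor are provable, by splitting with K empty;
   inserting one of them into the other is ss up.  For p up, cut P<M> and P'<N>
   against Z, P'<dual M>, P<dual N>, where Z is the par of all M_i (x) N_i: their
   par is provable block by block. *)

(** * Isomorphisms and derivations *)

(** Contexts and isomorphisms would obscure the case analysis, so every rule instance is read on the
    vertex set of its conclusion: the redex is a module, the context is its complement, and for ss
    and p the premise is the same vertex set with more edges ([regraph]). Peeling off a single block
    cannot be avoided: once W_i is deleted the quotient is in general no longer prime, and a proof
    of the rest need not respect the remaining blocks. No prime graph has three vertices, and one
    with two vertices only expresses a tensor or a par. This is where the bound 4 comes from, and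
    why splitting needs a tensor form beside the prime one; an atomic form ends the cut induction.
    All three forms require the same analysis of the last rule, which is therefore carried out once,
    for an abstract predicate [Phi] on the side graph. Replacements must also respect the measure,
    so [le] pairs entailment with an injection. *)

Notation GSder := (derivation (@GS _)).
Notation prov := (provable (@GS _)).

Section Iso.
Variable V : Type.
Implicit Types X Y Z G H K C D : graph V.

Lemma iso_refl X : isomorphic X X.
Proof. by exists id; split=> //; exists id. Qed.

Lemma isoI X Y (f : X -> Y) (g : Y -> X) :
  cancel f g -> cancel g f -> (forall x y, edge (f x) (f y) = edge x y) ->
  (forall x, label (f x) = label x) -> isomorphic X Y.
Proof. by move=> fK gK fe fl; exists f; split=> //; exists g. Qed.

Lemma iso_sym X Y : isomorphic X Y -> isomorphic Y X.
Proof.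
case=> f [[g fK gK] fe fl]; apply: (isoI (f := g) (g := f)) => // [x y|x].
  by rewrite -fe !gK.
by rewrite -fl gK.
Qed.

Lemma iso_trans Y X Z : isomorphic X Y -> isomorphic Y Z -> isomorphic X Z.
Proof.
case=> f [bf fe fl] [g [bg ge gl]]; exists (g \o f); split=> /=.
- exact: bij_comp.
- by move=> x y; rewrite /= ge fe.
- by move=> x; rewrite /= gl fl.
Qed.

(** Isomorphisms between subtypes, sums and dependent sums are awkward to invert by hand. Two
    injections into a common type with the same image determine one, and the inverse comes from
    choice. *)
Lemma iso_via (T : eqType) X Y (f : X -> T) (g : Y -> T) :
  injective f -> injective g ->
  (forall x, exists y, f x = g y) -> (forall y, exists x, f x = g y) ->
  (forall x x' y y', f x = g y -> f x' = g y' -> edge x x' = edge y y') ->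
  (forall x y, f x = g y -> label x = label y) -> isomorphic X Y.
Proof.
move=> fi gi fg gf ed lb.
have ex1 x : exists y, f x == g y by have [y e] := fg x; exists y; apply/eqP.
have ex2 y : exists x, f x == g y by have [x e] := gf y; exists x; apply/eqP.
pose h x := xchoose (ex1 x); pose k y := xchoose (ex2 y).
have hP x : f x = g (h x) by apply/eqP; exact: (xchooseP (ex1 x)).
have kP y : f (k y) = g y by apply/eqP; exact: (xchooseP (ex2 y)).
apply: (isoI (f := h) (g := k)).
- by move=> x; apply: fi; rewrite kP -hP.
- by move=> y; apply: gi; rewrite -hP kP.
- by move=> x y; rewrite (ed _ _ _ _ (hP x) (hP y)).
- by move=> x; rewrite (lb _ _ (hP x)).
Qed.

Lemma plug_iso C (R : {set C}) X Y :
  isomorphic X Y -> isomorphic (plug R X) (plug R Y).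
Proof.
case=> f [[g fK gK] fe fl].
apply: (isoI (X := plug R X) (Y := plug R Y)
  (f := fun u : C + X => match u with inl c => inl c | inr x => inr (f x) end)
  (g := fun u : C + Y => match u with inl c => inl c | inr x => inr (g x) end)).
- by case=> //= x; rewrite fK.
- by case=> //= x; rewrite gK.
- by case=> [c|x] [c'|x'] //=.
- by case=> [c|x] //=.
Qed.

Lemma parC X Y : isomorphic (par X Y) (par Y X).
Proof.
pose sw (S T : Type) (u : S + T) : T + S :=
  match u with inl c => inr c | inr x => inl x end.
apply: (isoI (X := par X Y) (Y := par Y X) (f := @sw X Y) (g := @sw Y X)).
- by case.
- by case.
- by case=> [c|x] [c'|x'] //=; rewrite !inE.
- by case.
Qed.

Lemma par_iso X X' Y Y' :
  isomorphic X X' -> isomorphic Y Y' -> isomorphic (par X Y) (par X' Y').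
Proof.
move=> iX iY; apply: (iso_trans (Y := par X Y')); first exact: plug_iso.
apply: iso_trans (parC _ _) _; apply: iso_trans (parC _ _).
exact: plug_iso.
Qed.

Lemma plug_plug_iso C (R : {set C}) D (S : {set D}) X :
  isomorphic (plug R (plug S X))
    (@plug _ (plug R D)
       [set z : plug R D | match z with inl c => c \in R | inr d => d \in S end] X).
Proof.
apply: (isoI (X := plug R (plug S X)) (Y := @plug _ (plug R D) _ X)
 (f := fun u : C + (D + X) => match u with inl c => inl (inl c) | inr (inl d) => inl (inr d)
            | inr (inr x) => inr x end)
 (g := fun u : (C + D) + X => match u with inl (inl c) => inl c | inl (inr d) => inr (inl d)
            | inr x => inr (inr x) end)).
- by case=> // -[].
- by case=> // -[].
- by case=> [c|[d|x]] [c'|[d'|x']] //=; rewrite inE.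
- by case=> [c|[d|x]].
Qed.

Lemma parA X Y Z : isomorphic (par X (par Y Z)) (par (par X Y) Z).
Proof.
apply: (isoI (X := par X (par Y Z)) (Y := par (par X Y) Z)
 (f := fun u : X + (Y + Z) => match u with inl c => inl (inl c) | inr (inl d) => inl (inr d)
            | inr (inr x) => inr x end)
 (g := fun u : (X + Y) + Z => match u with inl (inl c) => inl c | inl (inr d) => inr (inl d)
            | inr x => inr (inr x) end)).
- by case=> // -[].
- by case=> // -[].
- by case=> [c|[d|x]] [c'|[d'|x']] //=; rewrite ?inE.
- by case=> [c|[d|x]].
Qed.

Lemma plug0_iso C (R : {set C}) X : #|X| = 0 -> isomorphic C (plug R X).
Proof.
move=> X0; have noX (x : X) : False by have := card0_eq X0 x; rewrite !inE.
apply: (isoI (X := C) (Y := plug R X) (f := fun c => inl c)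
   (g := fun u : C + X => match u with inl c => c | inr x => False_rect C (noX x) end)) => //=.
by case=> // x; case: (noX x).
Qed.

Lemma par0_iso X Y : #|Y| = 0 -> isomorphic X (par X Y).
Proof. exact: plug0_iso. Qed.

Lemma par0x_iso X Y : #|Y| = 0 -> isomorphic X (par Y X).
Proof. by move=> Y0; apply: iso_trans (parC _ _); exact: plug0_iso. Qed.

Lemma card_empty : #|empty_graph V| = 0.
Proof. exact: card_void. Qed.

End Iso.
#[global] Hint Resolve iso_refl : core.

(** * Reflexive normalisation of iterated pars *)

Section ParAC.
Variable V : Type.

Inductive pexp := PE | PV of nat | PP of pexp & pexp.

Fixpoint peval (env : seq (graph V)) e : graph V :=
  match e with
  | PE => empty_graph V
  | PV n => nth (empty_graph V) env n
  | PP a b => par (peval env a) (peval env b)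
  end.

Fixpoint pflat e : seq nat :=
  match e with PE => [::] | PV n => [:: n] | PP a b => pflat a ++ pflat b end.

Definition pars (env : seq (graph V)) (s : seq nat) :=
  foldr (fun n g => par (nth (empty_graph V) env n) g) (empty_graph V) s.

Lemma pars_cat env s t : isomorphic (pars env (s ++ t)) (par (pars env s) (pars env t)).
Proof.
elim: s => [|n s IH] /=; first exact: par0x_iso (card_empty V).
by apply: iso_trans (parA _ _ _); exact: par_iso.
Qed.

Lemma peval_pars env e : isomorphic (peval env e) (pars env (pflat e)).
Proof.
elim: e => [|n|a IHa b IHb] //=; first exact: par0_iso (card_empty V).
by apply: iso_trans (iso_sym (pars_cat _ _ _)); exact: par_iso.
Qed.

Lemma pars_perm env s t : perm_eq s t -> isomorphic (pars env s) (pars env t).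
Proof.
move=> st; move: (iso_refl (pars env s)).
(* Permutations are generated by exchanging consecutive blocks, so a single use of [parC] between
   reassociations suffices. *)
apply: (catCA_perm_ind (P := fun t => isomorphic (pars env s) (pars env t)) _ st).
move=> s1 s2 s3 /iso_trans; apply.
apply: iso_trans (pars_cat _ _ _) _; apply: iso_trans (iso_sym (pars_cat _ _ _)).
apply: iso_trans (par_iso (iso_refl _) (pars_cat _ _ _)) _.
apply: iso_trans (iso_sym (par_iso (iso_refl _) (pars_cat _ _ _))).
apply: iso_trans (parA _ _ _) _; apply: iso_trans (iso_sym (parA _ _ _)).
exact: par_iso (parC _ _) (iso_refl _).
Qed.

Lemma pexp_iso env a b :
  perm_eq (pflat a) (pflat b) -> isomorphic (peval env a) (peval env b).
Proof.
move=> /(pars_perm env) h; apply: iso_trans (peval_pars _ _) _.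
by apply: iso_trans h _; apply: iso_sym; exact: peval_pars.
Qed.
End ParAC.

Ltac pac_mem x l :=
  match l with nil => constr:(false) | x :: _ => constr:(true) | _ :: ?t => pac_mem x t end.
Ltac pac_collect t l :=
  match t with
  | par ?a ?b => let l1 := pac_collect a l in pac_collect b l1
  | empty_graph _ => l
  | _ => match pac_mem t l with true => l | false => constr:(t :: l) end
  end.
Ltac pac_idx x l :=
  match l with x :: _ => constr:(O) | _ :: ?t => let n := pac_idx x t in constr:(S n) end.
Ltac pac_reify t l :=
  match t with
  | par ?a ?b => let a1 := pac_reify a l in let b1 := pac_reify b l in constr:(PP a1 b1)
  | empty_graph _ => constr:(PE)
  | _ => let n := pac_idx t l in constr:(PV n)
  end.
(* Isomorphism of iterated pars up to associativity, commutativity and unit. *)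
Ltac par_ac :=
  match goal with |- @isomorphic ?V ?X ?Y =>
    let l := pac_collect X (@nil (graph V)) in
    let l := pac_collect Y l in
    let a := pac_reify X l in let b := pac_reify Y l in
    change (isomorphic (peval l a) (peval l b)); exact: pexp_iso
  end.

(** * Closure properties of derivations and provability *)

Section Der.
Variable V : Type.
Implicit Types X Y Z G H K C D : graph V.

Lemma der_refl X : GSder X X.
Proof. exact: rt1n_refl. Qed.

Lemma der_trans Y X Z : GSder X Y -> GSder Y Z -> GSder X Z.
Proof. by elim=> // a b c s _ IH /IH; exact: rt1n_trans. Qed.

Lemma der_step X Y : step (@GS V) X Y -> GSder X Y.
Proof. by move=> s; exact: rt1n_trans s (rt1n_refl _ _ _). Qed.

Lemma der_iso X Y : isomorphic X Y -> GSder X Y.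
Proof. by move=> i; apply: der_step; exact: StepIso. Qed.

Lemma der_plug C (R : {set C}) X Y : GSder X Y -> GSder (plug R X) (plug R Y).
Proof.
elim=> [x|x y z s _ IH]; first exact: der_refl.
apply: der_trans IH; case: s => [G H i|D S A B r].
  by apply: der_iso; exact: plug_iso.
apply: der_trans (der_iso (plug_plug_iso _ _ _)) _.
apply: der_trans (der_iso (iso_sym (plug_plug_iso _ _ _))).
by apply: der_step; exact: StepRule.
Qed.

Lemma der_rule X Y : GS X Y -> GSder X Y.
Proof.
move=> r; pose E := empty_graph V.
have i Z : isomorphic Z (@plug V E set0 Z) by apply: par0x_iso; exact: card_empty.
apply: der_trans (der_iso (i X)) _; apply: der_trans (der_iso (iso_sym (i Y))).
by apply: der_step; exact: StepRule.
Qed.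

Lemma der_par X X' Y Y' : GSder X X' -> GSder Y Y' -> GSder (par X Y) (par X' Y').
Proof.
move=> dX dY; apply: (der_trans (Y := par X Y')); first exact: der_plug.
apply: der_trans (der_iso (parC _ _)) _; apply: der_trans (der_iso (parC _ _)).
exact: der_plug.
Qed.

Lemma prov_der X Y : prov X -> GSder X Y -> prov Y.
Proof. exact: der_trans. Qed.

Lemma prov_iso X Y : isomorphic X Y -> prov X -> prov Y.
Proof. by move=> i p; apply: prov_der p (der_iso i). Qed.

Lemma prov_empty X : #|X| = 0 -> prov X.
Proof.
move=> X0; apply: prov_der (der_refl _) (der_iso _).
by apply: iso_trans (par0_iso _ X0) _; apply: iso_trans (parC _ _) (iso_sym _);
   apply: par0_iso; exact: card_empty.
Qed.

(** The empty graph can be plugged in along any [R], and a proof of [X] then runs inside the context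
    [C]. This is all that ss up asks for once the factors of its premise are known to be
    provable. *)
Lemma prov_plug C (R : {set C}) X : prov C -> prov X -> prov (plug R X).
Proof.
move=> pC pX; apply: prov_der pC _.
apply: der_trans (der_iso (plug0_iso R (card_empty V))) _.
exact: der_plug.
Qed.

Lemma prov_par X Y : prov X -> prov Y -> prov (par X Y).
Proof. exact: prov_plug. Qed.

(** In the degenerate cases, [A] or [S] empty, both graphs are isomorphic, so later uses of ss need
    no case distinction. *)
Lemma der_ss (B A : graph V) (S : {set B}) : GSder (plug S A) (par B A).
Proof.
case: (posnP #|A|) => [A0|A0].
  by apply: der_iso; apply: iso_trans (iso_sym (plug0_iso _ A0)) (plug0_iso _ A0).
have [->|S0] := eqVneq S set0; first exact: der_refl.
by apply: der_rule; apply: Or32; exact: SsDown.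
Qed.

End Der.

(** * Induced subgraphs and changes of edges *)

Section Sub.
Variable V : Type.
Implicit Types X Y Z G H K C D : graph V.

Lemma sub_edge_sym G (A : {set G}) : symmetric (fun x y : {x : G | x \in A} => edge (val x) (val y)).
Proof. by move=> x y; exact: edge_sym. Qed.

Lemma sub_edge_irrefl G (A : {set G}) :
  irreflexive (fun x y : {x : G | x \in A} => edge (val x) (val y)).
Proof. by move=> x; exact: edge_irrefl. Qed.

Definition sub G (A : {set G}) : graph V :=
  Graph (fun x : {x : G | x \in A} => label (val x)) (@sub_edge_sym G A) (@sub_edge_irrefl G A).

(** Symmetry and irreflexivity are forced, so that any boolean relation describes a graph on the
    vertices of [G]. Premise and conclusion of a rule can then share one vertex type. *)
Definition regraph_edge G (e : rel G) (x y : G) := (x != y) && (e x y || e y x).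

Lemma regraph_edge_sym G (e : rel G) : symmetric (regraph_edge e).
Proof. by move=> x y; rewrite /regraph_edge eq_sym orbC. Qed.

Lemma regraph_edge_irrefl G (e : rel G) : irreflexive (regraph_edge e).
Proof. by move=> x; rewrite /regraph_edge eqxx. Qed.

Definition regraph G (e : rel G) : graph V :=
  Graph (fun x : G => label x) (regraph_edge_sym e) (regraph_edge_irrefl e).

(** The module condition as an equality of booleans, seen only from the vertices in [Z]. The
    relative form speaks of modules of an induced subgraph without passing to a subtype. *)
Definition homog G (A Z : {set G}) :=
  forall z a b, z \in Z -> z \notin A -> a \in A -> b \in A -> edge z a = edge z b.

Definition apart G (A B : {set G}) := forall a b, a \in A -> b \in B -> ~~ edge a b.

Lemma apartC G (A B : {set G}) : apart A B -> apart B A.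
Proof. by move=> h a b ha hb; rewrite edge_sym h. Qed.

Lemma sub_iso_via (T : eqType) X Y (A : {set X}) (B : {set Y}) (f : X -> T) (g : Y -> T) :
  {in A &, injective f} -> {in B &, injective g} ->
  (forall x, x \in A -> exists2 y, y \in B & f x = g y) ->
  (forall y, y \in B -> exists2 x, x \in A & f x = g y) ->
  (forall x x' y y', x \in A -> x' \in A -> y \in B -> y' \in B ->
     f x = g y -> f x' = g y' -> edge x x' = edge y y') ->
  (forall x y, x \in A -> y \in B -> f x = g y -> label x = label y) ->
  isomorphic (sub A) (sub B).
Proof.
move=> fi gi fg gf ed lb.
apply: (iso_via (T := T) (f := fun x : sub A => f (val x)) (g := fun y : sub B => g (val y))).
- by move=> [x xA] [y yA] /= /fi -/(_ xA yA) e; apply: val_inj.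
- by move=> [x xA] [y yA] /= /gi -/(_ xA yA) e; apply: val_inj.
- by move=> [x xA] /=; have [y yB ->] := fg x xA; exists (exist _ y yB).
- by move=> [y yB] /=; have [x xA <-] := gf y yB; exists (exist _ x xA).
- by move=> [x xA] [x' xA'] [y yB] [y' yB'] /=; exact: ed.
- by move=> [x xA] [y yB] /=; exact: lb.
Qed.

Lemma sub_iso X Y (f : X -> Y) (A : {set X}) (B : {set Y}) :
  {in A &, injective f} -> (forall x, x \in A -> f x \in B) ->
  (forall y, y \in B -> exists2 x, x \in A & f x = y) ->
  {in A &, forall x y, edge (f x) (f y) = edge x y} ->
  {in A, forall x, label (f x) = label x} ->
  isomorphic (sub A) (sub B).
Proof.
move=> fi fA fB ed lb; apply: (sub_iso_via (T := Y) (f := f) (g := id)) => //.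
- by move=> x xA; exists (f x) => //; exact: fA.
- by move=> x x' y y' xA xA' _ _ <- <-; rewrite ed.
- by move=> x y xA _ <-; rewrite lb.
Qed.

Lemma emb_iso X Y (f : X -> Y) (B : {set Y}) :
  injective f -> (forall x, f x \in B) -> (forall y, y \in B -> exists x, f x = y) ->
  (forall x y, edge (f x) (f y) = edge x y) -> (forall x, label (f x) = label x) ->
  isomorphic X (sub B).
Proof.
move=> fi fA fB ed lb.
apply: (iso_via (T := Y) (f := f) (g := fun y : sub B => val y)) => //.
- exact: val_inj.
- by move=> x; exists (exist _ (f x) (fA x)).
- by move=> [y yB] /=; exact: fB.
- by move=> x x' y y' e e'; rewrite /= -e -e' ed.
- by move=> x y e; rewrite /= -e lb.
Qed.

Lemma subT_iso X : isomorphic (sub [set: X]) X.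
Proof.
apply: iso_sym; apply: (emb_iso (f := id)) => // y _; by exists y.
Qed.

Lemma subsub_iso X (A B : {set X}) (B' : {set sub A}) :
  B \subset A -> (forall x : sub A, (x \in B') = (val x \in B)) ->
  isomorphic (sub B') (sub B).
Proof.
move=> /subsetP sBA eB; apply: (sub_iso (X := sub A) (Y := X) (f := val)) => //.
- by move=> x y _ _ /val_inj.
- by move=> x; rewrite eB.
- by move=> y yB; exists (exist _ y (sBA y yB)) => //; rewrite eB.
Qed.

Lemma card_sub X (A : {set X}) : #|sub A| = #|A|.
Proof. by rewrite card_sig; apply: eq_card => x; rewrite !inE. Qed.

Lemma sub0_prov X (A : {set X}) : A = set0 -> prov (sub A).
Proof. by move=> ->; apply: prov_empty; rewrite card_sub cards0. Qed.

Lemma regraph_id X (e : rel X) :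
  (forall x y, regraph_edge e x y = edge x y) -> isomorphic (regraph e) X.
Proof.
by move=> h; apply: (isoI (X := regraph e) (Y := X) (f := id) (g := id)) => // x y; rewrite /= h.
Qed.

Lemma sub_cut X (A B : {set X}) :
  apart A B -> [disjoint A & B] -> isomorphic (sub (A :|: B)) (par (sub A) (sub B)).
Proof.
move=> ap dj.
apply: iso_sym; apply: (emb_iso (X := par (sub A) (sub B)) (Y := X)
  (f := fun u : sub A + sub B => match u with inl c => val c | inr d => val d end)).
- case=> [[x xA]|[x xA]] [[y yA]|[y yA]] //= e; subst.
  + by congr inl; apply: val_inj.
  + by exfalso; have := disjointFr dj xA; rewrite yA.
  + by exfalso; have := disjointFr dj yA; rewrite xA.
  + by congr inr; apply: val_inj.
- by case=> [[x xA]|[x xA]] /=; rewrite inE xA ?orbT.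
- move=> y; rewrite inE => /orP[yA|yA].
    by exists (inl (exist _ y yA)).
  by exists (inr (exist _ y yA)).
- case=> [[x xA]|[x xA]] [[y yA]|[y yA]] //=; rewrite inE; apply/negbTE.
    exact: ap.
  by rewrite edge_sym ap.
- by case=> [[x xA]|[x xA]].
Qed.

Lemma sub_cutD X (A Z : {set X}) :
  A \subset Z -> apart A (Z :\: A) -> isomorphic (sub Z) (par (sub A) (sub (Z :\: A))).
Proof.
move=> sAZ ap; rewrite -{1}(setID Z A) (setIidPr sAZ); apply: sub_cut => //.
by apply/pred0P=> x /=; rewrite !inE; case: (x \in A).
Qed.

Lemma whole_cut X (A : {set X}) :
  apart A (~: A) -> isomorphic X (par (sub A) (sub (~: A))).
Proof.
move=> ap; apply: iso_trans (iso_sym (subT_iso X)) _; rewrite -setTD.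
by apply: sub_cutD => //; rewrite ?subsetT // setTD.
Qed.

Definition nbrs X (A : {set X}) (B : {set X}) : {set sub B} :=
  [set c : sub B | [exists y in A, edge (val c) y]].

(** A vertex outside a module is adjacent to all of it or to none, so the module sits in a context
    whose attachment set is [nbrs]. *)
Lemma sub_plug X (A : {set X}) :
  homog A setT -> isomorphic X (plug (nbrs A (~: A)) (sub A)).
Proof.
move=> hA; apply: iso_sym; apply: iso_trans (subT_iso X).
have nb (x y : X) (xA : x \in ~: A) (yA : y \in A) :
    (exist _ x xA \in nbrs A (~: A)) = edge x y.
  rewrite inE /=; apply/exists_inP/idP => [[z zA xz]|xy]; last by exists y.
  by rewrite (hA x y z) //; move: xA; rewrite inE.
apply: (emb_iso (X := plug (nbrs A (~: A)) (sub A)) (Y := X)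
  (f := fun u : sub (~: A) + sub A => match u with inl c => val c | inr d => val d end)).
- case=> [[x xA]|[x xA]] [[y yA]|[y yA]] //= e; subst.
  + by congr inl; apply: val_inj.
  + by exfalso; move: xA; rewrite inE yA.
  + by exfalso; move: yA; rewrite inE xA.
  + by congr inr; apply: val_inj.
- by move=> x; rewrite inE.
- move=> y _; have [yA|yA] := boolP (y \in A); first by exists (inr (exist _ y yA)).
  have yA' : y \in ~: A by rewrite inE.
  by exists (inl (exist _ y yA')).
- case=> [[x xA]|[x xA]] [[y yA]|[y yA]] //=; first by rewrite (nb _ _ _ yA).
  by rewrite (nb _ _ _ xA) edge_sym.
- by case=> [[x xA]|[x xA]].
Qed.

Lemma detach X (A : {set X}) : homog A setT -> GSder X (par (sub (~: A)) (sub A)).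
Proof. by move=> /sub_plug/der_iso h; apply: der_trans h _; exact: der_ss. Qed.

(** A converse of [detach] at the level of provability: the proof of [A] runs inside its complement,
    at the place of the module. *)
Lemma insert X (A : {set X}) : homog A setT -> prov (sub A) -> prov (sub (~: A)) -> prov X.
Proof. by move=> /sub_plug/iso_sym h pA pB; apply: prov_iso h (prov_plug _ _ _). Qed.

Definition presub X (Z A : {set X}) : {set sub Z} := [set x | val x \in A].

Lemma presub_iso X (Z A : {set X}) : A \subset Z -> isomorphic (sub (presub Z A)) (sub A).
Proof. by move=> sA; apply: subsub_iso => // x; rewrite inE. Qed.

Lemma presubC_iso X (Z A : {set X}) : isomorphic (sub (~: presub Z A)) (sub (Z :\: A)).
Proof.
apply: subsub_iso => [|x]; first exact: subsetDl.
by rewrite !inE (valP x) andbT.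
Qed.

Lemma homog_presub X (Z A : {set X}) : homog A Z -> homog (presub Z A) setT.
Proof. by move=> h z a b _; rewrite !inE => zA aA bA; apply: h => //; exact: valP. Qed.

Lemma detach_in X (A Z : {set X}) :
  A \subset Z -> homog A Z -> GSder (sub Z) (par (sub (Z :\: A)) (sub A)).
Proof.
move=> sA /homog_presub/detach h; apply: der_trans h _; apply: der_iso.
by apply: par_iso; [exact: presubC_iso | exact: presub_iso].
Qed.

Lemma plug_pull C (R : {set C}) K X : GSder (plug R (par K X)) (par (plug R X) K).
Proof.
apply: der_trans (der_iso (plug_iso _ (parC _ _))) _.
by apply: der_trans (der_iso (plug_plug_iso _ _ _)) _; exact: der_ss.
Qed.

(** The proof of [par K1 (sub A)] runs at the place of [A] in [Z]. This attaches [K1] to the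
    neighbours of [A] as well, and [plug_pull] detaches it again by ss. Two separate proofs are thus
    combined around a module. *)
Lemma insert_par X (A Z : {set X}) K1 K2 : A \subset Z -> homog A Z ->
  prov (par K1 (sub A)) -> prov (par K2 (sub (Z :\: A))) ->
  prov (par (par K1 K2) (sub Z)).
Proof.
move=> sA h pA pB.
pose C := par K2 (sub (Z :\: A)).
(* The neighbours of [A] are taken in [Z :\: A] only, none in [K2]. *)
pose R : {set C} := [set c : K2 + sub (Z :\: A) |
  match c with inl _ => false | inr z => [exists y in A, edge (val z) y] end].
apply: (prov_der (prov_plug R pB pA)); apply: der_trans (plug_pull _ _ _) _.
apply: (der_trans (Y := par (par K2 (sub Z)) K1)); last by apply: der_iso; par_ac.
apply: der_par (der_refl _); apply: der_iso.
have nb (x y : X) (xA : x \in Z :\: A) (yA : y \in A) :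
    [exists y in A, edge x y] = edge x y.
  apply/exists_inP/idP => [[z zA xz]|xy]; last by exists y.
  by move: xA; rewrite inE => /andP[xA xZ]; rewrite (h x y z).
apply: (iso_via (T := (K2 + X)%type) (X := plug R (sub A)) (Y := par K2 (sub Z))
  (f := fun u : (K2 + sub (Z :\: A)) + sub A => match u with inl (inl k) => inl k
     | inl (inr d) => inr (val d) | inr d => inr (val d) end)
  (g := fun u : K2 + sub Z => match u with inl k => inl k | inr d => inr (val d) end)).
- case=> [[k|[x xA]]|[x xA]] [[k'|[y yA]]|[y yA]] //= [] e; subst => //.
  + by congr (inl (inr _)); apply: val_inj.
  + by exfalso; move: xA; rewrite inE yA.
  + by exfalso; move: yA; rewrite inE xA.
  + by congr inr; apply: val_inj.
- by case=> [k|[x xA]] [k'|[y yA]] //= [] e; subst => //; congr inr; apply: val_inj.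
- case=> [[k|[x xA]]|[x xA]] /=; first by exists (inl k).
    by have xZ : x \in Z by [move: (xA); rewrite inE => /andP[]]; exists (inr (exist _ x xZ)).
  by have xZ := subsetP sA x xA; exists (inr (exist _ x xZ)).
- case=> [k|[x xZ]] /=; first by exists (inl (inl k)).
  have [xA|xA] := boolP (x \in A); first by exists (inr (exist _ x xA)).
  have xD : x \in Z :\: A by rewrite inE xA.
  by exists (inl (inr (exist _ x xD))).
- case=> [[k|[x xA]]|[x xA]] [[k'|[x' xA']]|[x' xA']] [l|[y yA]] [l'|[y' yA']] //= [] e [] e';
    subst; rewrite ?inE //=; first by rewrite (nb _ _ xA xA').
  by rewrite (nb _ _ xA' xA) edge_sym.
- by case=> [[k|[x xA]]|[x xA]] [l|[y yA]] //= [] e; subst.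
Qed.

End Sub.
Arguments sub {V G} A.

(** * The measure, and replacement of graphs *)

Section Size.
Variable V : Type.
Implicit Types X Y Z G H K C D : graph V.

(* The diagonal is included, so that deleting vertices decreases the count. *)
Definition nonadj X := #|[set p : X * X | ~~ edge p.1 p.2]|.

(** Edges are only reflected: from [X] to [Y] vertices may appear and edges may disappear, as from
    the premise to the conclusion of a rule. Such a passage never lowers [nonadj]. *)
Definition injects X Y :=
  exists2 f : X -> Y, injective f & forall x y, edge (f x) (f y) -> edge x y.

Lemma nonadj_inj X Y (f : X -> Y) : injective f ->
  (forall x y, edge (f x) (f y) -> edge x y) -> nonadj X <= nonadj Y.
Proof.
move=> fi fe; pose g (p : X * X) := (f p.1, f p.2).
have gi : injective g by move=> [a b] [c d] [] /fi -> /fi ->.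
rewrite /nonadj -(card_imset _ gi); apply: subset_leq_card; apply/subsetP=> p /imsetP[[a b]].
rewrite inE /= => /negP h ->; rewrite inE /=; apply/negP=> /fe; exact: h.
Qed.

(** The nonadjacent pair [(y1, y2)] can be missed for two reasons, a vertex outside the image of [f]
    or an edge present in [X]; the last hypothesis covers both. *)
Lemma nonadj_inj_lt X Y (f : X -> Y) y1 y2 : injective f ->
  (forall x y, edge (f x) (f y) -> edge x y) -> ~~ edge y1 y2 ->
  (forall x1 x2, f x1 = y1 -> f x2 = y2 -> edge x1 x2) -> nonadj X < nonadj Y.
Proof.
move=> fi fe ny h; pose g (p : X * X) := (f p.1, f p.2).
have gi : injective g by move=> [a b] [c d] [] /fi -> /fi ->.
rewrite /nonadj -(card_imset _ gi); apply: proper_card; apply/properP; split.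
  apply/subsetP=> p /imsetP[[a b]].
  rewrite inE /= => /negP nab ->; rewrite inE /=; apply/negP=> /fe; exact: nab.
exists (y1, y2); first by rewrite inE.
apply/negP=> /imsetP[[a b]]; rewrite inE /= => /negP nab [e1 e2].
by apply: nab; exact: h.
Qed.

Lemma injects_nn X Y : injects X Y -> nonadj X <= nonadj Y.
Proof. by case=> f fi fe; exact: nonadj_inj fi fe. Qed.

Lemma injects_card X Y : injects X Y -> #|X| <= #|Y|.
Proof. by case=> f fi _; exact: leq_card fi. Qed.

Lemma injects_refl X : injects X X.
Proof. by exists id. Qed.

Lemma injects_trans Y X Z : injects X Y -> injects Y Z -> injects X Z.
Proof.
case=> f fi fe [g gi ge]; exists (g \o f); first exact: inj_comp.
by move=> x y /= /ge /fe.
Qed.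

Lemma injects_iso X Y : isomorphic X Y -> injects X Y.
Proof.
by case=> f [[g fK gK] fe _]; exists f => [|x y]; [exact: can_inj fK | rewrite fe].
Qed.

Lemma injects_par X X' Y Y' : injects X X' -> injects Y Y' -> injects (par X Y) (par X' Y').
Proof.
case=> f fi fe [g gi ge].
exists (fun u : X + Y => match u with inl x => inl (f x) | inr y => inr (g y) end :> X' + Y').
  by case=> x [] y //= [] => [/fi ->|/gi ->].
by case=> x [] y //=; rewrite ?inE //; [exact: fe | exact: ge].
Qed.

Lemma injects_parl X Y : injects X (par X Y).
Proof. by exists (fun x => inl x :> X + Y) => [x y []|]. Qed.

Lemma injects_parr X Y : injects Y (par X Y).
Proof. by exists (fun x => inr x :> X + Y) => [x y []|]. Qed.

Lemma injects_sub X (A : {set X}) : injects (sub A) X.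
Proof. by exists (fun x : sub A => val x) => [x y /val_inj|]. Qed.

Lemma injects_subS X (A B : {set X}) : A \subset B -> injects (sub A) (sub B).
Proof.
move=> sAB; apply: injects_trans (injects_iso (iso_sym (presub_iso sAB))) _; exact: injects_sub.
Qed.

Lemma nonadj_iso X Y : isomorphic X Y -> nonadj X = nonadj Y.
Proof.
by move=> i; apply/eqP; rewrite eqn_leq !injects_nn //; apply: injects_iso => //; exact: iso_sym.
Qed.

Lemma nonadj_sum X : nonadj X = \sum_(x : X) \sum_(y : X) ~~ edge x y.
Proof.
rewrite /nonadj -sum1_card pair_big /= [RHS]big_mkcond /=.
by rewrite big_mkcond /=; apply: eq_bigr => p _; rewrite inE; case: edge.
Qed.

Lemma nonadj_par X Y : nonadj (par X Y) = nonadj X + nonadj Y + 2 * (#|X| * #|Y|).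
Proof.
rewrite !nonadj_sum big_sumType /=.
have -> : \sum_(x : X) \sum_(y : X + Y) ~~ plug_edge set0 (inl x) y =
          \sum_(x : X) (\sum_(y : X) ~~ edge x y + #|Y|).
  apply: eq_bigr => x _; rewrite big_sumType /=; congr (_ + _).
  by rewrite -sum1_card; apply: eq_bigr => y _; rewrite inE.
have -> : \sum_(x : Y) \sum_(y : X + Y) ~~ plug_edge set0 (inr x) y =
          \sum_(x : Y) (#|X| + \sum_(y : Y) ~~ edge x y).
  apply: eq_bigr => x _; rewrite big_sumType /=; congr (_ + _).
  by rewrite -sum1_card; apply: eq_bigr => y _; rewrite inE.
rewrite !big_split /= !sum_nat_const.
rewrite -/#|X| -/#|Y| [#|Y| * _]mulnC; lia.
Qed.

(** The pairs across a par contribute [2 * (#|X| * #|Y|)], so cardinalities have to be compared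
    along with the measure. *)
Lemma nonadj_par_lt X X' Y Y' : injects X X' -> #|Y| <= #|Y'| -> nonadj Y < nonadj Y' ->
  nonadj (par X Y) < nonadj (par X' Y').
Proof.
move=> s c l; rewrite !nonadj_par; have := injects_nn s; have := injects_card s => h1 h2.
have := leq_mul h1 c; lia.
Qed.

Lemma nonadj_par_ltl X X' Y Y' : injects Y Y' -> #|X| <= #|X'| -> nonadj X < nonadj X' ->
  nonadj (par X Y) < nonadj (par X' Y').
Proof.
by move=> s c l; rewrite (nonadj_iso (parC X Y)) (nonadj_iso (parC X' Y')); exact: nonadj_par_lt.
Qed.

Lemma nonadj_sub_lt X (A B : {set X}) : A \proper B -> nonadj (sub A) < nonadj (sub B).
Proof.
move=> /properP[sAB [b bB bA]].
rewrite -(nonadj_iso (presub_iso sAB)).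
apply: (nonadj_inj_lt (Y := sub B) (X := sub (presub B A)) (f := fun x => val x)
   (y1 := exist _ b bB) (y2 := exist _ b bB)) => //=.
- exact: val_inj.
- by rewrite edge_irrefl.
- by move=> [x xA] x2 /= e _; exfalso; move: xA; rewrite e inE /= (negbTE bA).
Qed.

Definition entails X Y := forall D, prov (par X D) -> prov (par Y D).

(** The injection bounds the measure of a replacement, so that the induction hypothesis still
    applies to it. *)
Definition le X Y := injects X Y /\ entails X Y.

Lemma entails_refl X : entails X X. Proof. by []. Qed.

Lemma entails_trans Y X Z : entails X Y -> entails Y Z -> entails X Z.
Proof. by move=> h1 h2 D /h1/h2. Qed.

Lemma entails_der X Y : GSder X Y -> entails X Y.
Proof. by move=> d D p; apply: prov_der p (der_par d (der_refl _)). Qed.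

Lemma entails_par X X' Y Y' : entails X X' -> entails Y Y' -> entails (par X Y) (par X' Y').
Proof.
move=> h1 h2 D p.
apply: (prov_iso (X := par X' (par Y' D))); first by par_ac.
apply: h1; apply: (prov_iso (X := par Y' (par X D))); first by par_ac.
by apply: h2; apply: prov_iso p; par_ac.
Qed.

Lemma le_refl X : le X X.
Proof. by split; [exact: injects_refl | exact: entails_refl]. Qed.

Lemma le_trans Y X Z : le X Y -> le Y Z -> le X Z.
Proof.
by case=> s1 e1 [s2 e2]; split; [exact: injects_trans s1 s2 | exact: entails_trans e1 e2].
Qed.

Lemma le_par X X' Y Y' : le X X' -> le Y Y' -> le (par X Y) (par X' Y').
Proof.
by case=> s1 e1 [s2 e2]; split; [exact: injects_par | exact: entails_par].
Qed.

Lemma le_iso X Y : isomorphic X Y -> le X Y.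
Proof. by move=> i; split; [exact: injects_iso | apply: entails_der; exact: der_iso]. Qed.

End Size.

(** * Rule instances on the vertex set of the conclusion *)

Section Forward.
Variable V : Type.
Implicit Types X Y Z G H K C D : graph V.

Lemma sub_regraph_base_iso X (e : rel X) (Z : {set X}) :
  {in Z &, forall x y, regraph_edge e x y = edge x y} ->
  isomorphic (@sub V (regraph e) Z) (sub Z).
Proof.
move=> h; apply: (sub_iso (X := regraph e) (Y := X) (f := id)) => // [y yZ|x y xZ yZ].
  by exists y.
by rewrite /= h.
Qed.

(* [regraph e] is the premise of a rule instance whose redex is the module [Y] of [X]. *)
Record reduct X (e : rel X) (Y : {set X}) : Prop := Reduct {
  reduct_homog : homog Y setT;
  reduct_agree : forall x y, ~~ ((x \in Y) && (y \in Y)) -> regraph_edge e x y = edge x y;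
  reduct_more : forall x y, edge x y -> regraph_edge e x y;
  reduct_new : exists x y, ~~ edge x y /\ regraph_edge e x y;
  reduct_der : GSder (@sub V (regraph e) Y) (sub Y) }.

(** The edges change only inside the module [Y], so both graphs place [Y] in the same context. *)
Lemma regraph_plug X (e : rel X) (Y : {set X}) : homog Y setT ->
  (forall x y, ~~ ((x \in Y) && (y \in Y)) -> regraph_edge e x y = edge x y) ->
  isomorphic (regraph e) (plug (nbrs Y (~: Y)) (@sub V (regraph e) Y)).
Proof.
move=> hY ag.
have hY' : @homog V (regraph e) Y setT.
  by move=> z a b zT zY aY bY; rewrite /= !ag ?(negbTE zY) //; exact: hY.
apply: iso_trans (sub_plug hY') _.
pose X1 := plug (nbrs (X := regraph e) Y (~: Y)) (@sub V (regraph e) Y).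
pose X2 := plug (nbrs (X := X) Y (~: Y)) (@sub V (regraph e) Y).
have nb (c : {x : X | x \in ~: Y}) :
    (c \in nbrs (X := regraph e) Y (~: Y)) = (c \in nbrs (X := X) Y (~: Y)).
  have := valP c; rewrite inE => cY; rewrite !inE; apply: eq_existsb => y; congr andb.
  by apply: ag; rewrite (negbTE cY).
apply: (isoI (X := X1) (Y := X2) (f := id) (g := id)) => //.
case=> [c|c] [d|d] //=.
by have := valP c; rewrite inE => cY; symmetry; apply: ag; rewrite (negbTE cY).
Qed.

Lemma regraph_fwd X (e : rel X) (Y : {set X}) : homog Y setT ->
  (forall x y, ~~ ((x \in Y) && (y \in Y)) -> regraph_edge e x y = edge x y) ->
  GSder (@sub V (regraph e) Y) (sub Y) -> GSder (regraph e) X.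
Proof.
move=> hY ag d; apply: der_trans (der_iso (regraph_plug hY ag)) _.
apply: der_trans (der_iso (iso_sym (sub_plug hY))); exact: der_plug.
Qed.

Lemma regraph_sub X (e : rel X) (Z : {set X}) :
  isomorphic (@sub V (regraph e) Z) (@regraph V (sub Z) (fun x y => e (val x) (val y))).
Proof.
apply: (isoI (X := @sub V (regraph e) Z) (Y := @regraph V (sub Z) (fun x y => e (val x) (val y)))
   (f := id) (g := id)) => //.
Qed.

Lemma reduct_sub X (e : rel X) (Y Z : {set X}) : reduct e Y -> Y \subset Z ->
  GSder (@sub V (regraph e) Z) (sub Z).
Proof.
case=> hY ag _ _ d sYZ.
apply: der_trans (der_iso (regraph_sub _ _)) _.
apply: (@regraph_fwd (sub Z) _ (presub Z Y)).
- by apply: homog_presub => z a b _; exact: hY.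
- by move=> x y; rewrite !inE; exact: ag.
- apply: der_trans (der_trans d (der_iso (iso_sym (presub_iso sYZ)))).
  apply: der_iso; apply: iso_trans (presub_iso (X := regraph e) sYZ).
  by apply: (isoI (f := id) (g := id)).
Qed.

Lemma reduct_full X (e : rel X) (Y : {set X}) : reduct e Y -> GSder (regraph e) X.
Proof. by case=> hY ag _ _ d; exact: regraph_fwd hY ag d. Qed.

Lemma reduct_out X (e : rel X) (Y Z : {set X}) : reduct e Y -> [disjoint Y & Z] ->
  isomorphic (@sub V (regraph e) Z) (sub Z).
Proof.
move=> r dj; apply: sub_regraph_base_iso => x y xZ yZ; apply: (reduct_agree r).
by rewrite (disjointFl dj xZ).
Qed.

Lemma reduct_lt X (e : rel X) (Y : {set X}) : reduct e Y -> nonadj (regraph e) < nonadj X.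
Proof.
case=> _ _ mo [x [y [nxy xy]]] _.
apply: (nonadj_inj_lt (X := regraph e) (Y := X) (f := id) (y1 := x) (y2 := y)) => //.
by move=> x1 x2 -> ->.
Qed.

(* Edges of the premise of ss when [A] gets attached to [S]. *)
Definition ss_rel X (A S : {set X}) : rel X := fun x y => edge x y || (x \in A) && (y \in S).

Lemma ss_relE X (A S : {set X}) x y : [disjoint A & S] ->
  regraph_edge (ss_rel A S) x y =
    [|| edge x y, (x \in A) && (y \in S) | (x \in S) && (y \in A)].
Proof.
move=> dj; rewrite /regraph_edge /ss_rel [edge y x]edge_sym.
have [<-|nxy] /= := eqVneq x y.
  rewrite edge_irrefl /=; case xA: (x \in A) => //=; last by rewrite andbF.
  by rewrite (disjointFr dj xA).
by case: edge => //=; rewrite [(y \in A) && _]andbC.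
Qed.

(** In the premise [A] is still a module of the redex, with exactly [S] as its neighbours in [B];
    the rule is thus an instance of detaching a module. *)
Lemma ss_reduct X (A B S : {set X}) :
  apart A B -> [disjoint A & B] -> homog (A :|: B) setT -> S \subset B ->
  A != set0 -> S != set0 -> reduct (ss_rel A S) (A :|: B).
Proof.
move=> ap dj hY sSB /set0Pn[a aA] /set0Pn[s sS].
have sB := subsetP sSB.
have djS : [disjoint A & S] by exact: disjointWr sSB dj.
split=> //.
- move=> x y; rewrite !inE ss_relE // => h; case: edge => //=; apply/negbTE.
  by apply: contra h => /orP[/andP[xA /sB yS]|/andP[/sB xA yS]]; rewrite ?xA ?yS ?orbT.
- by move=> x y xy; rewrite ss_relE // xy.
- exists a, s; rewrite ss_relE // aA sS orbT; split=> //.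
  by apply: ap => //; exact: sB.
have agA : {in A &, forall x y, regraph_edge (ss_rel A S) x y = edge x y}.
  move=> x y xA yA; rewrite ss_relE //.
  by rewrite (disjointFr djS xA) (disjointFr djS yA) andbF orbF.
have agB : {in B &, forall x y, regraph_edge (ss_rel A S) x y = edge x y}.
  move=> x y xB yB; rewrite ss_relE //.
  by rewrite (disjointFl dj xB) (disjointFl dj yB) andbF !orbF.
apply: der_trans (detach_in (X := regraph _) (A := A) (subsetUl _ _) _) _.
  move=> z c d; rewrite !inE => /orP[->//|zB] zA cA dA /=.
  rewrite !ss_relE // (negbTE zA) /= cA dA !andbT.
  by rewrite (negbTE (apartC ap zB cA)) (negbTE (apartC ap zB dA)).
apply: der_iso; apply: iso_trans (iso_sym (sub_cut ap dj)).
apply: iso_trans (parC _ _) _; apply: par_iso; first exact: sub_regraph_base_iso.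
have -> : (A :|: B) :\: A = B.
  apply/setP=> x; rewrite !inE; case xA: (x \in A) => //=.
  by rewrite (disjointFr dj xA).
exact: sub_regraph_base_iso.
Qed.

End Forward.

(** * Prime graphs *)

Section Prime.
Variable V : Type.
Implicit Types P Q X : graph V.

Lemma homog_mod X (M : {set X}) : homog M setT -> is_module M.
Proof.
move=> h x xM; have [->|/set0Pn[a aM]] := eqVneq M set0.
  by left=> y; rewrite inE.
case xa: (edge x a); [left|right] => y yM; first by rewrite (h x y a).
by rewrite (h x y a) // xa.
Qed.

Lemma mod_homog X (M : {set X}) : is_module M -> homog M setT.
Proof.
move=> h z a b _ zM aM bM; case: (h z zM) => k; first by rewrite !k.
by rewrite !(negbTE (k _ _)).
Qed.

Lemma prime_homog P (M : {set P}) : prime_graph P -> homog M setT ->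
  [\/ M = set0, exists x, M = [set x] | M = setT].
Proof. by case=> _ h /homog_mod /h. Qed.

(** If no edge left [Z], both [Z] and its complement would be modules, hence singletons, and the
    graph would have only two vertices. *)
Lemma prime_conn P (Z : {set P}) : prime_graph P -> 3 <= #|P| ->
  Z != set0 -> Z != setT -> exists i j, [/\ i \in Z, j \notin Z & edge i j].
Proof.
move=> pP P3 Z0 ZT.
have [/existsP[i /existsP[j /and3P[iZ jZ ij]]]|no] :=
  boolP [exists i, exists j, [&& i \in Z, j \notin Z & edge i j]]; first by exists i, j.
have ne i j : i \in Z -> j \notin Z -> edge i j = false.
  move=> iZ jZ; apply/negbTE; apply: contra no => ij.
  by apply/existsP; exists i; apply/existsP; exists j; rewrite iZ jZ.
have hZ : homog Z setT.
  by move=> z a b _ zZ aZ bZ; rewrite !(edge_sym z) !ne.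
have hZ' : homog (~: Z) setT.
  by move=> z a b _; rewrite !inE negbK => zZ aZ bZ; rewrite !ne.
case: (prime_homog pP hZ) => [e|[x ex]|e]; try by rewrite e eqxx in Z0 ZT.
case: (prime_homog pP hZ') => [e|[y ey]|e].
- by move: ZT; rewrite -(setCK Z) e setC0 eqxx.
- by have := cardsC Z; rewrite ex -{2}ex ey !cards1 => h; rewrite -h in P3.
- by move: Z0; rewrite -(setCK Z) e setCT eqxx.
Qed.

Lemma prime_dual P : prime_graph P -> prime_graph (dual P).
Proof.
case=> P2 h; split=> // M hM; apply: h => x xM.
have d y : y \in M -> (@edge V (dual P) x y) = ~~ edge x y.
  move=> yM; rewrite /= /dual_edge; case: eqP => //= e.
  by move: xM; rewrite e yM.
case: (hM x xM) => k; [right|left] => y yM; have := k y yM; rewrite d //.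
by rewrite negbK.
Qed.

(** Both the graph and its dual are connected, so in each of them an edge leaves the vertex [i]. *)
Lemma prime_nonconst P (i : P) : prime_graph P -> 3 <= #|P| ->
  exists j k, [/\ j != i, k != i, edge i j & ~~ edge i k].
Proof.
move=> pP P3.
have n0 : [set i] != set0 by apply/set0Pn; exists i; rewrite inE.
have nT : [set i] != setT.
  by apply/eqP=> e; have := cardsT P; rewrite -e cards1 => h; rewrite -h in P3.
have [a [j [/set1P-> ji ij]]] := prime_conn pP P3 n0 nT.
have [a' [k [/set1P-> ki ik]]] := prime_conn (prime_dual pP) P3 n0 nT.
exists j, k; move: ji ki ik; rewrite !inE => -> -> /=.
by rewrite /dual_edge => /andP[_ ->].
Qed.

(** A vertex [i] has a neighbour [j] and a nonneighbour [k]. The nonneighbour of [j] can only be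
    [k], which leaves [k] isolated. Hence a prime quotient has two vertices or falls in the range of
    p. *)
Lemma prime_not3 P : prime_graph P -> #|P| != 3.
Proof.
move=> pP; apply/eqP=> P3.
have /card_gt0P[i _] : 0 < #|P| by rewrite P3.
have [j [k [ji ki ij ik]]] := prime_nonconst i pP (eq_leq (esym P3)).
have jk : j != k by apply: contraNneq ik => <-.
have cov x : [|| x == i, x == j | x == k].
  have : #|[set i; j; k]| = 3.
    by rewrite setUC cardsU1 cards2 !inE (negbTE ki) eq_sym (negbTE jk) eq_sym ji.
  move=> c3; have : x \in [set i; j; k].
    suff -> : [set i; j; k] = setT by rewrite inE.
    by apply/eqP; rewrite eqEcard subsetT cardsT c3 P3.
  by rewrite !inE -orbA.
have [j' [k' [jj kj ejj ejk]]] := prime_nonconst j pP (eq_leq (esym P3)).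
have njk : ~~ edge j k.
  move: (cov k'); rewrite (negbTE kj) => /orP[/eqP e|/eqP <-//].
  by move: ejk; rewrite e edge_sym ij.
have [a [b [ak bk eka _]]] := prime_nonconst k pP (eq_leq (esym P3)).
move: (cov a) eka; rewrite (negbTE ak) orbF => /orP[/eqP->|/eqP->].
  by rewrite edge_sym (negbTE ik).
by rewrite edge_sym (negbTE njk).
Qed.

End Prime.

(** * The rule p on a fixed vertex set *)

Section PRule.
Variable V : Type.
Implicit Types X P : graph V.

(* Edges of the premise of p: the fibres of [q] in the redex [Y] are completely joined. *)
Definition p_rel X (P : finType) (Y : {set X}) (q : X -> P) : rel X :=
  fun x y => edge x y || [&& x \in Y, y \in Y & q x != q y].

Lemma p_relE X (P : finType) (Y : {set X}) (q : X -> P) x y :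
  regraph_edge (p_rel Y q) x y = edge x y || [&& x \in Y, y \in Y & q x != q y].
Proof.
rewrite /regraph_edge /p_rel [edge y x]edge_sym.
have [<-|nxy] /= := eqVneq x y; first by rewrite edge_irrefl eqxx !andbF.
by case: edge => //=; rewrite andbCA eq_sym orbb.
Qed.

Definition fib X (P : finType) (A : {set X}) (q : X -> P) i := [set x in A | q x == i].

Variables (X P : graph V) (q : X -> P) (M N : {set X}).
Hypotheses (apMN : apart M N) (djMN : [disjoint M & N]).

Lemma tensor_fib_iso :
  isomorphic (big_tensor (fun i => par (sub (fib M q i)) (sub (fib N q i))))
             (@sub V (regraph (p_rel (M :|: N) q)) (M :|: N)).
Proof.
pose H i := par (sub (fib M q i)) (sub (fib N q i)).
pose f (u : {i : P & H i}) : X := match tagged u with inl m => val m | inr n => val n end.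
have fY (u : {i : P & H i}) : f u \in M :|: N.
  by case: u => i [[x xi]|[x xi]]; rewrite /f /= inE; move: xi; rewrite inE => /andP[-> _];
   rewrite ?orbT.
have fq (u : {i : P & H i}) : q (f u) = tag u.
  by case: u => i [[x xi]|[x xi]]; rewrite /f /=; move: xi; rewrite inE => /andP[_ /eqP].
have fin i (a b : H i) : f (existT _ i a) = f (existT _ i b) -> a = b.
  case: a b => [[x xi]|[x xi]] [[y yi]|[y yi]]; rewrite /f /= => e; subst.
  - by congr inl; apply: val_inj.
  - by exfalso; move: xi yi; rewrite !inE => /andP[xi _] /andP[yi _]; rewrite (disjointFr djMN xi) in yi.
  - by exfalso; move: xi yi; rewrite !inE => /andP[xi _] /andP[yi _]; rewrite (disjointFr djMN yi) in xi.
  - by congr inr; apply: val_inj.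
apply: (emb_iso (X := big_tensor H) (Y := regraph (p_rel (M :|: N) q)) (f := f)) => //.
- move=> [i a] [j b] e; have := fq (existT _ i a); rewrite e fq /= => ij.
  by subst j; congr existT; exact: fin.
- move=> y; rewrite inE => /orP[yM|yN].
    have yi : y \in fib M q (q y) by rewrite inE yM /=.
    by exists (existT _ (q y) (inl (exist _ y yi) : H (q y))).
  have yi : y \in fib N q (q y) by rewrite inE yN /=.
  by exists (existT _ (q y) (inr (exist _ y yi) : H (q y))).
- move=> u v; rewrite /= p_relE !fY !fq /=.
  rewrite /join_edge; case: (eqVneq (tag u) (tag v)); last by rewrite orbT.
  case: u v => i a [j b] /= ij; subst j; rewrite orbF tagged_asE /f /=.
  case: a b => [[x xi]|[x xi]] [[y yi]|[y yi]] //=; rewrite inE;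
    move: xi yi; rewrite !inE => /andP[xi _] /andP[yi _]; apply/negbTE.
    exact: apMN.
  exact: apartC apMN _ _ _ _.
- by case=> i [[x xi]|[x xi]].
Qed.

(** The quotient is a parameter of its own because p composes over both [P] and its dual. *)
Lemma compose_fib_iso (Q : graph V) (r : X -> Q) (A : {set X}) :
  {in A &, forall x y, r x != r y -> edge x y = edge (r x) (r y)} ->
  isomorphic (compose (fun i : Q => sub (fib A r i))) (sub A).
Proof.
move=> hA; pose H i := sub (fib A r i).
pose f (u : {i : Q & H i}) : X := val (tagged u).
have fY (u : {i : Q & H i}) : f u \in A.
  by case: u => i [x xi]; rewrite /f /=; move: xi; rewrite inE => /andP[-> _].
have fq (u : {i : Q & H i}) : r (f u) = tag u.
  by case: u => i [x xi]; rewrite /f /=; move: xi; rewrite inE => /andP[_ /eqP].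
apply: (emb_iso (X := compose H) (Y := X) (f := f)) => //.
- move=> [i a] [j b] e; have := fq (existT _ i a); rewrite e fq /= => ij.
  by subst j; congr existT; apply: val_inj.
- move=> y yA; have yi : y \in fib A r (r y) by rewrite inE yA /=.
  by exists (existT _ (r y) (exist _ y yi : H (r y))).
- move=> u v; rewrite /= /join_edge; case: (eqVneq (tag u) (tag v)) => e; last first.
    by rewrite hA ?fY // ?fq.
  by case: u v e => i a [j b] /= ij; subst j; rewrite tagged_asE.
Qed.

Lemma p_reduct :
  prime_graph P -> 4 <= #|P| -> homog (M :|: N) setT ->
  (forall i, exists2 x, x \in M & q x = i) ->
  {in M &, forall x y, q x != q y -> edge x y = ~~ edge (q x) (q y)} ->
  {in N &, forall x y, q x != q y -> edge x y = edge (q x) (q y)} ->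
  reduct (p_rel (M :|: N) q) (M :|: N).
Proof.
move=> pP P4 hY sM eM eN; split=> //.
- by move=> x y h; rewrite p_relE andbA (negbTE h) orbF.
- by move=> x y xy; rewrite p_relE xy.
(* An edge of [P] is a nonedge of the dual, the quotient of [M]. As every block of [M] is inhabited,
   p really adds an edge. *)
- have /card_gt0P[i _] : 0 < #|P| by exact: leq_trans P4.
  have [j [_ [ji _ ij _]]] := prime_nonconst i pP (ltnW P4).
  have [x xM qx] := sM i; have [y yM qy] := sM j; exists x, y.
  rewrite p_relE !inE xM yM qx qy eq_sym ji orbT; split=> //.
  by rewrite eM // qx qy ?negbK // eq_sym.
apply: der_trans (der_iso (iso_sym tensor_fib_iso)) _.
apply: (der_trans (Y := par (compose (G := dual P) (fun i => sub (fib M q i)))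
   (compose (fun i => sub (fib N q i))))).
  apply: der_rule; apply: Or33; apply: PDown => // i.
  rewrite /nonempty card_sub; have [x xM qx] := sM i.
  by apply/card_gt0P; exists x; rewrite inE xM qx /=.
apply: der_iso; apply: iso_trans (iso_sym (sub_cut apMN djMN)).
apply: par_iso; last exact: compose_fib_iso.
apply: (@compose_fib_iso (dual P)) => x y xM yM nq.
by rewrite /= /dual_edge nq eM.
Qed.

End PRule.

(** * Detaching blocks from a quotient *)

Section Pull.
Variable V : Type.
Implicit Types X P : graph V.

Lemma sub_regraph_iso X (e1 e2 : rel X) (Z : {set X}) :
  {in Z &, forall x y, regraph_edge e1 x y = regraph_edge e2 x y} ->
  isomorphic (@sub V (regraph e1) Z) (@sub V (regraph e2) Z).
Proof.
move=> h; apply: (sub_iso (X := regraph e1) (Y := regraph e2) (f := id)) => // [y yZ|x y xZ yZ].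
  by exists y.
by rewrite /= h.
Qed.

(** [D] collects the vertices already detached: outside it the edges of the quotient are added, and
    the empty [D] gives the fully attached graph. *)
Definition pull_rel X P (r : X -> P) (D : {set X}) : rel X :=
  fun x y => edge x y || [&& x \notin D, y \notin D & edge (r x) (r y)].

Lemma pull_relE X P (r : X -> P) (D : {set X}) x y :
  regraph_edge (pull_rel r D) x y = edge x y || [&& x \notin D, y \notin D & edge (r x) (r y)].
Proof.
rewrite /regraph_edge /pull_rel [edge y x]edge_sym [edge (r y) _]edge_sym.
have [<-|nxy] /= := eqVneq x y; first by rewrite !edge_irrefl !andbF.
by case: edge => //=; rewrite andbCA orbb.
Qed.

(** The blocks of [D] are detached one at a time by ss. A block still attached is a module, since
    its neighbours outside depend only on its image in the quotient. *)
Lemma pull X P (r : X -> P) (D : {set X}) :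
  apart D (~: D) -> {in D &, forall x y, r x != r y -> ~~ edge x y} ->
  {in ~: D &, forall x y, r x != r y -> edge x y = edge (r x) (r y)} ->
  GSder (regraph (pull_rel r set0)) X.
Proof.
move=> apD eD eN; pose Ds s := [set x in D | r x \in (s : seq P)].
have main s : GSder (regraph (pull_rel r set0)) (regraph (pull_rel r (Ds s))).
  elim: s => [|i s IH].
    have -> : Ds [::] = set0 by apply/setP=> x; rewrite !inE andbF.
    exact: der_refl.
  apply: der_trans IH _; have [iS|iS] := boolP (i \in s).
    have -> : Ds (i :: s) = Ds s.
      by apply/setP=> x; rewrite !inE; case: eqP => // ->; rewrite iS.
    exact: der_refl.
  pose A := [set x in D | r x == i].
  have nDA z a : z \notin A -> a \in A -> edge z a = false.
    rewrite !inE; case zD: (z \in D) => /= zi /andP[aD /eqP ai]; apply/negbTE.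
      by apply: eD => //; rewrite ai.
    by rewrite edge_sym apD // inE zD.
  apply: der_trans (detach (X := regraph _) (A := A) _) _.
    move=> z a b _ zA aA bA; rewrite /= !pull_relE !nDA //.
    by move: aA bA; rewrite !inE => /andP[aD /eqP->] /andP[bD /eqP->]; rewrite (negbTE iS) !andbF.
  have ap : @apart V (regraph (pull_rel r (Ds (i :: s)))) A (~: A).
    move=> a z aA; rewrite inE => zA.
    rewrite /= pull_relE edge_sym nDA //=.
    by move: aA; rewrite !inE => /andP[-> /eqP->]; rewrite eqxx.
  apply: der_iso; apply: iso_trans (iso_sym (whole_cut ap)).
  apply: iso_trans (parC _ _) _; apply: par_iso; apply: sub_regraph_iso => x y.
    rewrite !inE => /andP[xD /eqP xi] /andP[yD /eqP yi].
    by rewrite !pull_relE xi yi edge_irrefl !andbF.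
  rewrite !inE => xA yA; rewrite !pull_relE !inE.
  move: xA yA; case: (x \in D); case: (y \in D) => //= xA yA;
    by rewrite ?(negbTE xA) ?(negbTE yA).
apply: der_trans (main (enum P)) _; apply: der_iso; apply: regraph_id => x y.
rewrite pull_relE !inE !mem_enum !inE !andbT.
have [//|ned /=] := boolP (edge x y); apply/negbTE/and3P => -[xD yD rxy].
have rn : r x != r y by apply: contraTneq rxy => ->; rewrite edge_irrefl.
by move: ned; rewrite eN ?inE // rxy.
Qed.

End Pull.

(** * Block-wise provability *)

Section Id.
Variable V : Type.
Implicit Types X P Q : graph V.

Lemma fib_sub_iso X (T : eqType) (f : X -> T) (Z : {set X}) i :
  isomorphic (sub [set x : sub Z | f (val x) == i]) (sub [set x in Z | f x == i]).
Proof.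
apply: subsub_iso => [|x]; first by apply/subsetP=> x; rewrite inE => /andP[].
by rewrite !inE (valP x).
Qed.

Lemma complete_prov X (I : finType) (r : X -> I) :
  (forall x y, r x != r y -> edge x y) -> (forall i, prov (sub [set x | r x == i])) -> prov X.
Proof.
have [n] := ubnP #|X|; elim: n X r => // n IH X r cX er pr.
have [/card0_eq X0|/card_gt0P[x0 _]] := posnP #|X|; first by apply/prov_empty/eq_card0.
pose A := [set x | r x == r x0].
apply: (insert (A := A)); [|exact: pr|].
  by move=> z a b _; rewrite !inE => zA /eqP aA /eqP bA; rewrite !er // ?aA ?bA.
apply: (IH (sub (~: A)) (fun x => r (val x))) => [|x y|i].
- rewrite card_sub; rewrite ltnS in cX; apply: leq_trans cX.
  rewrite -(cardsC A) -[X in X < _]add0n ltn_add2r.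
  by apply/card_gt0P; exists x0; rewrite inE.
- exact: er.
- apply: prov_iso (iso_sym (fib_sub_iso r _ i)) _.
  have [->|ni] := eqVneq i (r x0).
    by apply: sub0_prov; apply/setP=> x; rewrite !inE; case: eqP.
  suff -> : [set x in ~: A | r x == i] = [set x | r x == i] by [].
  by apply/setP=> x; rewrite !inE; case: (eqVneq (r x) i) => [->|]; rewrite ?ni ?andbT ?andbF.
Qed.

Definition homogb X (A Z : {set X}) :=
  [forall z in Z, [forall a in A, [forall b in A, (z \notin A) ==> (edge z a == edge z b)]]].

Lemma homogP X (A Z : {set X}) : reflect (homog A Z) (homogb A Z).
Proof.
apply: (iffP forall_inP) => [h z a b zZ zA aA bA | h z zZ].
  move/forall_inP: (h z zZ) => /(_ a aA)/forall_inP/(_ b bA)/implyP/(_ zA)/eqP; exact.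
apply/forall_inP=> a aA; apply/forall_inP=> b bA; apply/implyP=> zA; apply/eqP; exact: h.
Qed.

(** The dichotomy behind every reduction to prime quotients: a set of representatives is prime, or
    it has a nontrivial module to be merged. *)
Lemma prime_or_module X (J : {set X}) : 2 <= #|J| ->
  (exists T : {set X}, [/\ T \subset J, 1 < #|T|, #|T| < #|J| & homog T J]) \/
  prime_graph (sub J).
Proof.
move=> J2.
have [/existsP[T /and4P[h1 h2 h3 /homogP h4]]|no] :=
  boolP [exists T : {set X}, [&& T \subset J, 1 < #|T|, #|T| < #|J| & homogb T J]].
  by left; exists T.
right; split; first by rewrite card_sub.
move=> M /mod_homog hM; pose T := [set val x | x in M].
have sT : T \subset J by apply/subsetP=> _ /imsetP[x _ ->]; exact: valP.
have cT : #|T| = #|M| by apply: card_imset; exact: val_inj.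
have hT : homog T J.
  move=> z _ _ zJ zT /imsetP[a aM ->] /imsetP[b bM ->].
  apply: (hM (exist _ z zJ)) => //; apply: contra zT => zM.
  by apply/imsetP; exists (exist _ z zJ).
case: (ltngtP #|M| 1) => [|M2|/eqP/cards1P[x ->]].
- by rewrite ltnS leqn0 cards_eq0 => /eqP->; constructor 1.
- constructor 3; apply/eqP; rewrite eqEcard subsetT cardsT card_sub leqNgt.
  apply: contra no => lt; apply/existsP; exists T; rewrite sT cT M2 lt /=.
  exact/homogP.
- by constructor 2; exists x.
Qed.

(* [K] has quotient [dual Q] and its complement has quotient [Q], as in the
   conclusion of p, but [Q] need not be prime and fibres may be empty. *)
Definition idsys X Q (r : X -> Q) (K : {set X}) :=
  [/\ apart K (~: K),
      {in K &, forall x y, r x != r y -> edge x y = ~~ edge (r x) (r y)} &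
      {in ~: K &, forall x y, r x != r y -> edge x y = edge (r x) (r y)}].

Lemma idsys_sub X Q (r : X -> Q) (K Z : {set X}) :
  idsys r K -> idsys (fun x : sub Z => r (val x)) (presub Z K).
Proof.
case=> ap eK eN; split.
- by move=> x y; rewrite !inE => xK yK; apply: ap; rewrite ?inE.
- by move=> x y; rewrite !inE => xK yK; exact: eK.
- by move=> x y; rewrite !inE => xK yK; apply: eN; rewrite inE.
Qed.

Lemma idsys_dual X Q (r : X -> Q) (K : {set X}) :
  idsys r K -> @idsys X (dual Q) r (~: K).
Proof.
case=> ap eK eN; split; rewrite ?setCK.
- exact: apartC.
- by move=> x y xK yK n; rewrite /= /dual_edge n negbK; exact: eN.
- by move=> x y xK yK n; rewrite /= /dual_edge n; exact: eK.
Qed.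

(** A block without vertices in [K] has no edges to [K] and is joined to the rest as [Q] prescribes,
    hence it is a module. *)
Lemma idsys_insert X Q (r : X -> Q) (K : {set X}) i :
  idsys r K -> [set x | r x == i] \subset ~: K ->
  prov (sub [set x | r x == i]) -> prov (sub (~: [set x | r x == i])) -> prov X.
Proof.
case=> ap eK eN /subsetP sK; apply: insert => z a b _ zA aA bA.
move: (sK a aA) (sK b bA); move: zA aA bA; rewrite !inE => zi /eqP ai /eqP bi aK bK.
have [zK|zK] := boolP (z \in K).
  by rewrite !(negbTE (ap _ _ zK _)) // inE.
by rewrite !eN ?inE ?ai ?bi.
Qed.

(** The blocks are adjacent in [Q], so within [K] they are not joined, and no edge leaves the part
    of [K] over [i]. The rest of that block is then a module of what remains, and insertion does the
    work of p. *)
Lemma idsys_two X Q (r : X -> Q) (K : {set X}) i j :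
  idsys r K -> edge i j -> (forall x, (r x == i) || (r x == j)) ->
  prov (sub [set x | r x == i]) -> prov (sub [set x | r x == j]) -> prov X.
Proof.
case=> ap eK eN ij cov pI pJ.
have nij : i != j by apply: contraTneq ij => ->; rewrite edge_irrefl.
pose Fi := [set x | r x == i]; pose s := Fi :&: K; pose A := Fi :\: K.
have apsA : apart s A.
  by move=> x y; rewrite !inE => /andP[_ xK] /andP[yK _]; apply: ap; rewrite ?inE.
have djsA : [disjoint s & A].
  by apply/pred0P=> x /=; rewrite !inE; case: (x \in K); rewrite ?andbF.
have eFi : Fi = s :|: A by rewrite setID.
have aps : apart s (~: s).
  move=> x y xs; have := xs; rewrite !inE => /andP[/eqP xi xK].
  have [yK|yK] := boolP (y \in K); last by move=> _; apply: ap; rewrite ?inE.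
  rewrite andbT => yi; rewrite eK ?xi 1?eq_sym // negbK.
  by move: (cov y); rewrite (negbTE yi) => /= /eqP->.
apply: (prov_iso (iso_sym (whole_cut aps))).
apply: (prov_iso (X := par (par (sub s) (empty_graph V)) (sub (~: s)))); first by par_ac.
apply: (insert_par (A := A)).
- by apply/subsetP=> x; rewrite !inE => /andP[/negbTE->]; rewrite andbF.
- move=> z a b; rewrite !inE => zs zA /andP[aK /eqP ai] /andP[bK /eqP bi].
  have [zK|zK] := boolP (z \in K); first by rewrite !(negbTE (ap _ _ zK _)) // inE.
  move: zA; rewrite (negbTE zK) /= => zi.
  by rewrite !eN ?inE ?ai ?bi.
- by apply: prov_iso (sub_cut apsA djsA) _; rewrite -eFi.
- apply: (prov_iso (X := sub (~: s :\: A))); first by par_ac.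
  suff -> : ~: s :\: A = [set x | r x == j] by [].
  apply/setP=> x; rewrite !inE; move: (cov x).
  have [->|_] /= := eqVneq (r x) i; last by rewrite andbF.
  by rewrite (negbTE nij); case: (x \in K).
Qed.

(* By induction on the number of blocks: a nontrivial module of [Q] is merged into
   one block, a block without vertices in [K] is inserted last, and otherwise p applies. *)
Lemma id_prov X Q (r : X -> Q) (K : {set X}) :
  idsys r K -> (forall i, prov (sub [set x | r x == i])) -> prov X.
Proof.
have [n] := ubnP #|r @: setT|; elim: n X r K => // n IH X r K.
set J := r @: setT; rewrite ltnS => cJ sys pr.
have rJ x : r x \in J by apply: imset_f.
(* Deleting a block lowers the number of blocks, so the induction hypothesis proves the rest. *)
have pdel i : i \in J -> prov (sub (~: [set x | r x == i])).
  move=> iJ; apply: (IH _ _ (presub _ K)); last 1 first.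
  - move=> k; apply: prov_iso (iso_sym (fib_sub_iso r _ k)) _.
    have [->|ni] := eqVneq k i.
      by apply: sub0_prov; apply/setP=> x; rewrite !inE; case: eqP.
    suff -> : [set x in ~: [set x | r x == i] | r x == k] = [set x | r x == k] by [].
    by apply/setP=> x; rewrite !inE; case: (eqVneq (r x) k) => [->|]; rewrite ?ni ?andbT ?andbF.
  - apply: leq_trans cJ; apply: proper_card; apply/properP; split.
      by apply/subsetP=> _ /imsetP[x _ ->].
    exists i => //; apply/imsetP=> -[x _ e].
    by have := valP x; rewrite !inE => /negP; apply; apply/eqP.
  - exact: idsys_sub.
have [J2|J2] := leqP 2 #|J|; last first.
  have [J0|/set0Pn[i iJ]] := eqVneq J set0.
    apply: prov_empty; apply: eq_card0 => x; have := rJ x; by rewrite J0 inE.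
  apply: prov_iso (subT_iso X) _.
  suff <- : [set x | r x == i] = setT by [].
  apply/setP=> x; rewrite !inE; move: J2; rewrite ltnS => /card_le1_eqP h.
  by apply/eqP; apply: h.
have [[T [sT T2 TJ hT]]|pJ] := prime_or_module J2.
  have /card_gt0P[t0 t0T] := ltnW T2.
  (* [t0] represents the merged module [T]; as [T] is a module of [J], edges between the new blocks
     still follow the quotient. *)
  pose r' x := if r x \in T then t0 else r x.
  case: (sys) => ap eK eN.
  have er' x y : r' x != r' y -> r x != r y /\ edge (r x) (r y) = edge (r' x) (r' y).
    rewrite /r'; case xT: (r x \in T); case yT: (r y \in T) => // n'.
    - by rewrite eqxx in n'.
    - split; first by apply: contraFneq yT => <-.
      by rewrite !(edge_sym _ (r y)); apply: (hT (r y)); rewrite ?rJ ?yT.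
    - split; first by apply: contraFneq xT => ->.
      by apply: (hT (r x)); rewrite ?rJ ?xT.
  apply: (IH _ r' K).
  - apply: leq_trans cJ.
    have : #|r' @: setT| <= #|t0 |: (J :\: T)|.
      apply: subset_leq_card; apply/subsetP=> _ /imsetP[x _ ->].
      rewrite !inE /r'; case: ifP => [_|->]; first by rewrite eqxx.
      by rewrite rJ orbT.
    rewrite cardsU1 cardsD (setIidPr sT); have := subset_leq_card sT.
    by case: (_ \notin _) => /=; lia.
  - split=> // x y xK yK /er'[nr <-]; [exact: eK | exact: eN].
  - move=> i; have [->|ni] := eqVneq i t0.
      have -> : [set x | r' x == t0] = [set x | r x \in T].
        apply/setP=> x; rewrite !inE /r'; case: ifP => [_|xT]; first by rewrite eqxx.
        by apply: contraFF xT => /eqP->.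
      (* The merged block is itself such a system, with fewer blocks because [T] is a proper part of
         [J]. *)
      apply: (IH _ (fun x : sub [set x | r x \in T] => r (val x)) (presub _ K)); last 1 first.
      + move=> k; apply: prov_iso (iso_sym (fib_sub_iso r _ k)) _.
        have [kT|kT] := boolP (k \in T).
          suff -> : [set x in [set x | r x \in T] | r x == k] = [set x | r x == k] by [].
          by apply/setP=> x; rewrite !inE; case: eqP => [->|]; rewrite ?kT ?andbF.
        apply: sub0_prov; apply/setP=> x; rewrite !inE; case: eqP => [->|]; rewrite ?andbF //.
        by rewrite (negbTE kT).
      + apply: leq_trans cJ; apply: leq_ltn_trans TJ; apply: subset_leq_card.
        by apply/subsetP=> _ /imsetP[x _ ->]; have := valP x; rewrite inE.
      + exact: idsys_sub.
    have [iT|iT] := boolP (i \in T).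
      apply: sub0_prov; apply/setP=> x; rewrite !inE /r'.
      case: ifP => [_|xT]; first by rewrite eq_sym (negbTE ni).
      by apply: contraFF xT => /eqP->.
    suff -> : [set x | r' x == i] = [set x | r x == i] by [].
    apply/setP=> x; rewrite !inE /r'; case: ifP => // xT; rewrite eq_sym (negbTE ni).
    by apply/esym/negbTE; apply: contraNneq iT => <-.
have [/cards2P[i [j [nij eJ]]]|J3] := boolP (#|J| == 2).
  have cov x : (r x == i) || (r x == j) by have := rJ x; rewrite eJ !inE.
  have [ij|ij] := boolP (edge i j); first exact: (idsys_two sys ij cov).
  (* The two blocks are adjacent in the dual of [Q], for which [K] and its complement exchange
     roles. *)
  apply: (@idsys_two X (dual Q) r (~: K) i j (idsys_dual sys)) => //.
  by rewrite /= /dual_edge nij.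
have P4 : 4 <= #|sub J|.
  have := prime_not3 pJ; rewrite card_sub; move: J2 J3; set m := #|_|; clearbody m; lia.
have [/exists_inP[i iJ /eqP iK]|full] :=
    boolP [exists i in J, [set x in K | r x == i] == set0].
  apply: (idsys_insert (i := i) sys) => //; last exact: pdel.
  apply/subsetP=> x; rewrite !inE => xi; apply/negP=> xK.
  by have := in_set0 x; rewrite -iK inE xK xi.
case: (sys) => ap eK eN.
pose q x : sub J := exist _ (r x) (rJ x).
have qE x y : (q x == q y) = (r x == r y) by [].
have KT : K :|: ~: K = setT by apply/setP=> x; rewrite !inE orbN.
have red : reduct (p_rel (K :|: ~: K) q) (K :|: ~: K).
  apply: (p_reduct (P := sub J)) => //.
  - by apply/pred0P=> x /=; rewrite inE andbN.
  - by move=> z a b _; rewrite KT inE.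
  - case=> i iJ; have : [set x in K | r x == i] != set0.
      by move/exists_inPn: full; apply.
    by case/set0Pn=> x; rewrite inE => /andP[xK /eqP xi]; exists x => //; apply: val_inj.
apply: (prov_der _ (reduct_full red)).
(* [K] and its complement exhaust the graph, so the premise of p joins distinct blocks
   completely. *)
apply: (@complete_prov (regraph (p_rel (K :|: ~: K) q)) _ r) => [x y nr|i].
  by rewrite /= p_relE KT !inE qE nr orbT.
apply: prov_iso (pr i); apply: iso_sym; apply: sub_regraph_base_iso => x y.
by rewrite !inE => /eqP xi /eqP yi; rewrite p_relE qE xi yi eqxx !andbF orbF.
Qed.

(** [pull] derives the complement of [K] from a graph [Y1] in which [D] also follows the quotient
    [Q]; then [id_prov] applies to [K] against [Y1]. *)
Lemma id3_prov X Q (r : X -> Q) (D K : {set X}) :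
  apart D (~: D) -> {in D &, forall x y, r x != r y -> ~~ edge x y} ->
  [disjoint K & D] -> apart K (~: K) ->
  {in K &, forall x y, r x != r y -> edge x y = ~~ edge (r x) (r y)} ->
  {in ~: (K :|: D) &, forall x y, r x != r y -> edge x y = edge (r x) (r y)} ->
  (forall i, prov (sub [set x | r x == i])) -> prov X.
Proof.
move=> apD eD djKD apK eK eN pr.
pose Y := sub (~: K); pose rY (y : Y) := r (val y); pose Y1 := regraph (pull_rel rY set0).
have d : GSder Y1 Y.
  apply: (pull (D := presub (~: K) D)).
  - by move=> x y; rewrite !inE => xD yD; apply: apD; rewrite ?inE.
  - by move=> x y; rewrite !inE => xD yD; exact: eD.
  - move=> x y; have := valP x; have := valP y; rewrite !inE => yK xK xD yD nr.
    by apply: eN; rewrite ?inE // negb_or ?xK ?yK.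
have Y1E x y : @edge V Y1 x y = edge (val x) (val y) || edge (r (val x)) (r (val y)).
  by rewrite [LHS]pull_relE !inE.
apply: (prov_iso (iso_sym (whole_cut apK))).
apply: (prov_der _ (der_par (der_refl _) d)).
pose X1 := par (sub K) Y1.
pose f (u : X1) : X := match u with inl a => val a | inr b => val (b : Y) end.
have fK u : (f u \in K) = match u with inl _ => true | inr _ => false end.
  by case: u => [a|b] /=; [exact: valP | have := valP b; rewrite inE => /negbTE].
have fi : injective f.
  move=> u v e; have := fK u; have := fK v; rewrite e => ->.
  by case: u v e => [a|a] [b|b] //= /val_inj ->.
apply: (@id_prov X1 Q (fun u => r (f u)) [set u | f u \in K]).
  split.
  - by case=> [a|a] [b|b]; rewrite !inE !fK //= inE.
  - by case=> [a|a] [b|b]; rewrite !inE !fK //= => _ _ nr; apply: eK; rewrite ?(valP a) ?(valP b).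
  - case=> [a|a] [b|b]; rewrite !inE !fK //= => _ _ nr; rewrite [LHS]Y1E.
    have := valP a; have := valP b; rewrite !inE => bK aK.
    have [ab|ab] := boolP (edge (val a) (val b)) => //=; symmetry.
    have [aD|aD] := boolP (val a \in D); last have [bD|bD] := boolP (val b \in D).
    + have [bD|bD] := boolP (val b \in D); first by rewrite (negbTE (eD _ _ aD bD nr)) in ab.
      by rewrite (negbTE (apD _ _ aD _)) ?inE // in ab.
    + by rewrite edge_sym (negbTE (apD _ _ bD _)) ?inE // in ab.
    + by rewrite -eN ?inE ?negb_or ?aK ?bK.
move=> i; apply: prov_iso (pr i); apply: iso_sym.
apply: (sub_iso (X := X1) (Y := X) (f := f)).
- by move=> u v _ _ /fi.
- by move=> u; rewrite !inE.
- move=> x; rewrite inE => xi; have [xK|xK] := boolP (x \in K).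
    by exists (inl (exist _ x xK) : X1); rewrite ?inE.
  have xK' : x \in ~: K by rewrite inE.
  by exists (inr (exist _ x xK') : X1); rewrite ?inE.
- case=> [a|a] [b|b]; rewrite !inE => /eqP ai /eqP bi //=.
  + by rewrite inE; apply/negbTE; apply: apK; [exact: valP | exact: (valP b)].
  + by rewrite inE edge_sym; apply/negbTE; apply: apK; [exact: valP | exact: (valP a)].
  + by rewrite [RHS]Y1E; move: ai bi => /= -> ->; rewrite edge_irrefl orbF.
- by case.
Qed.

End Id.

(** * The last rule of a proof *)

Section Bottom.
Variable V : Type.
Implicit Types X P Q : graph V.

Lemma regraph_eq_iso X (e1 e2 : rel X) :
  (forall x y, regraph_edge e1 x y = regraph_edge e2 x y) -> isomorphic (regraph e1) (regraph e2).
Proof.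
by move=> h; apply: (isoI (X := regraph e1) (Y := regraph e2) (f := id) (g := id)) => // x y; rewrite /= h.
Qed.

Definition ss_data X (A B S : {set X}) :=
  [/\ apart A B, [disjoint A & B], homog (A :|: B) setT, S \subset B & A != set0 /\ S != set0].

Definition p_data X P (q : X -> P) (M N : {set X}) :=
  [/\ prime_graph P /\ 4 <= #|P|, apart M N /\ [disjoint M & N], homog (M :|: N) setT,
      (forall i, exists2 x, x \in M & q x = i) &
      {in M &, forall x y, q x != q y -> edge x y = ~~ edge (q x) (q y)} /\
      {in N &, forall x y, q x != q y -> edge x y = edge (q x) (q y)}].

(** The last rule seen from its conclusion: the redex is a module, so no context appears, and the
    premise is a [regraph] or, for an axiom, an induced subgraph. *)
Inductive bottom X : Prop :=
| BEmpty : #|X| = 0 -> bottom X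
| BAi (x y : X) : x != y -> label x = dual_atom (label y) -> ~~ edge x y ->
    @homog V X [set x; y] setT -> prov (@sub V X (~: [set x; y])) -> bottom X
| BSs (A B S : {set X}) : ss_data A B S -> prov (@regraph V X (ss_rel A S)) -> bottom X
| BP P (q : X -> P) (M N : {set X}) : p_data q M N -> prov (@regraph V X (p_rel (M :|: N) q)) -> bottom X.

Lemma bottom_iso X Y : isomorphic X Y -> bottom X -> bottom Y.
Proof.
case=> f [[g fK gK] fe fl].
have ge x y : edge (g x) (g y) = edge x y by rewrite -fe !gK.
have gi : injective g by exact: can_inj gK.
have gim (x : X) : exists y, g y = x by exists (f x).
have gap (A B : {set X}) : apart A B -> apart (g @^-1: A) (g @^-1: B).
  by move=> h a b; rewrite !inE -ge; exact: h.
have ghom (A : {set X}) : homog A setT -> homog (g @^-1: A) setT.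
  by move=> h z a b _; rewrite !inE -!ge; exact: h.
have gdj (A B : {set X}) : [disjoint A & B] -> [disjoint g @^-1: A & g @^-1: B].
  by move=> h; apply/pred0P=> x /=; rewrite !inE; case a: (_ \in A) => //=; rewrite (disjointFr h).
have g0 (A : {set X}) : A != set0 -> g @^-1: A != set0.
  by case/set0Pn=> x xA; apply/set0Pn; exists (f x); rewrite inE fK.
have imk (e1 : rel X) : isomorphic (regraph e1) (@regraph V Y (fun x y => e1 (g x) (g y))).
  apply: (isoI (X := regraph e1) (Y := @regraph V Y (fun x y => e1 (g x) (g y))) (f := f) (g := g)) => //.
  by move=> x y; rewrite /= /regraph_edge !fK (inj_eq (can_inj fK)).
case=> [X0|x y nxy lxy exy hxy pr|A B S [ap dj h sSB [A0 S0]] pr|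
        P q M N [[pP P4] [ap dj] h sq [eM eN]] pr].
- apply: BEmpty; rewrite -X0; symmetry; apply: bij_eq_card; exact: (Bijective fK gK).
- have e : [set f x; f y] = g @^-1: [set x; y].
    by apply/setP=> z; rewrite !inE -!(inj_eq gi) !fK.
  apply: (BAi (x := f x) (y := f y)).
  + by rewrite (inj_eq (can_inj fK)).
  + by rewrite !fl.
  + by rewrite fe.
  + by rewrite e; exact: ghom.
  + apply: prov_iso pr; apply: (sub_iso (f := f)).
    * by move=> a b _ _ /(can_inj fK).
    * by move=> a; rewrite e !inE fK.
    * by move=> b; rewrite e inE => bI; exists (g b) => //; rewrite inE; rewrite inE in bI.
    * by move=> a b _ _; rewrite fe.
    * by move=> a _; rewrite fl.
- apply: (@BSs _ (g @^-1: A) (g @^-1: B) (g @^-1: S)).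
    split; rewrite -?preimsetU; [exact: gap|exact: gdj|exact: ghom|exact: preimsetS|].
    by split; exact: g0.
  apply: prov_iso pr; apply: iso_trans (imk _) _.
  apply: regraph_eq_iso => x y; by rewrite /regraph_edge /ss_rel !inE !ge.
- apply: (@BP _ P (q \o g) (g @^-1: M) (g @^-1: N)).
    split; rewrite -?preimsetU //.
    + by split; [exact: gap | exact: gdj].
    + exact: ghom.
    + by move=> i; have [x xM <-] := sq i; exists (f x); rewrite ?inE /= fK.
    + by split=> x y; rewrite !inE -ge; [exact: eM | exact: eN].
  apply: prov_iso pr; apply: iso_trans (imk _) _.
  apply: regraph_eq_iso => x y; by rewrite /regraph_edge /p_rel !inE !ge.
Qed.

Lemma bottom_rule (C : graph V) (R : {set C}) X Y :
  GS X Y -> prov (plug R X) -> bottom (plug R Y).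
Proof.
case=> [[a]|[B A S S0 A0]|[P M N pP P4 M0]] pr.
- pose Z := plug R (par (atom_graph (dual_atom a)) (atom_graph a)).
  apply: (@BAi Z (inr (inl tt)) (inr (inr tt))) => //=.
  + by rewrite inE.
  + by move=> [z|[[]|[]]] [b|[[]|[]]] [c|[[]|[]]] _; rewrite !inE //=.
  + apply: prov_iso pr; apply: iso_trans (iso_sym (plug0_iso _ (card_empty V))) _.
    apply: (emb_iso (X := C) (Y := Z) (f := fun c => inl c)) => //.
    * by move=> x y [].
    * by move=> x; rewrite !inE.
    * by case=> [c|[[]|[]]]; rewrite !inE //=; exists c.
- pose Z := plug R (par B A).
  pose A' : {set Z} := [set z : Z | match z with inr (inr _) => true | _ => false end].
  pose B' : {set Z} := [set z : Z | match z with inr (inl _) => true | _ => false end].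
  pose S' : {set Z} := [set z : Z | match z with inr (inl b) => b \in S | _ => false end].
  have dj : [disjoint A' & B'] by apply/pred0P=> -[c|[b|d]] //=; rewrite !inE ?andbF.
  have sS : S' \subset B' by apply/subsetP=> -[c|[b|d]] //=; rewrite !inE.
  apply: (@BSs Z A' B' S').
    split=> //.
    + by move=> [c|[b|d]] [c'|[b'|d']]; rewrite !inE //= inE.
    + by move=> [c|[b|d]] [c'|[b'|d']] [c2|[b2|d2]]; rewrite !inE //= ?inE.
    + split; first by case/card_gt0P: A0 => a _; apply/set0Pn; exists (inr (inr a)); rewrite inE.
      by case/set0Pn: S0 => s sS'; apply/set0Pn; exists (inr (inl s)); rewrite inE.
  apply: prov_iso pr.
  have djS : [disjoint A' & S'] by exact: disjointWr sS dj.
  apply: (isoI (X := plug R (plug S A)) (Y := regraph (ss_rel A' S')) (f := id) (g := id)) => // x y.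
  rewrite [LHS]ss_relE //.
  by case: x => [c|[b|d]]; case: y => [c'|[b'|d']]; rewrite !inE /= ?inE ?orbF ?andbF ?andbT ?orbF.
- have /card_gt0P[i0 _] : 0 < #|P| by exact: leq_trans P4.
  pose Z := plug R (par (@compose _ (dual P) M) (@compose _ P N)).
  (* [i0] is a default value on the context, where [p_data] constrains nothing. *)
  pose q (z : Z) : P := match z with inl _ => i0 | inr (inl u) => tag u | inr (inr u) => tag u end.
  pose M' : {set Z} := [set z : Z | match z with inr (inl _) => true | _ => false end].
  pose N' : {set Z} := [set z : Z | match z with inr (inr _) => true | _ => false end].
  apply: (@BP Z P q M' N').
    split=> //; first split.
    + by move=> [c|[b|d]] [c'|[b'|d']]; rewrite !inE //= inE.
    + by apply/pred0P=> -[c|[b|d]] //=; rewrite !inE ?andbF.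
    + by move=> [c|[b|d]] [c'|[b'|d']] [c2|[b2|d2]]; rewrite !inE //= ?inE.
    + move=> i; have /card_gt0P[m _] := M0 i.
      by exists (inr (inl (existT _ i m : {i : dual P & M i}))); rewrite ?inE.
    + split.
        move=> [c|[b|d]] [c'|[b'|d']]; rewrite !inE //= => _ _ n.
        by rewrite /join_edge (negbTE n) /= /dual_edge n.
      move=> [c|[b|d]] [c'|[b'|d']]; rewrite !inE //= => _ _ n.
      by rewrite /join_edge (negbTE n).
  apply: prov_iso pr.
  pose T := plug R (big_tensor (fun i => par (M i) (N i))).
  pose f (u : T) : Z := match u with inl c => inl c | inr (existT i (inl m)) =>
     inr (inl (existT _ i m : {i : dual P & M i}))
     | inr (existT i (inr n)) => inr (inr (existT _ i n)) end.
  pose g (u : Z) : T := match u with inl c => inl c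
     | inr (inl (existT i m)) => inr (existT (fun i => (M i + N i)%type) i (inl m))
     | inr (inr (existT i m)) => inr (existT (fun i => (M i + N i)%type) i (inr m)) end.
  apply: (isoI (X := T) (Y := regraph (p_rel (M' :|: N') q)) (f := f) (g := g)).
  + by case=> [c|[i [m|n]]].
  + by case=> [c|[[i m]|[i n]]].
  + move=> x y; rewrite [LHS]p_relE.
    case: x => [c|[i x]]; case: y => [c'|[j y]]; rewrite ?inE ?andbF ?orbF //.
    * by case: y => y; rewrite ?inE //= ?andbF ?orbF.
    * by case: x => x; rewrite ?inE //= ?andbF ?orbF.
    * rewrite /= [RHS]/join_edge /=.
      have [e|n] := eqVneq i j.
        subst j; case: x => x; case: y => y;
        by rewrite ?inE /= ?eqxx ?orbF ?tagged_asE ?inE //= /join_edge /= eqxx tagged_asE.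
      by case: x => x; case: y => y; rewrite ?inE /= ?n ?orbT.
  + by case=> [c|[i [m|n]]].
Qed.

(** The derivation is read from its end; isomorphism steps are absorbed by [bottom_iso] until a rule
    is met. *)
Lemma prov_bottom X : prov X -> bottom X.
Proof.
move=> pr; elim: (Operators_Properties.clos_rt_rtn1 _ _ _ _ (Operators_Properties.clos_rt1n_rt _ _ _ _ pr)) => [|Y Z s h IH].
  by apply: BEmpty; exact: card_empty.
case: s h IH => [G H i _|C R A B r h _]; first exact: bottom_iso.
by apply: bottom_rule r _; apply: Operators_Properties.clos_rt_rt1n; exact: Operators_Properties.clos_rtn1_rt.
Qed.

Lemma ss_data_reduct X (A B S : {set X}) : ss_data A B S -> reduct (ss_rel A S) (A :|: B).
Proof. by case=> ap dj h sSB [A0 S0]; exact: ss_reduct. Qed.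

Lemma p_data_reduct X P (q : X -> P) (M N : {set X}) :
  p_data q M N -> reduct (p_rel (M :|: N) q) (M :|: N).
Proof. by case=> [[pP P4] [ap dj] h sq [eM eN]]; exact: p_reduct. Qed.

(* Minimising the number of blocks makes the quotient prime. *)
Lemma prime_quotient X (A : {set X}) : homog A setT -> A != set0 -> A != setT ->
  exists (Q : graph V) (q : X -> Q), [/\ prime_graph Q, forall i, exists x, q x = i,
    forall x y, q x != q y -> edge x y = edge (q x) (q y) &
    {in A &, forall x y, q x = q y}].
Proof.
move=> hA /set0Pn[a0 aA] AT.
(* Quotients are encoded as idempotent maps onto representatives, a finite type over which the
   number of blocks can be minimised. The bound [1 <] excludes the trivial quotient. *)
pose ok (f : {ffun X -> X}) := [&& [forall x, f (f x) == f x],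
  [forall x, forall y, (f x != f y) ==> (edge x y == edge (f x) (f y))],
  [forall x in A, f x == f a0] & 1 < #|f @: setT|].
pose f0 : {ffun X -> X} := [ffun x => if x \in A then a0 else x].
have ok0 : ok f0.
  apply/and4P; split.
  - by apply/forallP=> x; rewrite !ffunE; have [xA|xA] := boolP (x \in A); rewrite ?aA ?(negbTE xA).
  - apply/forallP=> x; apply/forallP=> y; apply/implyP; rewrite !ffunE.
    case: ifP => xA; case: ifP => yA n; first by rewrite eqxx in n.
    + by rewrite !(edge_sym _ y) (hA y x a0) ?inE // yA.
    + by rewrite (hA x y a0) ?inE // xA.
    + by [].
  - by apply/forall_inP=> x xA; rewrite !ffunE xA aA.
  - have /subsetPn[b _ bA] : ~~ ([set: X] \subset A) by rewrite subTset.
    apply/card_gt1P; exists a0, b; split; last by apply: contraNneq bA => <-.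
    + by apply/imsetP; exists a0; rewrite ?ffunE ?aA.
    + by apply/imsetP; exists b; rewrite ?ffunE ?(negbTE bA).
case: (arg_minnP (fun f : {ffun X -> X} => #|f @: setT|) ok0) => f /and4P[/forallP f1 /forallP f2 /forall_inP f3 f4] fmin.
set J := f @: setT in f4 fmin.
have fJ x : f x \in J by apply: imset_f.
have Jf x : x \in J -> f x = x by case/imsetP=> y _ ->; exact/eqP.
have f2' x y : f x != f y -> edge x y = edge (f x) (f y).
  by move=> n; have /forallP/(_ y)/implyP/(_ n)/eqP := f2 x.
exists (sub J), (fun x => exist _ (f x) (fJ x)); split.
- have [[T [sT T2 TJ hT]]|//] := prime_or_module f4; exfalso.
  have /card_gt0P[t0 t0T] := ltnW T2.
  (* Merging a nontrivial module of representatives gives a quotient with fewer blocks, still at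
     least two because [T] is proper. *)
  pose g : {ffun X -> X} := [ffun x => if f x \in T then t0 else f x].
  have ft0 : f t0 = t0 by apply: Jf; exact: (subsetP sT).
  have okg : ok g.
    apply/and4P; split.
    + apply/forallP=> x; rewrite !ffunE; have [xT|xT] := boolP (f x \in T); first by rewrite ft0 t0T.
      by rewrite (eqP (f1 x)) (negbTE xT).
    + apply/forallP=> x; apply/forallP=> y; apply/implyP; rewrite !ffunE.
      case xT: (f x \in T); case yT: (f y \in T) => n; first by rewrite eqxx in n.
      * rewrite f2'; last by apply: contraFneq yT => <-.
        by rewrite !(edge_sym _ (f y)) (hT (f y) (f x) t0) // yT.
      * rewrite f2'; last by apply: contraFneq xT => ->.
        by rewrite (hT (f x) (f y) t0) // xT.
      * by rewrite f2'.
    + by apply/forall_inP=> x xA; rewrite !ffunE (eqP (f3 x xA)).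
    + have : ~~ (J \subset T) by apply: contraTN TJ => /subset_leq_card; rewrite leqNgt.
      case/subsetPn=> b bJ bT; apply/card_gt1P; exists t0, b; split.
      * by apply/imsetP; exists t0; rewrite ?ffunE ?ft0 ?t0T.
      * by apply/imsetP; exists b; rewrite ?ffunE ?Jf ?(negbTE bT).
      * by apply: contraNneq bT => <-.
  have := fmin g okg; rewrite leqNgt => /negP; apply.
  have : #|g @: setT| <= #|t0 |: (J :\: T)|.
    apply: subset_leq_card; apply/subsetP=> _ /imsetP[x _ ->].
    rewrite !inE ffunE; case: ifP => [_|->]; first by rewrite eqxx.
    by rewrite fJ orbT.
  rewrite cardsU1 cardsD (setIidPr sT); have := subset_leq_card sT.
  by case: (_ \notin _) => /=; lia.
- by case=> i iJ; exists i; apply: val_inj => /=; exact: Jf.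
- by move=> x y n; apply: f2'.
- by move=> x y xA yA; apply: val_inj; rewrite /= (eqP (f3 x xA)) (eqP (f3 y yA)).
Qed.

End Bottom.

(** * Splitting *)

Section Tools.
Variable V : Type.
Implicit Types X P Q H W K D : graph V.

Definition sumf (A B T : Type) (r : A -> T) (q : B -> T) (u : A + B) : T :=
  match u with inl x => r x | inr y => q y end.

Lemma fib_plug_iso X (R : {set X}) D (T : eqType) (r : X -> T) (q : D -> T) i :
  (forall x d, x \in R -> r x != q d) ->
  isomorphic (@sub V (plug R D) [set u | sumf r q u == i])
             (par (sub [set x | r x == i]) (sub [set d | q d == i])).
Proof.
move=> hR; apply: iso_sym.
apply: (emb_iso (X := par (sub [set x | r x == i]) (sub [set d | q d == i])) (Y := plug R D)
  (f := fun u : sub [set x | r x == i] + sub [set d | q d == i] =>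
     match u with inl x => inl (val x) | inr d => inr (val d) end)).
- by case=> a [] b //= [] /val_inj ->.
- by case=> a; have := valP a; rewrite !inE.
- case=> a; rewrite inE /= => ai.
    have ai' : a \in [set x | r x == i] by rewrite inE.
    by exists (inl (exist _ a ai')).
  have ai' : a \in [set x | q x == i] by rewrite inE.
  by exists (inr (exist _ a ai')).
- case=> a [] b //=; rewrite inE.
    apply/negbTE; apply/negP=> /hR => /(_ (val b)); have := valP a; have := valP b.
    by rewrite !inE => /eqP-> /eqP->; rewrite eqxx.
  apply/negbTE; apply/negP=> /hR => /(_ (val a)); have := valP a; have := valP b.
  by rewrite !inE => /eqP-> /eqP->; rewrite eqxx.
- by case.
Qed.

Lemma fib_par_iso X D (T : eqType) (r : X -> T) (q : D -> T) i :
  isomorphic (@sub V (par X D) [set u | sumf r q u == i])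
             (par (sub [set x | r x == i]) (sub [set d | q d == i])).
Proof. by apply: fib_plug_iso => x d; rewrite inE. Qed.

Lemma id_par H W Q (r : H -> Q) (q : W -> Q) :
  (forall x y, r x != r y -> edge x y = ~~ edge (r x) (r y)) ->
  (forall x y, q x != q y -> edge x y = edge (q x) (q y)) ->
  (forall i, prov (par (sub [set x | r x == i]) (sub [set x | q x == i]))) ->
  prov (par H W).
Proof.
move=> eH eW pr; pose K : {set par H W} := [set u : H + W | if u is inl _ then true else false].
apply: (@id_prov V (par H W) Q (sumf r q) K).
  split.
  - by case=> a [] b; rewrite !inE //= inE.
  - by case=> a [] b; rewrite !inE //= => _ _; exact: eH.
  - by case=> a [] b; rewrite !inE //= => _ _; exact: eW.
by move=> i; apply: prov_iso (iso_sym (fib_par_iso _ _ _)) (pr i).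
Qed.

Lemma injects_regraph X (e : rel X) (Z : {set X}) : (forall x y, edge x y -> regraph_edge e x y) ->
  injects (@sub V (regraph e) Z) (sub Z).
Proof. by move=> h; exists id => // x y; exact: h. Qed.

Lemma le_plug X (R : {set X}) D : le (plug R D) (par X D).
Proof.
split; last by apply: entails_der; exact: der_ss.
by exists id => // -[a|a] [b|b] //=; rewrite inE.
Qed.

Lemma nonadj_plug_lt X (R : {set X}) D : R != set0 -> 0 < #|D| ->
  nonadj (plug R D) < nonadj (par X D).
Proof.
move=> /set0Pn[x xR] /card_gt0P[d _].
apply: (nonadj_inj_lt (X := plug R D) (Y := par X D) (f := id) (y1 := inl x) (y2 := inr d)) => //.
- by case=> [a|a] [b|b] //=; rewrite inE.
- by rewrite /= inE.
- by move=> _ _ -> -> /=.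
Qed.

(** Insertion as a replacement: the test graph [D] of the entailment travels beside [K2] through
    [insert_par]. *)
Lemma le_insert X (A Z : {set X}) K1 K2 : A \subset Z -> homog A Z ->
  prov (par K1 (sub A)) -> le (par K2 (sub (Z :\: A))) (par (par K1 K2) (sub Z)).
Proof.
move=> sA h pA; split.
  by apply: injects_par; [exact: injects_parr | apply: injects_subS; exact: subsetDl].
move=> D pD; apply: (prov_iso (X := par (par K1 (par K2 D)) (sub Z))); first by par_ac.
by apply: insert_par sA h pA _; apply: prov_iso pD; par_ac.
Qed.

Lemma prov_ai X (x y : X) : x != y -> ~~ edge x y -> label x = dual_atom (label y) ->
  prov (@sub V X [set x; y]).
Proof.
move=> nxy exy lxy.
pose P := par (atom_graph (dual_atom (label y))) (atom_graph (label y)).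
have pP : prov P by apply: prov_der (der_refl _) _; apply: der_rule; apply: Or31; exact: AiDown.
apply: prov_iso pP.
apply: (emb_iso (X := P) (Y := X) (f := fun u : unit + unit => if u is inl _ then x else y)).
- by case=> -[] [] [] // e; rewrite e eqxx in nxy.
- by case=> _; rewrite !inE eqxx ?orbT.
- by move=> z; rewrite !inE => /orP[/eqP->|/eqP->]; [exists (inl tt) | exists (inr tt)].
- case=> -[] [] [] /=; rewrite ?inE ?edge_irrefl //.
    exact/negbTE.
  by rewrite edge_sym; apply/negbTE.
- by case=> -[].
Qed.

(** Restricting to [Z] either leaves an instance of ss or empties [A] or [S], and then the two
    graphs agree. *)
Lemma ss_sub_der X (A B S Z : {set X}) : ss_data A B S ->
  GSder (@sub V (regraph (ss_rel A S)) Z) (sub Z).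
Proof.
case=> ap dj h sSB _.
have djS : [disjoint A & S] by exact: disjointWr sSB dj.
pose A' := presub Z A; pose B' := presub Z B; pose S' := presub Z S.
apply: der_trans (der_iso (regraph_sub _ _)) _.
apply: (der_trans (Y := regraph (ss_rel A' S'))).
  by apply: der_iso; apply: regraph_eq_iso => x y; rewrite /regraph_edge /ss_rel !inE.
have dj' : [disjoint A' & B'].
  by apply/pred0P=> x /=; rewrite !inE; case a: (_ \in A) => //=; rewrite (disjointFr dj).
have [A0|A0] := eqVneq A' set0.
  apply: der_iso; apply: regraph_id => x y; rewrite /regraph_edge /ss_rel A0 !inE /= !orbF.
  rewrite [edge (val y) _]edge_sym orbb; case: eqP => // ->; by rewrite edge_irrefl.
have [S0|S0] := eqVneq S' set0.
  apply: der_iso; apply: regraph_id => x y; rewrite /regraph_edge /ss_rel S0 !inE /= !andbF !orbF.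
  rewrite [edge (val y) _]edge_sym orbb; case: eqP => // ->; by rewrite edge_irrefl.
apply: (@reduct_full V (sub Z) _ (A' :|: B')); apply: ss_reduct => //.
- by move=> x y; rewrite !inE; exact: ap.
- by move=> z a b _; rewrite !inE -!in_setU; exact: h.
- by apply/subsetP=> x; rewrite !inE; exact: (subsetP sSB).
Qed.

(** If [Z] cuts no block, this is the connectedness of [Q]. If [x] and [y] in one block are
    separated by [Z], a vertex [z] of an adjacent block is joined to both and lies on one of the two
    sides. The relation [e] is abstract so that it can also be nonadjacency. *)
Lemma quot_split (T : finType) (e : rel T) (W : {set T}) Q (q : T -> Q) (Z : {set T}) a b :
  symmetric e -> prime_graph Q -> 3 <= #|Q| -> (forall i, exists2 x, x \in W & q x = i) ->
  {in W &, forall x y, q x != q y -> e x y = edge (q x) (q y)} ->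
  a \in W -> a \in Z -> b \in W -> b \notin Z ->
  exists x y, [/\ x \in W, x \in Z, y \in W, y \notin Z & e x y].
Proof.
move=> es pQ Q3 sq eW aW aZ bW bZ.
pose J := q @: (W :&: Z).
have qaJ : q a \in J by apply: imset_f; rewrite inE aW.
have J0 : J != set0 by apply/set0Pn; exists (q a).
have [/existsP[y /and3P[yW yZ yJ]]|no] :=
    boolP [exists y, [&& y \in W, y \notin Z & q y \in J]]; last first.
  have JT : J != setT.
    apply/eqP=> JT; move/existsPn: no => /(_ b); by rewrite bW bZ JT inE.
  have [i [j [/imsetP[x xWZ ->] jJ ij]]] := prime_conn pQ Q3 J0 JT.
  have [y yW qy] := sq j; exists x, y.
  move: xWZ; rewrite inE => /andP[xW xZ]; split=> //.
    by apply: contra jJ => yZ; rewrite -qy imset_f // inE yW.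
  by rewrite eW // qy //; apply: contraNneq jJ => <-; apply: imset_f; rewrite inE xW.
case/imsetP: yJ => x; rewrite inE => /andP[xW xZ] qyx.
have [j [_ [ji _ ij _]]] := prime_nonconst (q y) pQ Q3.
have [z zW qz] := sq j.
have ezy : e y z by rewrite eW // qz // eq_sym.
have exz : e x z by rewrite eW // qz -qyx // eq_sym.
have [zZ|zZ] := boolP (z \in Z); first by exists z, y; rewrite es.
by exists x, z.
Qed.

End Tools.

(** * The splitting statement and its principal cases *)

Section Split.
Variable V : Type.
Implicit Types X P Q H W K D : graph V.

Lemma iso0 (X Y : graph V) : #|X| = 0 -> #|Y| = 0 -> isomorphic X Y.
Proof. by move=> X0 Y0; apply: iso_trans (par0_iso X Y0) (iso_sym (par0x_iso Y X0)). Qed.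

Definition tensor_split K W (I : finType) (q : W -> I) :=
  exists H (r : H -> I), [/\ forall x y, r x != r y -> ~~ edge x y,
    forall i, prov (par (sub [set x | r x == i]) (sub [set x | q x == i])) & le H K].

Definition dual_split K W Q (q : W -> Q) :=
  exists H (r : H -> Q), [/\ forall x y, r x != r y -> edge x y = ~~ edge (r x) (r y),
    forall i, prov (par (sub [set x | r x == i]) (sub [set x | q x == i])) & le H K].

Definition peel_split K W Q (q : W -> Q) :=
  exists (i : Q) KX KY, [/\ prov (par KX (sub [set x | q x == i])),
    prov (par KY (sub [set x | q x != i])) & le (par KX KY) K].

(** The three forms are proved together: the premise of the last rule may have to be split along a
    quotient of another kind than the one given for [W]. *)
Definition splitting n := forall K W, nonadj (par K W) < n -> prov (par K W) ->
  [/\ forall (I : finType) (q : W -> I), (forall x y, q x != q y -> edge x y) -> tensor_split K q,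
      forall Q (q : W -> Q), prime_graph Q -> 4 <= #|Q| -> (forall i, exists x, q x = i) ->
        (forall x y, q x != q y -> edge x y = edge (q x) (q y)) -> dual_split K q \/ peel_split K q
    & forall w : W, (forall x : W, x = w) -> entails (atom_graph (dual_atom (label w))) K].

(** Connectedness by cuts instead of paths: every cut of [W] is crossed by an edge. *)
Definition conn X (W : {set X}) := forall (Z : {set X}) a b,
  a \in W -> a \in Z -> b \in W -> b \notin Z ->
  exists x y, [/\ x \in W, x \in Z, y \in W, y \notin Z & edge x y].

Definition coconn X (W : {set X}) := forall (Z : {set X}) a b,
  a \in W -> a \in Z -> b \in W -> b \notin Z ->
  exists x y, [/\ x \in W, x \in Z, y \in W, y \notin Z & ~~ edge x y].

(* What remains of the case analysis of the last rule of a proof of [G], whose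
   component [W] is to be split off.  Either [Phi] holds, or the rule is an axiom
   linking [W] to its complement, or it acts inside [W], or the blocks of the
   premise cut [W] along the module [L], or [W] is one half of the redex of p. *)
Inductive principal (G : graph V) (W : {set G}) (Phi : graph V -> Prop) : Prop :=
| PrDone : Phi (sub (~: W)) -> principal W Phi
| PrAi x y : x \in W -> y \notin W -> label y = dual_atom (label x) ->
    homog [set x; y] setT -> prov (sub (~: [set x; y])) -> principal W Phi
| PrAiIn x y : x \in W -> y \in W -> x != y -> label x = dual_atom (label y) -> ~~ edge x y ->
    homog [set x; y] setT -> prov (sub (~: [set x; y])) -> principal W Phi
| PrIn e (Y : {set G}) : reduct e Y -> coconn Y -> Y \subset W -> Y != W ->
    prov (@regraph V G e) -> principal W Phi
| PrCross F F' (L : {set G}) : L \subset W -> L != set0 -> L != W -> homog L W ->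
    prov (par F (sub L)) -> prov (par F' (sub (W :\: L))) ->
    le (par F F') (sub (~: W)) -> nonadj (par F (sub L)) < nonadj G ->
    nonadj (par F' (sub (W :\: L))) < nonadj G -> principal W Phi
| PrQuot P (q : G -> P) H (r : H -> P) : prime_graph P -> 4 <= #|P| ->
    {in W &, forall x y, q x != q y -> edge x y = edge (q x) (q y)} ->
    (forall i, exists2 x, x \in W & q x = i) ->
    (forall x y, r x != r y -> edge x y = ~~ edge (r x) (r y)) ->
    (forall i, prov (par (sub [set x | r x == i]) (sub [set x in W | q x == i]))) ->
    le H (sub (~: W)) -> principal W Phi.

Section Skeleton.
Variables (G : graph V) (W : {set G}) (Phi : graph V -> Prop).
Hypotheses (Wap : apart W (~: W)) (Wconn : conn W) (W0 : W != set0).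
Hypothesis Phi_le : forall K K', le K K' -> Phi K -> Phi K'.
Hypothesis Phi_red : forall K, prov (par K (sub W)) -> nonadj (par K (sub W)) < nonadj G -> Phi K.

(** [Phi K] stands for one of the three splitting claims about [K] and the fixed [W]; [Phi_red] is
    the induction hypothesis and [Phi_le] its stability under replacement. Together they settle each
    case in which [W] survives as a component of a smaller provable graph. *)
Lemma principal_done K : prov (par K (sub W)) -> nonadj (par K (sub W)) < nonadj G ->
  le K (sub (~: W)) -> principal W Phi.
Proof. by move=> p l h; apply: PrDone; apply: Phi_le h _; exact: Phi_red. Qed.

(** The side graph comes from outside [U] and its partner from a proper part of [U], so the loss of
    vertices alone lowers the measure. *)
Lemma nonadj_part (U L : {set G}) K T : apart U (~: U) -> L \proper U -> injects K (sub (~: U)) ->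
  injects T (sub L) -> nonadj (par K T) < nonadj G.
Proof.
move=> Uap LU sK sT.
rewrite (nonadj_iso (whole_cut Uap)) (nonadj_iso (parC (sub U) _)); apply: nonadj_par_lt => //.
  by apply: leq_trans (injects_card sT) _; apply: injects_card; apply: injects_subS; exact: proper_sub.
by apply: leq_ltn_trans (injects_nn sT) _; exact: nonadj_sub_lt.
Qed.

Lemma rest_iso (U : {set G}) : W \subset U -> apart U (~: U) ->
  isomorphic (sub (~: W)) (par (sub (~: U)) (sub (U :\: W))).
Proof.
move=> sWU Uap.
have e : ~: W = ~: U :|: (U :\: W).
  apply/setP=> x; rewrite !inE; have := subsetP sWU x.
  by case: (x \in W); case: (x \in U) => //= /(_ isT).
rewrite e; apply: sub_cut.
  by move=> a b; rewrite !inE => aU /andP[_ bU]; rewrite edge_sym Uap // inE.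
by apply/pred0P=> x /=; rewrite !inE; case: (x \in U); rewrite ?andbF.
Qed.

(** * The rule ss with the component inside its redex *)

Section SS.
Variables (A B S : {set G}).
Hypothesis ssD : ss_data A B S.
Let e := ss_rel A S.
Let G' := regraph e.
Hypothesis WAB : W \subset A \/ W \subset B.
Variable U : {set G}.
Hypotheses (sAU : A \subset U) (sWU : W \subset U) (sUY : U \subset A :|: B).
Hypothesis Uap' : @apart V G' U (~: U).
Hypothesis Umin : forall U' : {set G}, A \subset U' -> W \subset U' -> U' \subset U ->
  @apart V G' U' (~: U') -> U' = U.

Let apAB : apart A B. Proof. by case: ssD. Qed.
Let djAB : [disjoint A & B]. Proof. by case: ssD. Qed.
Let sSB : S \subset B. Proof. by case: ssD. Qed.
Let A0 : A != set0. Proof. by case: ssD => _ _ _ _ []. Qed.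
Let djAS : [disjoint A & S]. Proof. exact: disjointWr sSB djAB. Qed.

Let eE (x y : G) : @edge V G' x y = [|| edge x y, (x \in A) && (y \in S) | (x \in S) && (y \in A)].
Proof. exact: ss_relE. Qed.

Let e_more (x y : G) : edge x y -> @edge V G' x y.
Proof. by rewrite eE => ->. Qed.

Let e_out (x y : G) : x \notin A -> y \notin A -> @edge V G' x y = edge x y.
Proof. by move=> /negbTE xA /negbTE yA; rewrite eE xA yA andbF !orbF. Qed.

Let e_in (x y : G) : x \in A -> y \in A -> @edge V G' x y = edge x y.
Proof. by move=> xA yA; rewrite eE (disjointFr djAS xA) (disjointFr djAS yA) !andbF !orbF. Qed.

Let e_AB (x y : G) : x \in B -> y \in A -> @edge V G' x y = (x \in S).
Proof.
move=> xB yA; rewrite eE yA andbT (disjointFl djAB xB) /=.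
by rewrite edge_sym (negbTE (apAB yA xB)).
Qed.

Let Uap : apart U (~: U).
Proof. by move=> a b aU bU; apply: contra (Uap' aU bU); exact: e_more. Qed.

Let sub'_iso (Z : {set G}) : [disjoint A & Z] -> isomorphic (@sub V G' Z) (sub Z).
Proof.
by move=> dj; apply: sub_regraph_base_iso => x y xZ yZ; apply: e_out; rewrite (disjointFl dj).
Qed.

Let sub'A_iso (Z : {set G}) : Z \subset A -> isomorphic (@sub V G' Z) (sub Z).
Proof.
by move=> /subsetP sZ; apply: sub_regraph_base_iso => x y /sZ xZ /sZ yZ; exact: e_in.
Qed.

Let Wn (z a : G) : z \notin W -> a \in W -> edge z a = false.
Proof. by move=> zW aW; rewrite edge_sym (negbTE (Wap aW _)) // inE. Qed.

Let Wcut (Z : {set G}) : W \subset Z -> isomorphic (sub Z) (par (sub W) (sub (Z :\: W))).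
Proof.
by move=> sWZ; apply: sub_cutD => // a b aW; rewrite inE => /andP[bW _]; apply: Wap; rewrite ?inE.
Qed.

(** For [W] inside [A], the premise attaches all of [W] to the same vertices, so [W] is a module of
    [L] and ss detaches it. Otherwise [L] avoids [A] and carries no new edges. *)
Lemma peelW (L : {set G}) K : W \subset L -> L \subset U -> A \subset L \/ [disjoint A & L] ->
  (W \subset B -> [disjoint A & L]) ->
  prov (par K (@sub V G' L)) -> prov (par (par K (@sub V G' (L :\: W))) (sub W)).
Proof.
move=> sWL sLU AL WB pr.
have sWA : W \subset A \/ [disjoint A & L].
  by case: WAB => [|/WB]; [left | right].
apply: (prov_iso (X := par K (par (@sub V G' (L :\: W)) (sub W)))); first by par_ac.
apply: (prov_der pr); apply: der_par (der_refl _) _.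
case: sWA => [sWA|dj].
  apply: der_trans (detach_in (X := G') sWL _) _; last first.
    by apply: der_par (der_refl _) _; apply: der_iso; exact: sub'A_iso.
  move=> z a b zL zW aW bW.
  have [aA bA] : a \in A /\ b \in A by split; exact: (subsetP sWA).
  have /setUP[zA|zB] := subsetP sUY z (subsetP sLU z zL).
    by rewrite !e_in // (Wn zW aW) (Wn zW bW).
  by rewrite !e_AB.
apply: der_iso; apply: iso_trans (sub'_iso dj) _; apply: iso_trans (Wcut sWL) _.
apply: iso_trans (parC _ _) _; apply: par_iso (iso_refl _); apply: iso_sym; apply: sub'_iso.
exact: disjointWr (subsetDl _ _) dj.
Qed.

(* [L] is a block of the premise of ss that splits off.  If it contains [W] or
   avoids [W], the problem reduces to a smaller one for [W] itself. *)
Lemma ss_peel_split (L : {set G}) KX KY : L \subset U -> L != set0 -> L != U -> @homog V G' L U ->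
  A \subset L \/ [disjoint A & L] ->
  prov (par KX (@sub V G' L)) -> prov (par KY (@sub V G' (U :\: L))) ->
  le (par KX KY) (sub (~: U)) -> principal W Phi.
Proof.
move=> sLU L0 LU hL AL pX pY lXY.
have pLU : L \proper U by rewrite properEneq LU.
have pDU : U :\: L \proper U.
  apply/properP; split; first exact: subsetDl.
  by case/set0Pn: L0 => x xL; exists x; [exact: (subsetP sLU) | rewrite inE xL].
have shX : injects KX (sub (~: U)) := injects_trans (injects_parl _ _) lXY.1.
have shY : injects KY (sub (~: U)) := injects_trans (injects_parr _ _) lXY.1.
have Wrest := rest_iso sWU Uap.
(* Three positions: [W] lies in the rest [U :\: L], inside [L], or is cut by [L]. *)
have [WL0|/set0Pn[w1]] := eqVneq (W :&: L) set0; last rewrite inE => /andP[w1W w1L].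
  have sWD : W \subset U :\: L.
    by rewrite subsetD sWU /= -setI_eq0 WL0.
  pose T := U :\: L :\: W.
  apply: (@principal_done (par KY (sub T))).
  - apply: (prov_iso (X := par KY (par (sub W) (sub T)))); first by par_ac.
    apply: (prov_der pY); apply: der_par (der_refl _) _.
    by apply: der_trans (ss_sub_der _ ssD) _; apply: der_iso; exact: Wcut.
  - rewrite (nonadj_iso (Y := par KY (par (sub W) (sub T)))); last by par_ac.
    apply: (nonadj_part Uap pDU shY); apply: injects_iso; apply: iso_sym; exact: Wcut.
  apply: (@le_trans _ (par (par KX KY) (sub (U :\: W)))); last first.
    apply: le_trans (le_iso (iso_sym Wrest)); exact: le_par lXY (le_refl _).
  have eT : T = U :\: W :\: L by rewrite /T !setDDl setUC.
  have sLW : L \subset U :\: W.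
    by rewrite subsetD sLU /= disjoint_sym -setI_eq0 WL0.
  (* With [A] inside [L], the block is inserted in the premise, where it is a module, and ss
     follows. With [A] outside, it is a module of the conclusion too and is inserted there. *)
  case: AL => AL.
    split.
      apply: injects_par; first exact: injects_parr.
      by apply: injects_subS; rewrite eT subsetDl.
    apply: (@entails_trans _ (par (par KX KY) (@sub V G' (U :\: W)))); last first.
      by apply: entails_der; apply: der_par (der_refl _) _; exact: ss_sub_der ssD.
    apply: (@entails_trans _ (par KY (@sub V G' T))).
      apply: entails_der; apply: der_par (der_refl _) _; apply: der_iso; apply: iso_sym.
      apply: sub'_iso; apply/pred0P=> x /=; rewrite !inE.
      by case xA: (x \in A) => //=; rewrite (subsetP AL x xA) andbF.
    rewrite eT; apply: (le_insert (X := G') KY sLW _ pX).2.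
    by move=> z a b zU; apply: hL; move: zU; rewrite inE => /andP[].
  rewrite eT; apply: le_insert => //; last by apply: prov_der pX (der_par (der_refl _) (ss_sub_der _ ssD)).
  move=> z a b; rewrite inE => /andP[_ zU] zL aL bL.
  have aA : a \notin A by rewrite (disjointFl AL aL).
  have bA : b \notin A by rewrite (disjointFl AL bL).
  have [zA|zA] := boolP (z \in A); last by have := hL z a b zU zL aL bL; rewrite !e_out.
  have aB : a \in B by have := subsetP sUY a (subsetP sLU a aL); rewrite inE (negbTE aA).
  have bB : b \in B by have := subsetP sUY b (subsetP sLU b bL); rewrite inE (negbTE bA).
  by rewrite !(negbTE (apAB _ _)).
have [sWL|/subsetPn[w2 w2W w2L]] := boolP (W \subset L).
  have WB : W \subset B -> [disjoint A & L].
    (* If [A] were inside [L], no edge of the premise would leave [L]: a vertex of [U] outside [L]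
       sees all of [L] as it sees [W], that is, not at all. This contradicts the minimality of
       [U]. *)
    move=> sWB; case: AL => // AL; exfalso; case/negP: LU; apply/eqP; apply: Umin => //.
    apply: (@apartC V G') => z a; rewrite inE => zL aL.
    have [zU|zU] := boolP (z \in U); last first.
      by rewrite edge_sym; apply: Uap'; [exact: (subsetP sLU) | rewrite inE].
    rewrite (hL z a w1) // e_out.
    - by rewrite edge_sym Wap // inE; apply: contra zL; exact: (subsetP sWL).
    - by apply: contra zL; exact: (subsetP AL).
    - by rewrite (disjointFl djAB) // (subsetP sWB).
  have sDL : injects (@sub V G' (L :\: W)) (sub (L :\: W)).
    by apply: injects_regraph => x y; exact: e_more.
  apply: (@principal_done (par KX (@sub V G' (L :\: W)))).
  - exact: peelW.
  - rewrite (nonadj_iso (Y := par KX (par (sub W) (@sub V G' (L :\: W))))); last by par_ac.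
    apply: (nonadj_part Uap pLU shX).
    apply: injects_trans (injects_iso (iso_sym (Wcut sWL))); exact: injects_par (injects_refl _) sDL.
  apply: (@le_trans _ (par (par KX KY) (sub (U :\: W)))); last first.
    apply: le_trans (le_iso (iso_sym Wrest)); exact: le_par lXY (le_refl _).
  split.
    apply: injects_par; first exact: injects_parl.
    by apply: injects_trans sDL _; apply: injects_subS; exact: setSD.
  apply: (@entails_trans _ (par (par KX KY) (@sub V G' (U :\: W)))); last first.
    by apply: entails_der; apply: der_par (der_refl _) _; exact: ss_sub_der ssD.
  move=> D pD; apply: (prov_iso (X := par (par (par KX D) KY) (@sub V G' (U :\: W)))).
    by par_ac.
  apply: (insert_par (X := G') (A := L :\: W)).
  - exact: setSD.
  - move=> z a b; rewrite !inE => /andP[zW zU]; rewrite zW /= => zL /andP[_ aL] /andP[_ bL].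
    exact: hL.
  - by apply: prov_iso pD; par_ac.
  - have -> : U :\: W :\: (L :\: W) = U :\: L.
      apply/setP=> x; rewrite !inE; have := subsetP sWL x.
      by case: (x \in W) => [/(_ isT)->|_]; rewrite ?andbF ?andbT /=.
    exact: pY.
have sWB : W \subset B.
  case: WAB => // sWA; case: AL => [AL|AL].
    by have := subsetP AL w2 (subsetP sWA w2 w2W); rewrite (negbTE w2L).
  by have := disjointFl AL w1L; rewrite (subsetP sWA).
have WnA x : x \in W -> x \notin A by move=> xW; rewrite (disjointFl djAB) // (subsetP sWB).
have sIL : W :&: L \subset L by exact: subsetIr.
have eL : L :\: (W :&: L) = L :\: W by rewrite setDIr setDv setU0.
have apIL : apart (W :&: L) (L :\: (W :&: L)).
  by rewrite eL => x y; rewrite !inE => /andP[xW _] /andP[yW _]; apply: Wap; rewrite ?inE.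
have isoL := sub_cutD sIL apIL; rewrite eL in isoL.
have sJD : W :\: L \subset U :\: L by exact: setSD.
have eD : U :\: L :\: (W :\: L) = U :\: L :\: W.
  by apply/setP=> x; rewrite !inE; case: (x \in L); case: (x \in W).
have apJD : apart (W :\: L) (U :\: L :\: (W :\: L)).
  by rewrite eD => x y; rewrite !inE => /andP[_ xW] /andP[yW _]; apply: Wap; rewrite ?inE.
have isoD := sub_cutD sJD apJD; rewrite eD in isoD.
have eWL : W :\: (W :&: L) = W :\: L by rewrite setDIr setDv set0U.
apply: (@PrCross G W Phi (par KX (sub (L :\: W))) (par KY (sub (U :\: L :\: W))) (W :&: L)).
- exact: subsetIl.
- by apply/set0Pn; exists w1; rewrite inE w1W.
- by apply/eqP=> /setP/(_ w2); rewrite inE w2W (negbTE w2L).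
- move=> z a b zW; rewrite !inE zW /= => zL /andP[aW aL] /andP[bW bL].
  have := hL z a b (subsetP sWU z zW) zL aL bL.
  by rewrite !e_out ?WnA.
- apply: (prov_iso (X := par KX (par (sub (W :&: L)) (sub (L :\: W))))); first by par_ac.
  apply: (prov_der pX); apply: der_par (der_refl _) _; apply: der_trans (ss_sub_der _ ssD) _.
  exact: der_iso.
- rewrite eWL; apply: (prov_iso (X := par KY (par (sub (W :\: L)) (sub (U :\: L :\: W))))).
    by par_ac.
  apply: (prov_der pY); apply: der_par (der_refl _) _; apply: der_trans (ss_sub_der _ ssD) _.
  exact: der_iso.
(* Edges between [A] and [B] are absent from the conclusion. An edge inside [B] between the two
   remainders would also reach [w1] in the component [W], since [L] is a module of the premise. *)
- have ap : apart (L :\: W) (U :\: L :\: W).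
    move=> x y; rewrite !inE => /andP[xW xL] /and3P[yW yL yU]; rewrite edge_sym; apply/negP=> yx.
    have /setUP[yA|yB] := subsetP sUY y yU.
      case: AL => AL; first by rewrite (subsetP AL) in yL.
      have xB : x \in B.
        by have := subsetP sUY x (subsetP sLU x xL); rewrite inE (disjointFl AL xL).
      by rewrite (negbTE (apAB yA xB)) in yx.
    have xB : x \in B.
      have /setUP[xA|//] := subsetP sUY x (subsetP sLU x xL).
      by rewrite edge_sym (negbTE (apAB xA yB)) in yx.
    have ynA : y \notin A by rewrite (disjointFl djAB).
    have xnA : x \notin A by rewrite (disjointFl djAB).
    have := hL y x w1 yU yL xL w1L.
    by rewrite (e_out ynA xnA) (e_out ynA (WnA _ w1W)) yx (Wn yW w1W).
  have dj : [disjoint L :\: W & U :\: L :\: W].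
    by apply/pred0P=> x /=; rewrite !inE; case: (x \in L); rewrite ?andbF.
  have eU : U :\: W = (L :\: W) :|: (U :\: L :\: W).
    apply/setP=> x; rewrite !inE; have := subsetP sLU x.
    by case: (x \in W); case: (x \in L) => //= ->.
  apply: (@le_trans _ (par (par KX KY) (sub (U :\: W)))); last first.
    apply: le_trans (le_iso (iso_sym Wrest)); exact: le_par lXY (le_refl _).
  apply: le_iso; rewrite eU; apply: iso_trans (par_iso (iso_refl _) (iso_sym (sub_cut ap dj))).
  by par_ac.
- rewrite (nonadj_iso (Y := par KX (par (sub (W :&: L)) (sub (L :\: W))))); last by par_ac.
  by apply: (nonadj_part Uap pLU shX); apply: injects_iso; exact: iso_sym.
- rewrite eWL (nonadj_iso (Y := par KY (par (sub (W :\: L)) (sub (U :\: L :\: W))))); last by par_ac.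
  by apply: (nonadj_part Uap pDU shY); apply: injects_iso; exact: iso_sym.
Qed.

(** [A] lies in one block [i0] of the quotient of [U]. If [W] is inside [A], the problem shrinks to
    that block; if [W] is inside [B], the graph [A] moves to the side graph and joins the fibre of
    [i0] there. *)
Lemma ss_dual_split Q (q : G -> Q) H (r : H -> Q) : prime_graph Q -> 4 <= #|Q| ->
  (forall i, exists2 x, x \in U & q x = i) ->
  {in U &, forall x y, q x != q y -> @edge V G' x y = edge (q x) (q y)} ->
  {in A &, forall x y, q x = q y} ->
  (forall x y, r x != r y -> edge x y = ~~ edge (r x) (r y)) ->
  (forall i, prov (par (sub [set x | r x == i]) (@sub V G' [set x in U | q x == i]))) ->
  le H (sub (~: U)) -> principal W Phi.
Proof.
move=> pQ Q4 sq eq qA er pr lH; have Q3 := ltnW Q4.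
pose F i := [set x in U | q x == i].
have sFU i : F i \subset U by apply/subsetP=> x; rewrite inE => /andP[].
have hF i : @homog V G' (F i) U.
  move=> z a b zU; rewrite !inE zU andTb => zi /andP[aU /eqP ai] /andP[bU /eqP bi].
  by rewrite !eq ?ai ?bi.
have pF i : F i \proper U.
  have [j [_ [ji _ _ _]]] := prime_nonconst i pQ Q3; have [x xU qx] := sq j.
  by apply/properP; split=> //; exists x; rewrite ?inE ?xU ?qx ?(negbTE ji).
have AF i : A \subset F i \/ [disjoint A & F i].
  have /set0Pn[a aA] := A0; have [ai|ai] := eqVneq (q a) i; [left|right].
    by apply/subsetP=> x xA; rewrite inE (subsetP sAU) //= (qA x a) // ai.
  apply/pred0P=> x /=; rewrite !inE; case xA: (x \in A) => //=.
  by rewrite (qA x a) // (negbTE ai) andbF.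
have fibE (Z : {set G}) i : [set x in U :\: Z | q x == i] = F i :\: Z.
  by apply/setP=> x; rewrite !inE andbA.
(* An empty fibre of [H] means that a block of [U] is provable alone, a case of peeling. Once this
   is excluded every fibre is inhabited, which makes [R] nonempty below. *)
have [[k rk]|rs] : (exists k, forall x, r x != k) \/ (forall k, exists x, r x = k).
- have [/existsP[k /forallP h]|no] := boolP [exists k, forall x, r x != k].
    by left; exists k.
  right=> k; move/existsPn: no => /(_ k)/forallPn[x]; rewrite negbK => /eqP <-; by exists x.
- have rk0 : [set x | r x == k] = set0 by apply/setP=> x; rewrite !inE; apply/negbTE.
  apply: (@ss_peel_split (F k) (empty_graph V) H) => //.
  + by have [x xU qx] := sq k; apply/set0Pn; exists x; rewrite inE xU qx /=.
  + by case/andP: (pF k) => _; apply: contraNneq => ->.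
  + apply: prov_iso (pr k); apply: par_iso (iso_refl _).
    by apply: iso0; rewrite ?card_empty // card_sub rk0 cards0.
  + apply: (id_par (Q := Q) (r := r) (q := fun x : @sub V G' (U :\: F k) => q (val x))) => //.
      by move=> x y; apply: eq; [have := valP x | have := valP y]; rewrite inE => /andP[].
    move=> i; have [->|ni] := eqVneq i k.
      apply: prov_par; first exact: sub0_prov.
      apply: prov_iso (iso_sym (fib_sub_iso (X := G') q (U :\: F k) k)) _.
      by apply: sub0_prov; rewrite fibE setDv.
    apply: prov_iso (pr i). apply: par_iso; first exact: iso_refl.
    apply: iso_trans (iso_sym (fib_sub_iso (X := G') q (U :\: F k) i)).
    suff <- : F i = [set x in U :\: F k | q x == i] by [].
    rewrite fibE; apply/setP=> x; rewrite !inE.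
    by case: (eqVneq (q x) i) => [->|_]; rewrite ?andbF ?(negbTE ni) ?andbF.
  + by apply: le_trans lH; apply: le_iso; par_ac.
have /set0Pn[a0 a0A] := A0; pose i0 := q a0.
have a0F : A \subset F i0.
  by apply/subsetP=> x xA; rewrite inE (subsetP sAU) //= (qA x a0).
have Wrest := rest_iso sWU Uap.
case: WAB => [sWA|sWB].
- have sWF : W \subset F i0 by exact: subset_trans sWA a0F.
  have WB : W \subset B -> [disjoint A & F i0].
    move=> sWB; case/set0Pn: W0 => w wW.
    by have := disjointFr djAB (subsetP sWA w wW); rewrite (subsetP sWB).
  have sDL : injects (@sub V G' (F i0 :\: W)) (sub (F i0 :\: W)).
    by apply: injects_regraph => x y; exact: e_more.
  have shH : injects (sub [set x | r x == i0]) (sub (~: U)) := injects_trans (injects_sub _) lH.1.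
  apply: (@principal_done (par (sub [set x | r x == i0]) (@sub V G' (F i0 :\: W)))).
  + by apply: peelW => //; left.
  + rewrite (nonadj_iso (Y := par (sub [set x | r x == i0]) (par (sub W) (@sub V G' (F i0 :\: W))))).
      apply: (nonadj_part Uap (pF i0) shH).
      apply: injects_trans (injects_iso (iso_sym (Wcut sWF))); exact: injects_par (injects_refl _) sDL.
    by par_ac.
  apply: (@le_trans _ (par H (sub (U :\: W)))); last first.
    apply: le_trans (le_iso (iso_sym Wrest)); exact: le_par lH (le_refl _).
  split.
    apply: injects_par; first exact: injects_sub.
    by apply: injects_trans sDL _; apply: injects_subS; exact: setSD.
  apply: (@entails_trans _ (par H (@sub V G' (U :\: W)))); last first.
    by apply: entails_der; apply: der_par (der_refl _) _; exact: ss_sub_der ssD.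
  (* [D] enters the block of [A], where it takes the place of [W]. *)
  move=> D pD; pose C := @sub V G' (U :\: W).
  pose R : {set C} := [set c : C | edge (q (val c)) i0].
  apply: (prov_iso (X := par H (par (@sub V G' (U :\: W)) D))); first by par_ac.
  apply: (prov_der _ (der_par (der_refl _) (der_ss D R))).
  apply: (@id_par V H (plug R D) Q r (sumf (fun c : C => q (val c)) (fun _ => i0))) => //.
    case=> [x|x] [y|y] /= n; last by rewrite eqxx in n.
    + by apply: eq => //; [have := valP x | have := valP y]; rewrite inE => /andP[].
    + by rewrite inE.
    + by rewrite inE edge_sym.
  move=> i; have fI : isomorphic (@sub V (plug R D) [set u | sumf (fun c : C => q (val c)) (fun _ => i0) u == i])
      (par (@sub V G' (F i :\: W)) (sub [set d : D | i0 == i])).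
    apply: iso_trans (fib_plug_iso _ _) _.
      by move=> x d; rewrite inE; apply: contraTneq => ->; rewrite edge_irrefl.
    apply: par_iso (iso_refl _); rewrite -fibE.
    exact: (fib_sub_iso (X := G') q (U :\: W) i).
  apply: (prov_iso (par_iso (iso_refl _) (iso_sym fI))).
  have [<-|ni] := eqVneq i0 i.
    apply: prov_iso pD; apply: iso_trans (iso_sym (parA _ _ _)) _.
    apply: par_iso (iso_refl _) _; apply: par_iso (iso_refl _) _.
    by apply: iso_sym; rewrite (_ : [set d : D | true] = setT); [exact: subT_iso | apply/setP=> x; rewrite !inE].
  apply: prov_iso (pr i); apply: par_iso (iso_refl _) _.
  have -> : F i :\: W = F i.
    apply/setDidPl; rewrite disjoint_sym; apply/pred0P=> x /=; apply/negP=> /andP[xW].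
    by have := subsetP sWF x xW; rewrite !inE => /andP[-> /eqP->]; rewrite (negbTE ni).
  by apply: par0_iso; rewrite card_sub; apply: eq_card0 => x; rewrite !inE.
(* [A] is attached as the dual quotient prescribes, to the other fibres not adjacent to [i0] in [Q].
   These edges, absent from the conclusion, make the measure drop. *)
pose R := [set x : H | (r x != i0) && ~~ edge (r x) i0].
have R0 : R != set0.
  have [_ [k [_ ki _ ik]]] := prime_nonconst i0 pQ Q3; have [x rx] := rs k.
  by apply/set0Pn; exists x; rewrite inE rx ki edge_sym ik.
have sWUA : W \subset U :\: A.
  by rewrite subsetD sWU /= disjoint_sym; exact: disjointWr sWB djAB.
have djUA : [disjoint A & U :\: A] by apply/pred0P=> x /=; rewrite !inE; case: (x \in A).
have apUA : apart A (U :\: A).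
  move=> x y xA; rewrite inE => /andP[yA yU]; apply: apAB => //.
  by have := subsetP sUY y yU; rewrite inE (negbTE yA).
pose T := U :\: A :\: W.
have isoU := sub_cutD sAU apUA.
have isoUA := Wcut sWUA.
apply: (@principal_done (par (plug R (sub A)) (sub T))).
- apply: (prov_iso (X := par (plug R (sub A)) (@sub V G' (U :\: A)))).
    apply: (iso_trans (Y := par (plug R (sub A)) (par (sub W) (sub T)))); last by par_ac.
    by apply: par_iso (iso_refl _) _; apply: iso_trans (sub'_iso djUA) _.
  apply: (@id_par V (plug R (sub A)) (@sub V G' (U :\: A)) Q (sumf r (fun _ => i0))
    (fun x => q (val x))).
  + case=> [x|x] [y|y] /= n; last by rewrite eqxx in n.
    * exact: er.
    * by rewrite inE n.
    * by rewrite inE edge_sym eq_sym n.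
  + by move=> x y; apply: eq; [have := valP x | have := valP y]; rewrite inE => /andP[].
  move=> i; apply: (prov_iso (X := par (par (sub [set x | r x == i]) (sub [set d : sub A | i0 == i]))
      (@sub V G' (F i :\: A)))).
    apply: par_iso; apply: iso_sym.
      by apply: fib_plug_iso => x d; rewrite inE => /andP[].
    by rewrite -fibE; exact: (fib_sub_iso (X := G') q (U :\: A) i).
  have [<-|ni] := eqVneq i0 i.
    rewrite (_ : [set d : sub A | true] = setT); last by apply/setP=> x; rewrite !inE.
    apply: (prov_iso (X := par (sub [set x | r x == i0]) (par (@sub V G' (F i0 :\: A)) (@sub V G' A)))).
      apply: (iso_trans (Y := par (sub [set x | r x == i0]) (par (@sub V G' (F i0 :\: A)) (sub [set: sub A])))).
        apply: par_iso (iso_refl _) _; apply: par_iso (iso_refl _) _.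
        by apply: iso_trans (sub'A_iso (subxx A)) (iso_sym (subT_iso _)).
      by par_ac.
    apply: (prov_der (pr i0)); apply: der_par (der_refl _) _.
    apply: (detach_in (X := G')) => // z a b; rewrite inE => /andP[zU zi] zA aA bA.
    have zB : z \in B by have := subsetP sUY z zU; rewrite inE (negbTE zA).
    by rewrite !e_AB.
  have -> : F i :\: A = F i.
    apply/setDidPl; rewrite disjoint_sym; apply/pred0P=> x /=; apply/negP=> /andP[xA].
    by have := subsetP a0F x xA; rewrite !inE => /andP[-> /eqP->]; rewrite (negbTE ni).
  apply: prov_iso (pr i); apply: par_iso (iso_refl _).
  by apply: par0_iso; rewrite card_sub; apply: eq_card0 => x; rewrite !inE.
- apply: (@leq_ltn_trans (nonadj (par (plug R (sub A)) (sub (U :\: A))))).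
    apply: injects_nn; apply: injects_trans (injects_par (injects_refl _) (injects_iso (iso_sym isoUA))).
    by apply: injects_iso; rewrite /T; par_ac.
  apply: (@leq_trans (nonadj (par (par (sub (~: U)) (sub A)) (sub (U :\: A))))); last first.
    apply: injects_nn; apply: injects_iso; apply: iso_trans _ (iso_sym (whole_cut Uap)).
    apply: iso_trans (par_iso (iso_sym isoU) (iso_refl _)).
    by par_ac.
  have shH := lH.1.
  apply: nonadj_par_ltl; first exact: injects_refl.
    apply: leq_trans (injects_card (injects_par shH (injects_refl (sub A)))).
    exact: injects_card (le_plug R (sub A)).1.
  apply: leq_trans (nonadj_plug_lt R0 _) (injects_nn (injects_par shH (injects_refl _))).
  by rewrite card_sub; apply/card_gt0P; exists a0.
- apply: (@le_trans _ (par (par (sub (~: U)) (sub A)) (sub T))).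
    apply: le_par (le_refl _); apply: le_trans (le_plug _ _) _.
    exact: le_par lH (le_refl _).
  apply: le_iso; apply: iso_trans _ (iso_sym Wrest).
  apply: (iso_trans (Y := par (sub (~: U)) (par (sub A) (sub T)))); first by par_ac.
  apply: par_iso (iso_refl _) _; apply: iso_sym.
  have -> : T = U :\: W :\: A by rewrite /T !setDDl setUC.
  apply: sub_cutD.
    by rewrite subsetD sAU /=; exact: disjointWr sWB djAB.
  move=> x y xA; rewrite !inE => /and3P[yA _ yU]; apply: apUA => //; by rewrite inE yA.
Qed.

End SS.
End Skeleton.
End Split.

(** * Case analysis of the last rule *)

Section Skeleton2.
Variable V : Type.
Implicit Types X P Q H K D : graph V.

(** Quotient maps of a subgraph are needed as maps on the whole graph; [t0] is the default outside
    [Z]. *)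
Lemma ext_fun X (Z : {set X}) (T : Type) (t0 : T) (q : sub Z -> T) :
  exists q' : X -> T, forall u : sub Z, q' (val u) = q u.
Proof.
exists (fun x => if (insub x : option {x : X | x \in Z}) is Some u then q u else t0) => u.
by rewrite valK.
Qed.

Lemma card2_cov (T : finType) (i j k : T) : #|T| = 2 -> i != j -> (k == i) || (k == j).
Proof.
move=> T2 ij; have : k \in [set i; j].
  suff -> : [set i; j] = setT by rewrite inE.
  by apply/eqP; rewrite eqEcard subsetT cardsT T2 cards2 ij.
by rewrite !inE.
Qed.

Variables (n : nat) (G : graph V) (W : {set G}) (Phi : graph V -> Prop).
Hypothesis IH : splitting V n.
Hypothesis nG : nonadj G <= n.
Hypotheses (Wap : apart W (~: W)) (Wconn : conn W) (W0 : W != set0).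
Hypothesis Phi_le : forall K K', le K K' -> Phi K -> Phi K'.
Hypothesis Phi_red : forall K, prov (par K (sub W)) -> nonadj (par K (sub W)) < nonadj G -> Phi K.

Let Wn (z a : G) : z \notin W -> a \in W -> edge z a = false.
Proof. by move=> zW aW; rewrite edge_sym (negbTE (Wap aW _)) // inE. Qed.

Lemma skeleton_ss (A B S : {set G}) : ss_data A B S -> prov (regraph (ss_rel A S)) ->
  W \subset A \/ W \subset B -> principal W Phi.
Proof.
move=> ssD pG' WAB; have [apAB djAB hY sSB [A0 S0]] := ssD.
have djAS : [disjoint A & S] by exact: disjointWr sSB djAB.
pose G' := regraph (ss_rel A S).
have eE (x y : G) : @edge V G' x y = [|| edge x y, (x \in A) && (y \in S) | (x \in S) && (y \in A)].
  exact: ss_relE.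
have e_more (x y : G) : edge x y -> @edge V G' x y by rewrite eE => ->.
have sWY : W \subset A :|: B.
  by case: WAB => s; apply: subset_trans s _; [exact: subsetUl | exact: subsetUr].
have lG' : nonadj G' < nonadj G by exact: reduct_lt (ss_data_reduct ssD).
(* If the attachment avoids [W], then [W] is still a component of the premise and the problem is
   already smaller. *)
have [/andP[sWB djSW]|link] := boolP ((W \subset B) && [disjoint S & W]).
  have Wap' : @apart V G' W (~: W).
    move=> x y xW yW; rewrite eE (negbTE (Wap xW yW)) /=.
    by rewrite (disjointFl djSW xW) (disjointFl djAB) // (subsetP sWB).
  have Wiso : isomorphic (@sub V G' W) (sub W).
    apply: sub_regraph_base_iso => x y xW yW; rewrite ss_relE //.
    by rewrite !(disjointFl djSW) // andbF orbF.
  have Giso : isomorphic G' (par (@sub V G' (~: W)) (sub W)).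
    apply: iso_trans (whole_cut Wap') _; apply: iso_trans (parC _ _) _.
    by apply: par_iso; [exact: iso_refl | exact: Wiso].
  apply: (@principal_done V G W Phi Phi_le Phi_red (@sub V G' (~: W))).
  - exact: prov_iso Giso pG'.
  - by rewrite -(nonadj_iso Giso).
  - by split; [exact: injects_regraph | apply: entails_der; exact: (ss_sub_der _ ssD)].
have /set0Pn[a0 a0A] := A0; have /set0Pn[w0 w0W] := W0; have /set0Pn[s0 s0S] := S0.
pose closed' (U : {set G}) := [forall x in U, [forall y in ~: U, ~~ @edge V G' x y]].
have closedP (U : {set G}) : reflect (@apart V G' U (~: U)) (closed' U).
  apply: (iffP forall_inP) => h x; first by move=> y xU yU; move/forall_inP: (h x xU); apply.
  by move=> xU; apply/forall_inP=> y; exact: h.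
pose good (U : {set G}) := [&& A \subset U, W \subset U & closed' U].
have goodT : good setT.
  by rewrite /good !subsetT; apply/closedP=> x y _; rewrite !inE.
(* [U] is a smallest union of components of the premise containing both [A] and [W]. *)
case: (arg_minnP (fun U : {set G} => #|U|) goodT) => U /and3P[sAU sWU /closedP Uap'] Umin0.
have Umin (U' : {set G}) : A \subset U' -> W \subset U' -> U' \subset U ->
    @apart V G' U' (~: U') -> U' = U.
  move=> s1 s2 s3 ap; apply/eqP; rewrite eqEcard s3; apply: Umin0.
  by rewrite /good s1 s2; exact/closedP.
have sUY : U \subset A :|: B.
  suff <- : U :&: (A :|: B) = U by exact: subsetIr.
  apply: Umin; rewrite ?subsetI ?sAU ?sWU ?subsetUl ?subsetIl //.
  move=> x y; rewrite inE => /andP[xU xY] yI.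
  have [yY|yY] := boolP (y \in A :|: B).
    by apply: Uap' => //; move: yI; rewrite !in_setC in_setI yY andbT.
  have ny : @edge V G y x = false.
    rewrite (hY y x w0) ?in_setT //; last exact: (subsetP sWY).
    by apply: Wn => //; apply: contra yY; exact: (subsetP sWY).
  have yA : y \notin A by apply: contra yY; rewrite inE => ->.
  have yS : y \notin S by apply: contra yY => /(subsetP sSB); rewrite inE orbC => ->.
  by rewrite eE (@edge_sym V G x y) ny (negbTE yA) (negbTE yS) !andbF.
have Uap : apart U (~: U).
  by move=> x y xU yU; apply: contra (Uap' x y xU yU); exact: e_more.
have iso_out : isomorphic (@sub V G' (~: U)) (sub (~: U)).
  apply: sub_regraph_base_iso => x y; rewrite !inE => xU yU; rewrite ss_relE //.
  have -> : x \in A = false by apply: contraNF xU; exact: (subsetP sAU).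
  have -> : y \in A = false by apply: contraNF yU; exact: (subsetP sAU).
  by rewrite andbF !orbF.
pose U' := @sub V G' U.
have Giso : isomorphic G' (par (sub (~: U)) U').
  apply: iso_trans (whole_cut Uap') _; apply: iso_trans (parC _ _) _.
  by apply: par_iso; [exact: iso_out | exact: iso_refl].
have pU : prov (par (sub (~: U)) U') by exact: prov_iso Giso pG'.
have nU : nonadj (par (sub (~: U)) U') < n by rewrite -(nonadj_iso Giso); exact: leq_trans nG.
(* [A] is a proper part of [U], as [prime_quotient] demands: the witness is a vertex of [W], or one
   of [S], adjacent to [A] in the premise, when [W] is inside [A]. *)
have [b bU bA] : exists2 b, b \in U & b \notin A.
  case: WAB => sW; last first.
    by exists w0; [exact: (subsetP sWU) | rewrite (disjointFl djAB) // (subsetP sW)].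
  exists s0; last by rewrite (disjointFl djAS).
  apply/negPn/negP=> sU; have := Uap' a0 s0 (subsetP sAU _ a0A); rewrite inE => /(_ sU).
  by rewrite eE a0A s0S orbT.
pose AU : {set U'} := presub (X := G') U A.
have hAU : homog AU setT.
  apply: (homog_presub (X := G')) => z x y zU zA xA yA.
  have zB : z \in B by have := subsetP sUY z zU; rewrite inE (negbTE zA).
  rewrite !eE (negbTE zA) xA yA !andbT.
  by rewrite (negbTE (apartC apAB zB xA)) (negbTE (apartC apAB zB yA)).
have [||Q [q [pQ sq eq qA]]] := @prime_quotient V U' AU hAU.
- by apply/set0Pn; exists (exist _ a0 (subsetP sAU a0 a0A)); rewrite inE.
- by apply/eqP=> /setP/(_ (exist _ b bU)); rewrite !inE /= (negbTE bA).
have [q' q'E] := @ext_fun G' U Q (q (exist _ a0 (subsetP sAU a0 a0A))) q.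
have sq' i : exists2 x, x \in U & q' x = i.
  by have [x <-] := sq i; exists (val x); [exact: valP | exact: q'E].
have eq' : {in U &, forall x y, q' x != q' y -> @edge V G' x y = edge (q' x) (q' y)}.
  move=> x y xU yU; have := q'E (exist _ x xU); have := q'E (exist _ y yU) => /= -> ->.
  exact: eq (exist _ x xU) (exist _ y yU).
have qA' : {in A &, forall x y, q' x = q' y}.
  move=> x y xA yA.
  have := q'E (exist _ x (subsetP sAU x xA)); have := q'E (exist _ y (subsetP sAU y yA)) => /= -> ->.
  by apply: qA; rewrite inE.
have [sT sP _] := IH nU pU.
have fibI i : isomorphic (sub [set u : U' | q u == i]) (@sub V G' [set x in U | q' x == i]).
  apply: iso_trans _ (fib_sub_iso (X := G') q' U i).
  suff -> : [set u : U' | q u == i] = [set x : @sub V G' U | q' (val x) == i] by [].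
  by apply/setP=> x; rewrite !inE -q'E.
have Q2 : 2 <= #|Q| by case: (pQ).
have F2 := @ss_peel_split V G W Phi Wap Phi_le Phi_red A B S ssD WAB U sWU sUY Uap' Umin.
have [/eqP Q2'|Q2'] := boolP (#|Q| == 2); last first.
  have Q4 : 4 <= #|Q|.
    by have := prime_not3 pQ; case: #|Q| Q2 Q2' => [|[|[|[|m]]]].
  case: (sP Q q pQ Q4 sq eq) => [[H [r [er pr lH]]]|[i [KX [KY [pX pY lXY]]]]].
    apply: (@ss_dual_split V G W Phi Wap W0 Phi_le Phi_red A B S ssD WAB U sAU sWU sUY Uap' Umin
      Q q' H r) => // i.
    by apply: prov_iso (pr i); apply: par_iso; [exact: iso_refl | exact: fibI].
  pose L := [set x in U | q' x == i].
  apply: (F2 L KX KY) => //.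
  - by apply/subsetP=> x; rewrite inE => /andP[].
  - by have [x xU qx] := sq' i; apply/set0Pn; exists x; rewrite inE xU qx /=.
  - have [j [_ [ji _ _ _]]] := prime_nonconst i pQ (ltnW Q4); have [x xU qx] := sq' j.
    by apply/eqP=> /setP/(_ x); rewrite inE xU qx (negbTE ji).
  - move=> z x y zU; rewrite !inE zU andTb => zi /andP[xU /eqP xi] /andP[yU /eqP yi].
    by rewrite !eq' ?xi ?yi.
  - have [ai|ai] := eqVneq (q' a0) i; [left|right].
      by apply/subsetP=> x xA; rewrite inE (subsetP sAU) //= (qA' x a0) // ai.
    apply/pred0P=> x /=; rewrite !inE; case xA: (x \in A) => //=.
    by rewrite (qA' x a0) // (negbTE ai) andbF.
  - by apply: prov_iso pX; apply: par_iso; [exact: iso_refl | exact: fibI].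
  - apply: prov_iso pY; apply: par_iso; first exact: iso_refl.
    apply: subsub_iso => [|x]; first exact: subsetDl.
    by rewrite !inE (valP x) q'E andbT.
pose i0 := q' a0.
have [k ki0] : exists k, k != i0.
  have : 1 < #|[set: Q]| by rewrite cardsT Q2'.
  case/card_gt1P=> x [y [_ _ xy]]; case: (eqVneq x i0) => [e|]; last by exists x.
  by exists y; rewrite -e eq_sym.
have cov j : (j == i0) || (j == k) by apply: card2_cov Q2' _; rewrite eq_sym.
pose L := [set x in U | q' x == i0].
have sAL : A \subset L.
  by apply/subsetP=> x xA; rewrite inE (subsetP sAU) //= (qA' x a0).
have sLU : L \subset U by apply/subsetP=> x; rewrite inE => /andP[].
have LU : L != U.
  by have [x xU qx] := sq' k; apply/eqP=> /setP/(_ x); rewrite inE xU qx (negbTE ki0).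
have eDL : U :\: L = [set x in U | q' x == k].
  apply/setP=> x; rewrite !inE; case: (x \in U) => //=.
  rewrite andbT; case: (eqVneq (q' x) k) => [->|nk] //=.
  by apply/negbF; move: (cov (q' x)); rewrite (negbTE nk) orbF.
(* If the two blocks were not adjacent, the block of [A] would be closed in the premise. It contains
   [W], which is inside [A] or else is connected and meets [S]. Minimality of [U] forbids this, so
   [U] is a tensor of two blocks. *)
have [ik|ik] := boolP (edge i0 k); last first.
  exfalso; case/negP: LU; apply/eqP; apply: Umin => //.
    case: WAB => sW; first exact: subset_trans sW sAL.
    move: link; rewrite sW andTb => /pred0Pn[s] /= /andP[sS sW'].
    have cross x y : x \in L -> y \in U -> y \notin L -> @edge V G' x y = false.
      move=> xL yU yL; have := xL; rewrite inE => /andP[xU /eqP qx].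
      have : y \in U :\: L by rewrite inE yL.
      rewrite eDL inE => /andP[_ /eqP qy].
      by rewrite eq' ?qx ?qy 1?eq_sym //; apply/negbTE.
    have sL : s \in L.
      apply/negPn/negP=> sL.
      have := cross a0 s (subsetP sAL _ a0A) (subsetP sWU _ sW') sL.
      by rewrite eE a0A sS orbT.
    apply/subsetPn=> -[w wW wL].
    have [x [y [xW xL yW yL xy]]] := Wconn sW' sL wW wL.
    by have := cross x y xL (subsetP sWU _ yW) yL; rewrite e_more.
  move=> x y xL; rewrite inE => yL; have := xL; rewrite inE => /andP[xU /eqP qx].
  have [yU|yU] := boolP (y \in U); last by apply: Uap'; rewrite ?inE.
  have : y \in U :\: L by rewrite inE yL.
  rewrite eDL inE => /andP[_ /eqP qy].
  by rewrite eq' ?qx ?qy 1?eq_sym.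
have comp x y : q x != q y -> edge x y.
  move=> nxy; rewrite eq //; move: nxy.
  by case/orP: (cov (q x)) => /eqP->; case/orP: (cov (q y)) => /eqP->; rewrite ?eqxx // edge_sym.
have [H [r [er pr lH]]] := sT Q q comp.
have erk : ~: [set x | r x == i0] = [set x | r x == k].
  apply/setP=> x; rewrite !inE; case: (eqVneq (r x) k) => [->|nk] //.
  by apply/negbF; move: (cov (r x)); rewrite (negbTE nk) orbF.
apply: (F2 L (sub [set x | r x == i0]) (sub [set x | r x == k])) => //.
- by apply/set0Pn; exists a0; rewrite (subsetP sAL).
- move=> z x y zU; rewrite !inE zU andTb => zi /andP[xU /eqP xi] /andP[yU /eqP yi].
  by rewrite !eq' ?xi ?yi.
- by left.
- by apply: prov_iso (pr i0); apply: par_iso; [exact: iso_refl | exact: fibI].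
- by rewrite eDL; apply: prov_iso (pr k); apply: par_iso; [exact: iso_refl | exact: fibI].
- apply: le_trans lH; apply: le_iso; rewrite -erk; apply: iso_sym; apply: whole_cut.
  by move=> x y; rewrite !inE => /eqP xi yi; apply: er; rewrite xi eq_sym.
Qed.

(** [W] and [O] are the two halves of the redex of p. The side graph of the premise splits
    blockwise, and [pull] joins its fibres to those of [O], so that together they carry the dual
    quotient. *)
Lemma skeleton_quot P (q : G -> P) (O : {set G}) H (r : H -> P) :
  prime_graph P -> 4 <= #|P| -> apart W O -> [disjoint W & O] ->
  apart (W :|: O) (~: (W :|: O)) ->
  {in W &, forall x y, q x != q y -> edge x y = edge (q x) (q y)} ->
  {in O &, forall x y, q x != q y -> edge x y = ~~ edge (q x) (q y)} ->
  (forall i, exists2 x, x \in W & q x = i) ->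
  (forall x y, r x != r y -> ~~ edge x y) ->
  (forall i, prov (par (sub [set x | r x == i]) (sub [set x in W :|: O | q x == i]))) ->
  le H (sub (~: (W :|: O))) -> principal W Phi.
Proof.
move=> pP P4 apO djO Yap eW eO sW er pr lH.
pose Z := par H (sub O); pose r' : Z -> dual P := sumf r (fun x : sub O => q (val x)).
pose H' := regraph (pull_rel r' set0).
have e' x y : r' x != r' y -> @edge V H' x y = ~~ @edge V P (r' x) (r' y).
  move=> nxy; rewrite [LHS]pull_relE !inE /= /dual_edge nxy /=.
  by case: x y nxy => [x|x] [y|y] /= nxy; rewrite ?inE ?(negbTE (er _ _ nxy)) // eO ?orbb //;
    exact: valP.
apply: (@PrQuot V G W Phi P q H' r') => //.
- move=> i; have fI : isomorphic (sub [set x : H' | r' x == i])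
      (par (sub [set x | r x == i]) (sub [set x in O | q x == i])).
    apply: (iso_trans (Y := sub [set x : Z | r' x == i])).
      apply: sub_regraph_base_iso => x y; rewrite !inE => /eqP xi /eqP yi.
      by rewrite pull_relE xi yi edge_irrefl !andbF orbF.
    apply: iso_trans (fib_par_iso _ _ _) _; apply: par_iso; first exact: iso_refl.
    exact: fib_sub_iso.
  apply: (prov_iso (par_iso (iso_sym fI) (iso_refl _))).
  have eF : [set x in W :|: O | q x == i] = [set x in W | q x == i] :|: [set x in O | q x == i].
    by apply/setP=> x; rewrite !inE andb_orl.
  apply: prov_iso (pr i); rewrite eF.
  apply: (iso_trans (Y := par (sub [set x | r x == i])
     (par (sub [set x in W | q x == i]) (sub [set x in O | q x == i])))); last by par_ac.
  apply: par_iso; [exact: iso_refl | apply: sub_cut].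
    by move=> x y; rewrite !inE => /andP[xW _] /andP[yO _]; exact: apO.
  by apply/pred0P=> x /=; rewrite !inE; case xW: (x \in W) => //=; rewrite (disjointFr djO) ?andbF.
- have Wrest := rest_iso (subsetUl W O) Yap; rewrite setDUl setDv set0U in Wrest.
  have eOW : O :\: W = O by apply/setDidPl; rewrite disjoint_sym.
  rewrite eOW in Wrest.
  apply: (@le_trans _ (par H (sub O))); last first.
    apply: le_trans (le_iso (iso_sym Wrest)); exact: le_par lH (le_refl _).
  split.
    exists id => // x y xy; have := pull_relE r' set0 x y.
    by rewrite (_ : @edge V Z x y = true) // => ->.
  apply: entails_der; apply: (pull (D := [set u : Z | if u is inl _ then true else false])).
  + by case=> [x|x] [y|y]; rewrite !inE //= inE.
  + by case=> [x|x] [y|y]; rewrite !inE //= => _ _; exact: er.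
  + case=> [x|x] [y|y]; rewrite !inE //= => _ _ nxy.
    by rewrite /dual_edge nxy eO //; exact: valP.
Qed.

Lemma skeleton_p P (q : G -> P) (M N : {set G}) : p_data q M N ->
  prov (regraph (p_rel (M :|: N) q)) -> W \subset M :|: N -> principal W Phi.
Proof.
move=> pD pG' sWY; have [[pP P4] [apMN djMN] hY sM [eM eN]] := pD.
have P3 := ltnW P4.
set Y := M :|: N in pG' hY sWY.
pose G' := regraph (p_rel Y q).
have /set0Pn[w0 w0W] := W0.
have Yap : apart Y (~: Y).
  move=> x y xY; rewrite inE => yY; rewrite edge_sym (hY y x w0) ?in_setT //; last exact: (subsetP sWY).
  by rewrite Wn //; apply: contra yY; exact: (subsetP sWY).
have lG' : nonadj G' < nonadj G by exact: reduct_lt (p_data_reduct pD).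
have e_out x y : ~~ ((x \in Y) && (y \in Y)) -> @edge V G' x y = @edge V G x y.
  by move=> h; rewrite /= p_relE andbA (negbTE h) orbF.
have Yap' : @apart V G' Y (~: Y).
  by move=> x y xY yY; rewrite e_out; [exact: Yap | move: yY; rewrite inE => /negbTE->; rewrite andbF].
have Giso : isomorphic G' (par (sub (~: Y)) (@sub V G' Y)).
  apply: iso_trans (whole_cut Yap') _; apply: iso_trans (parC _ _) _.
  apply: par_iso; last exact: iso_refl.
  apply: sub_regraph_base_iso => x y; rewrite !in_setC => xY _.
  by apply: e_out; rewrite (negbTE xY).
have pY : prov (par (sub (~: Y)) (@sub V G' Y)) by exact: prov_iso Giso pG'.
have nY : nonadj (par (sub (~: Y)) (@sub V G' Y)) < n.
  by rewrite -(nonadj_iso Giso); exact: leq_trans nG.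
have [sT _ _] := IH nY pY.
have comp (x y : @sub V G' Y) : q (val x) != q (val y) -> edge x y.
  by move=> nxy; rewrite /= p_relE nxy !(valP x, valP y) orbT.
have [H [r [er pr0 lH]]] := sT P (fun x => q (val x)) comp.
have pr i : prov (par (sub [set x | r x == i]) (sub [set x in Y | q x == i])).
  apply: prov_iso (pr0 i); apply: par_iso; first exact: iso_refl.
  apply: iso_trans (fib_sub_iso (X := G') q Y i) _.
  apply: sub_regraph_base_iso => x y; rewrite !inE => /andP[_ /eqP xi] /andP[_ /eqP yi].
  by rewrite p_relE xi yi eqxx !andbF orbF.
have Mconn : conn M.
  move=> Z a b aM aZ bM bZ.
  apply: (@quot_split V G (@edge V G) M (dual P) q Z a b) => //.
  - exact: edge_sym.
  - exact: prime_dual.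
  - by move=> x y xM yM nxy; rewrite eM //= /dual_edge nxy.
have [/subsetP sWM|/subsetPn[w wW wM]] := boolP (W \subset M).
  have eWM : W = M.
    apply/eqP; rewrite eqEsubset; apply/andP; split; first exact/subsetP.
    apply/subsetPn=> -[z zM zW].
    have [x [y [xM xW yM yW xy]]] := Mconn W w0 z (sWM _ w0W) w0W zM zW.
    by rewrite edge_sym Wn in xy.
  apply: (@skeleton_quot (dual P) q N H r); rewrite ?eWM //.
  - exact: prime_dual.
  - by move=> x y xM yM nxy; rewrite eM //= /dual_edge nxy.
  - by move=> x y xN yN nxy; rewrite eN //= /dual_edge nxy negbK.
have sWN : W \subset N.
  apply/subsetPn=> -[z zW zN].
  have zM : z \in M by have := subsetP sWY z zW; rewrite inE (negbTE zN) orbF.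
  have wN : w \in N by have := subsetP sWY w wW; rewrite inE (negbTE wM).
  have [x [y [xW xM yW yM xy]]] := Wconn zW zM wW wM.
  have yN : y \in N by have := subsetP sWY y yW; rewrite inE (negbTE yM).
  by rewrite (negbTE (apMN _ _ xM yN)) in xy.
(* A missing block of [N] may disconnect [N], so that [W] need not be all of it. The corresponding
   block of [M] is then provable with its fibre of [H]. Deleting both leaves a smaller problem for
   [W], proved by [id3_prov], and [le_insert] puts them back. *)
have [[i0 N0]|sN] : (exists i0, forall x, x \in N -> q x != i0) \/
    (forall i, exists2 x, x \in N & q x = i).
- have [/existsP[i /forall_inP h]|no] := boolP [exists i, forall x in N, q x != i].
    by left; exists i.
  right=> i; move/existsPn: no => /(_ i)/forall_inPn[x xN]; rewrite negbK => /eqP <-; by exists x.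
- pose Mi := [set x in M | q x == i0].
  pose Hr := sub [set x | r x != i0].
  have sMY : Mi \subset Y by apply/subsetP=> x; rewrite !inE => /andP[->].
  have djW : [disjoint W & Mi].
    by apply/pred0P=> x /=; rewrite !inE; case xW: (x \in W) => //=; rewrite (disjointFl djMN) ?(subsetP sWN).
  have sWYM : W \subset Y :\: Mi by rewrite subsetD sWY djW.
  have Yi0 : [set x in Y | q x == i0] = Mi.
    apply/setP=> x; rewrite !inE; case: (x \in M) => //=.
    by case xN: (x \in N) => //=; apply/negbTE; exact: N0.
  pose T := Y :\: Mi :\: W.
  have isoT : isomorphic (sub (Y :\: Mi)) (par (sub W) (sub T)).
    apply: sub_cutD => // x y xW; rewrite inE => /andP[yW _]; apply: Wap => //; by rewrite inE.
  have pK : prov (par Hr (sub (Y :\: Mi))).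
    pose X := par Hr (sub (Y :\: Mi)).
    pose r' := sumf (fun x : Hr => r (val x)) (fun x : sub (Y :\: Mi) => q (val x)).
    pose D : {set X} := [set u : X | if u is inl _ then true else false].
    pose K : {set X} := [set u : X | if u is inr x then val x \in M else false].
    have nMN (y : sub (Y :\: Mi)) : val y \notin M -> val y \in N.
      by move=> yM; have := valP y; rewrite !inE (negbTE yM).
    apply: (@id3_prov V X P r' D K).
    + by case=> [x|x] [y|y]; rewrite !inE //= inE.
    + by case=> [x|x] [y|y]; rewrite !inE //= => _ _; exact: er.
    + by apply/pred0P; case=> x /=; rewrite !inE ?andbF.
    + case=> [x|x] [y|y]; rewrite !inE //= => xM; rewrite ?inE // => /nMN; exact: apMN.
    + by case=> [x|x] [y|y]; rewrite !inE //= => xM yM; exact: eM.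
    + by case=> [x|x] [y|y]; rewrite !inE ?orbT //= orbF => /nMN xN; rewrite orbF => /nMN yN; exact: eN.
    move=> i; apply: (prov_iso (iso_sym (fib_par_iso _ _ _))).
    have [->|ni] := eqVneq i i0.
      apply: prov_par; first by apply: sub0_prov; apply/setP=> x; rewrite !inE; have := valP x; rewrite inE => /negbTE.
      apply: sub0_prov; apply/setP=> x; rewrite !inE; apply/negbTE; have := valP x.
      rewrite !inE => /andP[h /orP[xM|xN]]; last exact: N0.
      by move: h; rewrite xM.
    apply: prov_iso (pr i); apply: par_iso; apply: iso_sym.
      apply: iso_trans (fib_sub_iso r [set x | r x != i0] i) _.
      suff -> : [set x in [set x | r x != i0] | r x == i] = [set x | r x == i] by [].
      by apply/setP=> x; rewrite !inE; case: (eqVneq (r x) i) => [->|]; rewrite ?ni ?andbF.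
    apply: iso_trans (fib_sub_iso q (Y :\: Mi) i) _.
    suff -> : [set x in Y :\: Mi | q x == i] = [set x in Y | q x == i] by [].
    by apply/setP=> x; rewrite !inE; case: (eqVneq (q x) i) => [->|]; rewrite ?(negbTE ni) ?andbF.
  apply: (@principal_done V G W Phi Phi_le Phi_red (par Hr (sub T))).
  + apply: prov_iso pK; apply: iso_trans (par_iso (iso_refl _) isoT) _.
    by rewrite /T; par_ac.
  + have iK : isomorphic (par (par Hr (sub T)) (sub W)) (par Hr (par (sub W) (sub T))).
      by rewrite /T; par_ac.
    rewrite (nonadj_iso iK); apply: (@nonadj_part V G Y (Y :\: Mi)) => //.
    * apply/properP; split; first exact: subsetDl.
      have [x xM qx] := sM i0; exists x; first by rewrite inE xM.
      by rewrite !inE xM qx eqxx.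
    * exact: injects_trans (injects_sub _) lH.1.
    * exact: injects_iso (iso_sym isoT).
  have Wrest := rest_iso sWY Yap.
  have eT : T = Y :\: W :\: Mi by rewrite /T !setDDl setUC.
  have sMW : Mi \subset Y :\: W by rewrite subsetD sMY disjoint_sym.
  pose Hi := sub [set x | r x == i0].
  have isoH : isomorphic H (par Hi Hr).
    have -> : Hr = sub (~: [set x | r x == i0]).
      by congr sub; apply/setP=> x; rewrite !inE.
    by apply: whole_cut => x y; rewrite !inE => /eqP xi yi; apply: er; rewrite xi eq_sym.
  apply: (@le_trans _ (par (par Hi Hr) (sub (Y :\: W)))).
    rewrite eT; apply: le_insert => //; last by rewrite -Yi0; exact: pr.
    move=> z a b zY zM; rewrite !inE => /andP[aM /eqP ai] /andP[bM /eqP bi].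
    have [zM'|zM'] := boolP (z \in M); last first.
      have zN : z \in N by move: zY; rewrite !inE (negbTE zM') => /andP[].
      by rewrite !(edge_sym z) !(negbTE (apMN _ _ _ zN)).
    have zi : q z != i0 by move: zM; rewrite inE zM'.
    by rewrite !eM ?ai ?bi.
  apply: le_trans (le_iso (iso_sym Wrest)); apply: le_par (le_refl _).
  exact: le_trans (le_iso (iso_sym isoH)) lH.
have eWN : W = N.
  apply/eqP; rewrite eqEsubset sWN; apply/subsetPn=> -[z zN zW].
  have [x [y [xN xW yN yW xy]]] : exists x y, [/\ x \in N, x \in W, y \in N, y \notin W & edge x y].
    apply: (@quot_split V G (@edge V G) N P q W w0 z) => //; first exact: edge_sym.
    exact: (subsetP sWN).
  by rewrite edge_sym Wn in xy.
apply: (@skeleton_quot P q M H r); rewrite ?eWN //.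
- exact: apartC.
- by rewrite disjoint_sym.
- by rewrite setUC.
- by move=> i; rewrite setUC.
- by rewrite setUC.
Qed.

Lemma coconn_two (A B : {set G}) : apart A B -> A != set0 -> B != set0 -> coconn (A :|: B).
Proof.
move=> ap /set0Pn[a aA] /set0Pn[b bB] Z x y xY xZ yY yZ.
have aY : a \in A :|: B by rewrite inE aA.
have bY : b \in A :|: B by rewrite inE bB orbT.
have nba : ~~ edge b a by rewrite edge_sym; exact: ap.
have [aZ|aZ] := boolP (a \in Z); have [bZ|bZ] := boolP (b \in Z).
- move: yY; rewrite inE => /orP[yA|yB]; [exists b, y|exists a, y]; split=> //.
  + by rewrite inE yA.
  + by rewrite edge_sym; exact: ap.
  + by rewrite inE yB orbT.
  + exact: ap.
- by exists a, b; split=> //; exact: ap.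
- by exists b, a.
- move: xY; rewrite inE => /orP[xA|xB]; [exists x, b|exists x, a]; split=> //.
  + by rewrite inE xA.
  + exact: ap.
  + by rewrite inE xB orbT.
  + by rewrite edge_sym; exact: ap.
Qed.

(** A module and a component are disjoint or nested: if [Y] met both [W] and its complement without
    containing [W], an edge of [W] leaving [Y] would also reach the complement of [W]. *)
Lemma reduct_cases (e : rel G) (Y : {set G}) : reduct e Y -> prov (regraph e) -> coconn Y ->
  [\/ principal W Phi, W = Y | W \subset Y /\ W != Y].
Proof.
move=> red pG' cY; have hY := reduct_homog red.
have [dj|] := boolP [disjoint Y & W].
  constructor 1.
  have ag (x y : G) : x \in W -> regraph_edge e x y = edge x y.
    by move=> xW; apply: (reduct_agree red); rewrite (disjointFl dj xW).
  have Wap' : @apart V (regraph e) W (~: W).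
    by move=> x y xW yW; rewrite /= ag //; exact: Wap.
  have Wiso : isomorphic (@sub V (regraph e) W) (sub W).
    by apply: sub_regraph_base_iso => x y xW yW; exact: ag.
  have Giso : isomorphic (regraph e) (par (@sub V (regraph e) (~: W)) (sub W)).
    apply: iso_trans (whole_cut Wap') _; apply: iso_trans (parC _ _) _.
    by apply: par_iso; [exact: iso_refl | exact: Wiso].
  apply: (@principal_done V G W Phi Phi_le Phi_red (@sub V (regraph e) (~: W))).
  - exact: prov_iso Giso pG'.
  - by rewrite -(nonadj_iso Giso); exact: reduct_lt red.
  - split; first by apply: injects_regraph; exact: reduct_more red.
    apply: entails_der; apply: (reduct_sub red).
    by apply/subsetP=> x xY; rewrite inE (disjointFr dj).
case/pred0Pn=> w /= /andP[wY wW].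
have [/subsetP sYW|/subsetPn[y yY yW]] := boolP (Y \subset W).
  have [->|WY] := eqVneq W Y; first by constructor 2.
  constructor 1; apply: (@PrIn V G W Phi e Y) => //; first exact/subsetP.
  by rewrite eq_sym.
have sWY : W \subset Y.
  apply/subsetPn=> -[z zW zY].
  have [a [b [aW aY bW bY ab]]] := Wconn wW wY zW zY.
  have : edge b y by rewrite (hY b y a) ?in_setT // edge_sym.
  by rewrite edge_sym Wn.
constructor 3; split=> //.
by apply: contraNneq yW => ->.
Qed.

Lemma skeleton : prov G -> principal W Phi.
Proof.
case/prov_bottom=> [G0|x y nxy lxy exy hxy pr|A B S ssD pG'|P q M N pD pG'].
- by case/set0Pn: W0 => w _; have := card0_eq G0 w; rewrite inE.
- have [xW|xW] := boolP (x \in W); have [yW|yW] := boolP (y \in W).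
  + exact: (@PrAiIn V G W Phi x y).
  + apply: (@PrAi V G W Phi x y) => //; rewrite lxy; by case: (label y).
  + by apply: (@PrAi V G W Phi y x); rewrite // setUC.
  have sC : [set x; y] \subset ~: W.
    by apply/subsetP=> z; rewrite !inE => /orP[/eqP->|/eqP->].
  have isoC : isomorphic (sub (~: [set x; y])) (par (sub (~: W :\: [set x; y])) (sub W)).
    have e : ~: [set x; y] :\: W = ~: W :\: [set x; y].
      by apply/setP=> z; rewrite !in_setD !in_setC andbC.
    rewrite -e; apply: iso_trans (parC _ _); apply: sub_cutD.
      apply/subsetP=> z zW; rewrite !inE; apply/norP; split.
        by apply: contraNneq xW => <-.
      by apply: contraNneq yW => <-.
    by move=> a b aW; rewrite inE => /andP[bW _]; apply: Wap => //; rewrite inE.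
  apply: (@principal_done V G W Phi Phi_le Phi_red (sub (~: W :\: [set x; y]))).
  + exact: prov_iso isoC pr.
  + rewrite -(nonadj_iso isoC) -(nonadj_iso (subT_iso G)); apply: nonadj_sub_lt.
    by rewrite properT; apply/eqP=> /setP/(_ x); rewrite !inE eqxx.
  apply: (@le_trans _ (par (empty_graph V) (sub (~: W :\: [set x; y])))).
    by apply: le_iso; par_ac.
  apply: (@le_trans _ (par (par (empty_graph V) (empty_graph V)) (sub (~: W)))).
    apply: le_insert => //.
      by move=> z a b _ zA aA bA; apply: hxy.
    by apply: (prov_iso (X := sub [set x; y])); [par_ac | exact: prov_ai].
  by apply: le_iso; par_ac.
- have [apAB djAB hY sSB [A0 S0]] := ssD.
  have B0 : B != set0 by case/set0Pn: S0 => s sS; apply/set0Pn; exists s; exact: (subsetP sSB).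
  have WAB : W \subset A :|: B -> W \subset A \/ W \subset B.
    move=> sWY; have [|/subsetPn[w wW wA]] := boolP (W \subset A); [by left|right].
    apply/subsetPn=> -[z zW zB].
    have zA : z \in A by have := subsetP sWY z zW; rewrite inE (negbTE zB) orbF.
    have [a [b [aW aA bW bA ab]]] := Wconn zW zA wW wA.
    have bB : b \in B by have := subsetP sWY b bW; rewrite inE (negbTE bA).
    by rewrite (negbTE (apAB _ _ aA bB)) in ab.
  case: (reduct_cases (ss_data_reduct ssD) pG' (coconn_two apAB A0 B0)) => [//|WY|[sWY _]].
    by apply: (skeleton_ss ssD pG'); apply: WAB; rewrite WY.
  by apply: (skeleton_ss ssD pG'); apply: WAB.
have [[pP P4] [apMN djMN] hY sM [eM eN]] := pD.
have cY : coconn (M :|: N).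
  have [/card_gt0P[i _]] : 0 < #|P| by exact: leq_trans P4.
  have [m mM _] := sM i.
  (* With [N] empty the redex is [M] alone; nonadjacency on [M] has quotient [P] and is therefore
     connected. *)
  have [->|N0] := eqVneq N set0; last by apply: coconn_two => //; apply/set0Pn; exists m.
  rewrite setU0 => Z a b aM aZ bM bZ.
  apply: (@quot_split V G (fun x y => ~~ @edge V G x y) M P q Z a b) => //.
  - by move=> x y; rewrite edge_sym.
  - exact: ltnW.
  - by move=> x y xM yM nxy; rewrite eM ?negbK.
case: (reduct_cases (p_data_reduct pD) pG' cY) => [//|WY|[sWY _]].
  by apply: (skeleton_p pD pG'); rewrite WY.
exact: (skeleton_p pD pG').
Qed.

End Skeleton2.

(** * Principal cases for a par of two graphs *)

Section SplitAll.
Variable V : Type.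
Implicit Types X P Q H K D : graph V.

(** The cases of [principal] for [par K W], with [W] as a graph of its own, on which the given
    quotient map is defined. *)
Inductive principalW K (W : graph V) (Phi : graph V -> Prop) : Prop :=
| QDone : Phi K -> principalW K W Phi
| QAi (x : W) (y : K) : label y = dual_atom (label x) -> (forall z, ~~ edge z x) ->
    (forall z, ~~ edge z y) -> prov (par (sub (~: [set y])) (sub (~: [set x]))) ->
    principalW K W Phi
| QAiIn (x y : W) : x != y -> label x = dual_atom (label y) -> ~~ edge x y ->
    @homog V W [set x; y] setT -> prov (par K (sub (~: [set x; y]))) -> principalW K W Phi
| QIn (e : rel W) (Y : {set W}) : reduct e Y -> coconn Y -> Y != setT ->
    prov (par K (@regraph V W e)) -> principalW K W Phi
| QCross F F' (L : {set W}) : L != set0 -> L != setT -> homog L setT ->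
    prov (par F (sub L)) -> prov (par F' (sub (~: L))) -> le (par F F') K ->
    nonadj (par F (sub L)) < nonadj (par K W) -> nonadj (par F' (sub (~: L))) < nonadj (par K W) ->
    principalW K W Phi
| QQuot P (q : W -> P) H (r : H -> P) : prime_graph P -> 4 <= #|P| ->
    (forall x y, q x != q y -> edge x y = edge (q x) (q y)) -> (forall i, exists x, q x = i) ->
    (forall x y, r x != r y -> edge x y = ~~ edge (r x) (r y)) ->
    (forall i, prov (par (sub [set x | r x == i]) (sub [set x | q x == i]))) ->
    le H K -> principalW K W Phi.

Section Transfer.
Variables (K W : graph V).
Let G := par K W.

Definition inr_set (Z : {set W}) : {set G} := [set u : K + W | if u is inr w then w \in Z else false].
Definition inr_pre (Z : {set G}) : {set W} := [set w : W | (inr w : G) \in Z].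

Lemma inr_sub_iso (Z : {set W}) : isomorphic (sub Z) (sub (inr_set Z)).
Proof.
apply: (sub_iso (X := W) (Y := G) (f := fun w => inr w)) => //.
- by move=> x y _ _ [].
- by move=> x xZ; rewrite inE.
- by case=> [k|w]; rewrite inE // => wZ; exists w.
Qed.

Lemma inl_iso : isomorphic K (sub (~: inr_set setT)).
Proof.
apply: (emb_iso (X := K) (Y := G) (f := fun w => inl w)) => //.
- by move=> x y [].
- by move=> x; rewrite !inE.
- by case=> [k|w]; rewrite !inE // => _; exists k.
Qed.

Lemma inr_preK (Z : {set G}) : Z \subset inr_set setT -> inr_set (inr_pre Z) = Z.
Proof.
move=> /subsetP s; apply/setP=> -[k|w]; rewrite !inE //.
by apply/esym/negP=> /s; rewrite inE.
Qed.

Lemma principal_graph (Phi : graph V -> Prop) : (forall K K', le K K' -> Phi K -> Phi K') ->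
  principal (inr_set setT) Phi -> principalW K W Phi.
Proof.
move=> Phi_le; have iW := iso_trans (iso_sym (inr_sub_iso setT)) (subT_iso W).
have iK := iso_sym inl_iso.
case=> [ph|[x|x] [y|y]|[x|x] [y|y]|e Y red cY sY YW pr|F F' L sL L0 LW hL pF pF' lF nF nF'|
        P q H r pP P4 eW sW er pr lH].
- by apply: QDone; apply: Phi_le ph; exact: le_iso.
- by rewrite inE.
- by rewrite inE.
- rewrite !inE => _ _ lxy hxy pr; apply: (@QAi K W Phi x y) => //.
  + move=> z; have [->|zx] := eqVneq z x; first by rewrite edge_irrefl.
    have := hxy (inr z) (inr x) (inl y); rewrite !inE !eqxx ?orbT /= => h.
    rewrite h ?inE // orbF; apply: contraNneq zx => -[->] //.
  + move=> z; have [->|zx] := eqVneq z y; first by rewrite edge_irrefl.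
    have := hxy (inl z) (inr x) (inl y); rewrite !inE !eqxx ?orbT /= => h.
    rewrite -h ?inE //; apply: contraNneq zx => -[->] //.
  + apply: prov_iso pr; apply: iso_sym.
    apply: (emb_iso (X := par (sub (~: [set y])) (sub (~: [set x]))) (Y := G)
      (f := fun u : sub (~: [set y]) + sub (~: [set x]) => match u with inl a => inl (val a) | inr b => inr (val b) end)).
    * by case=> a [] b //= [] /val_inj ->.
    * case=> a; have := valP a; rewrite !inE /= => na; first by apply: contra na => /eqP[->].
      by rewrite orbF; apply: contra na => /eqP[->].
    * case=> a; rewrite !inE /= ?orbF => na.
        have na' : a \in ~: [set y] by rewrite !inE; apply: contra na => /eqP->.
        by exists (inl (exist _ a na')).
      have na' : a \in ~: [set x] by rewrite !inE; apply: contra na => /eqP->.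
      by exists (inr (exist _ a na')).
    * by case=> a [] b //=; rewrite !inE.
    * by case.
- by rewrite !inE.
- by rewrite inE.
- by rewrite inE.
- by rewrite !inE.
- rewrite !inE => _ _ nxy lxy exy hxy pr; apply: (@QAiIn K W Phi x y) => //.
  + by move=> z a b _ zxy axy bxy; apply: (hxy (inr z) (inr a) (inr b)); move: zxy axy bxy; rewrite !inE.
  + apply: prov_iso pr; apply: iso_sym.
    apply: (emb_iso (X := par K (sub (~: [set x; y]))) (Y := G)
      (f := fun u : K + sub (~: [set x; y]) => match u with inl a => inl a | inr b => inr (val b) end)).
    * by case=> a [] b //= [] // => [->//|/val_inj->].
    * by case=> a; rewrite !inE //; have := valP a; rewrite !inE.
    * case=> a; rewrite !inE /= => na; first by exists (inl a).
      have na' : a \in ~: [set x; y] by rewrite !inE.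
      by exists (inr (exist _ a na')).
    * by case=> a [] b //=; rewrite !inE.
    * by case.
- pose e' : rel W := fun x y => e (inr x) (inr y).
  pose Y' := inr_pre Y; have eY : inr_set Y' = Y by exact: inr_preK.
  have e'E x y : regraph_edge e' x y = regraph_edge e (inr x : G) (inr y : G) by [].
  have YE w : (w \in Y') = ((inr w : G) \in Y) by rewrite inE.
  have isoG' : isomorphic (regraph e) (par K (regraph e')).
    apply: (isoI (X := regraph e) (Y := par K (regraph e')) (f := id) (g := id)) => //.
    have nY k : (inl k : G) \in Y = false.
      by apply/negP=> /(subsetP sY); rewrite inE.
    by case=> [k|w] [k'|w'] //=; rewrite (reduct_agree red) ?nY ?andbF.
  apply: (@QIn K W Phi e' Y').
  + split.
    * by move=> z a b _ zY aY bY; apply: (reduct_homog red _ _ _ _ : edge (inr z : G) (inr a) = edge (inr z : G) (inr b)); rewrite ?in_setT -?YE.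
    * by move=> x y; rewrite !YE e'E => h; rewrite (reduct_agree red).
    * by move=> x y xy; rewrite e'E; apply: (reduct_more red).
    * have [x [y [nxy xy]]] := reduct_new red.
      have : (x \in Y) && (y \in Y).
        by apply/negPn/negP=> h; rewrite (reduct_agree red) // (negbTE nxy) in xy.
      case/andP=> xY yY; case: x y xY yY nxy xy => [k|x] [k'|y] xY yY nxy xy; try
        by [have := subsetP sY _ xY; rewrite inE | have := subsetP sY _ yY; rewrite inE].
      by exists x, y.
    * apply: der_trans (der_trans _ (reduct_der red)) _; last first.
        by apply: der_iso; rewrite -eY; apply: iso_sym; exact: inr_sub_iso.
      apply: der_iso; rewrite -eY.
      apply: (sub_iso (X := regraph e') (Y := regraph e) (f := fun w => inr w)) => //.
      - by move=> x y _ _ [].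
      - by move=> x xZ; rewrite inE.
      - by case=> [k|w]; rewrite inE // => wZ; exists w.
  + move=> Z a b aY aZ bY bZ.
    have aZ' : (inr a : G) \in inr_set Z by rewrite inE.
    have bZ' : (inr b : G) \notin inr_set Z by rewrite inE.
    rewrite YE in aY; rewrite YE in bY.
    have [x [y [xY xZ yY yZ xy]]] := cY (inr_set Z) (inr a) (inr b) aY aZ' bY bZ'.
    case: x y xZ xY yY yZ xy => [k|x] [k'|y] xZ xY yY yZ xy.
    * by rewrite inE in xZ.
    * by rewrite inE in xZ.
    * by have := subsetP sY _ yY; rewrite inE.
    * by rewrite inE in xZ; rewrite inE in yZ; exists x, y; rewrite !YE.
  + by apply: contraNneq YW => YT; rewrite -eY YT.
  + exact: prov_iso isoG' pr.
- pose L' := inr_pre L; have eL : inr_set L' = L by exact: inr_preK.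
  have LE w : (w \in L') = ((inr w : G) \in L) by rewrite inE.
  have iL : isomorphic (sub L) (sub L') by rewrite -eL; apply: iso_sym; exact: inr_sub_iso.
  have iC : isomorphic (sub (inr_set setT :\: L)) (sub (~: L')).
    have -> : inr_set setT :\: L = inr_set (~: L').
      by apply/setP=> -[k|w]; rewrite !inE ?andbF // andbT.
    by apply: iso_sym; exact: inr_sub_iso.
  apply: (@QCross K W Phi F F' L').
  + case/set0Pn: L0 => -[k|w] wL; first by have := subsetP sL _ wL; rewrite inE.
    by apply/set0Pn; exists w; rewrite LE.
  + by apply: contraNneq LW => LT; rewrite -eL LT.
  + by move=> z a b _ zL aL bL; apply: (hL (inr z) (inr a) (inr b)); rewrite -?LE //; rewrite !inE.
  + by apply: prov_iso pF; apply: par_iso.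
  + by apply: prov_iso pF'; apply: par_iso.
  + exact: le_trans lF (le_iso iK).
  + by rewrite (nonadj_iso (par_iso (iso_refl F) (iso_sym iL))).
  + by rewrite (nonadj_iso (par_iso (iso_refl F') (iso_sym iC))).
- apply: (@QQuot K W Phi P (fun w => q (inr w)) H r) => //.
  + by move=> x y; apply: eW; rewrite inE.
  + by move=> i; have [[k|w]] := sW i; rewrite inE // => _ <-; exists w.
  + move=> i; apply: prov_iso (pr i); apply: par_iso; first exact: iso_refl.
    have -> : [set x in inr_set setT | q x == i] = inr_set [set x | q (inr x) == i].
      by apply/setP=> -[k|w]; rewrite !inE.
    by apply: iso_sym; exact: inr_sub_iso.
  + exact: le_trans lH (le_iso iK).
Qed.

Lemma graph_skeleton n (Phi : graph V -> Prop) (w0 : W) :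
  splitting V n -> nonadj (par K W) <= n -> prov (par K W) -> conn [set: W] ->
  (forall K K', le K K' -> Phi K -> Phi K') ->
  (forall K', prov (par K' W) -> nonadj (par K' W) < nonadj (par K W) -> Phi K') ->
  principalW K W Phi.
Proof.
move=> IH nG pr cW Phi_le Phi_red; apply: principal_graph => //.
have iW := iso_trans (iso_sym (inr_sub_iso setT)) (subT_iso W).
apply: (@skeleton V n G (inr_set setT) Phi) => //.
- by case=> [k|w] [k'|w'] //; rewrite !inE //= inE.
- move=> Z [k|a] [k'|b]; rewrite ?inE // => _ aZ _ bZ.
  have aZ' : a \in inr_pre Z by rewrite inE.
  have bZ' : b \notin inr_pre Z by rewrite inE.
  have [x [y [_ xZ _ yZ xy]]] := cW (inr_pre Z) a b (in_setT _) aZ' (in_setT _) bZ'.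
  by exists (inr x), (inr y); split; rewrite ?inE //; [move: xZ | move: yZ]; rewrite inE.
- by apply/set0Pn; exists (inr w0); rewrite !inE.
- move=> K' p l; apply: Phi_red.
    by apply: prov_iso p; apply: par_iso.
  by rewrite -(nonadj_iso (par_iso (iso_refl K') iW)).
Qed.

End Transfer.

End SplitAll.

(** * The induction step of splitting *)

Section SplitAll.
Variable V : Type.
Implicit Types X P Q H K D : graph V.

Lemma tensor_split_le K K' (W : graph V) (I : finType) (q : W -> I) :
  le K K' -> tensor_split K q -> tensor_split K' q.
Proof.
by move=> h [H [r [er pr lH]]]; exists H, r; split=> //; exact: le_trans lH h.
Qed.

Lemma prime_split_le K K' (W Q : graph V) (q : W -> Q) :
  le K K' -> dual_split K q \/ peel_split K q -> dual_split K' q \/ peel_split K' q.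
Proof.
move=> h [[H [r [er pr lH]]]|[i [KX [KY [pX pY l]]]]]; [left|right].
  by exists H, r; split=> //; exact: le_trans lH h.
by exists i, KX, KY; split=> //; exact: le_trans l h.
Qed.

(** * Parts of a graph that do not cut a given module *)

Section Parts.
Variables (W : graph V) (Y : {set W}) (p : pred W).
Hypotheses (hY : homog Y setT) (pY : {in Y &, forall x y, p x = p y}).

Let dich : Y \subset [set w | p w] \/ [disjoint Y & [set w | p w]].
Proof.
have [->|/set0Pn[y yY]] := eqVneq Y set0; first by left; exact: sub0set.
case py: (p y); [left|right].
  by apply/subsetP=> x xY; rewrite inE (pY xY yY).
by apply/pred0P=> x /=; rewrite !inE; case xY: (x \in Y) => //=; rewrite (pY xY yY).
Qed.

Lemma part_insert F K : prov (par F (sub Y)) ->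
  prov (par K (sub [set u : sub (~: Y) | p (val u)])) ->
  (exists2 y, y \in Y & p y) -> prov (par (par F K) (sub [set w | p w])).
Proof.
move=> pF pK [y yY py].
have sY : Y \subset [set w | p w] by apply/subsetP=> x xY; rewrite inE (pY xY yY).
apply: (insert_par (A := Y)) => //; first by move=> z a b _; exact: hY.
apply: prov_iso pK; apply: par_iso; first exact: iso_refl.
apply: subsub_iso => [|x]; first by apply/subsetP=> x; rewrite !inE => /andP[].
by have := valP x; rewrite !inE => ->.
Qed.

Lemma part_skip K : prov (par K (sub [set u : sub (~: Y) | p (val u)])) ->
  [disjoint Y & [set w | p w]] -> prov (par K (sub [set w | p w])).
Proof.
move=> pK dj; apply: prov_iso pK; apply: par_iso; first exact: iso_refl.
apply: subsub_iso => [|x]; last by rewrite !inE.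
by apply/subsetP=> x xp; rewrite inE (disjointFl dj).
Qed.

Lemma part_prov K : prov (sub Y) ->
  prov (par K (sub [set u : sub (~: Y) | p (val u)])) -> prov (par K (sub [set w | p w])).
Proof.
move=> pS pK; have [Y0|/set0Pn[y yY]] := eqVneq Y set0.
  by apply: part_skip => //; rewrite disjoints_subset Y0 sub0set.
case: dich => [sY|]; last exact: part_skip.
apply: (prov_iso (X := par (par (empty_graph V) K) (sub [set w | p w]))); first by par_ac.
apply: part_insert => //; last by exists y => //; have := subsetP sY y yY; rewrite inE.
by apply: prov_iso pS; par_ac.
Qed.

Lemma part_red (e : rel W) : reduct e Y ->
  GSder (@sub V (regraph e) [set w | p w]) (sub [set w | p w]).
Proof.
move=> red; case: dich => [sY|dj]; first exact: reduct_sub red sY.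
by apply: der_iso; exact: reduct_out red dj.
Qed.

End Parts.

(** The image of [Y] is a module of [Q]. It is not all of [Q], because a vertex outside [Y] sees [Y]
    uniformly while its image has both neighbours and nonneighbours. So the image is a single
    vertex. *)
Lemma prime_const (W Q : graph V) (q : W -> Q) (Y : {set W}) : prime_graph Q -> 4 <= #|Q| ->
  (forall i, exists x, q x = i) -> (forall x y, q x != q y -> edge x y = edge (q x) (q y)) ->
  homog Y setT -> Y != setT -> {in Y &, forall x y, q x = q y}.
Proof.
move=> pQ Q4 sq eq hY YT x y xY yY; pose J := q @: Y.
have inJ z : z \in Y -> q z \in J by move=> zY; exact: imset_f.
have hJ : homog J setT.
  move=> z _ _ _ zJ /imsetP[a aY ->] /imsetP[b bY ->]; have [w qw] := sq z.
  have wY : w \notin Y by apply: contra zJ => wY; rewrite -qw; exact: inJ.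
  have n c : c \in Y -> q w != q c by move=> cY; rewrite qw; apply: contraNneq zJ => ->; exact: inJ.
  by rewrite -qw -!eq ?n //; apply: hY; rewrite ?inE.
case: (prime_homog pQ hJ) => [J0|[j Jj]|JT].
- by have := inJ x xY; rewrite J0 inE.
- by have := inJ x xY; have := inJ y yY; rewrite Jj !inE => /eqP-> /eqP.
have /subsetPn[w _ wY] : ~~ ([set: W] \subset Y) by rewrite subTset.
have [j [k [jw kw ij ik]]] := prime_nonconst (q w) pQ (ltnW Q4).
have /imsetP[a aY ja] : j \in J by rewrite JT inE.
have /imsetP[b bY kb] : k \in J by rewrite JT inE.
have := hY w a b (in_setT w) wY aY bY.
by rewrite !eq -?ja -?kb 1?eq_sym // ij (negbTE ik).
Qed.

Section Step.
Variable n : nat.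
Hypothesis IH : splitting V n.
Variables (K W : graph V).
Hypotheses (nG : nonadj (par K W) <= n) (pr : prov (par K W)).

Let ltn_IH K' W' : nonadj (par K' W') < nonadj (par K W) -> nonadj (par K' W') < n.
Proof. by move=> h; exact: leq_trans h nG. Qed.

Let nonadj_del (A : {set W}) : A != set0 -> nonadj (par K (sub (~: A))) < nonadj (par K W).
Proof.
move=> /set0Pn[a aA]; rewrite -(nonadj_iso (par_iso (iso_refl K) (subT_iso W))).
have pA : ~: A \proper setT by rewrite properT; apply/eqP=> /setP/(_ a); rewrite !inE aA.
apply: nonadj_par_lt; [exact: injects_refl | | exact: nonadj_sub_lt].
by apply: injects_card; apply: injects_subS; exact: proper_sub.
Qed.

Let nonadj_red (e : rel W) (Y : {set W}) : reduct e Y -> nonadj (par K (regraph e)) < nonadj (par K W).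
Proof. by move=> red; apply: nonadj_par_lt; [exact: injects_refl | | exact: reduct_lt red]. Qed.

(** On a single vertex each principal case is void or already settled, except an axiom between [W]
    and [K]; it exhibits the dual atom as an isolated vertex of [K] whose removal leaves a provable
    graph. *)
Lemma splitting_atom (w : W) : (forall x : W, x = w) ->
  entails (atom_graph (dual_atom (label w))) K.
Proof.
move=> eW.
have := @graph_skeleton V K W n (entails (atom_graph (dual_atom (label w)))) w IH nG pr.
case.
- by move=> Z a b; rewrite (eW a) (eW b) => _ -> _.
- by move=> K1 K2 [_ l] h; exact: entails_trans h l.
- by move=> K' p l; have [_ _] := IH (ltn_IH l) p; apply.
- by [].
- move=> x y lxy _ iy p D pD.
  have pC : prov (sub (~: [set y])).
    apply: prov_iso p; apply: iso_sym; apply: par0_iso; rewrite card_sub.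
    by apply: eq_card0 => z; rewrite !inE (eW z) (eW x) eqxx.
  have ap : apart [set y] (~: [set y]).
    by move=> a b /set1P-> _; rewrite edge_sym.
  have iy' : isomorphic (atom_graph (dual_atom (label w))) (sub [set y]).
    apply: (emb_iso (X := atom_graph (dual_atom (label w))) (Y := K) (f := fun _ => y)) => //.
    + by case=> -[].
    + by move=> _; rewrite inE.
    + by move=> z /set1P->; exists tt.
    + by move=> a b; rewrite edge_irrefl.
    + by case; rewrite /= lxy (eW x).
  have i : isomorphic (par (par (atom_graph (dual_atom (label w))) D) (sub (~: [set y]))) (par K D).
    apply: (@iso_trans V (par (par (atom_graph (dual_atom (label w))) (sub (~: [set y]))) D)).
      by par_ac.
    apply: par_iso; last exact: iso_refl.
    apply: iso_trans (iso_sym (whole_cut ap)).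
    by apply: par_iso; [exact: iy' | exact: iso_refl].
  by apply: prov_iso i _; exact: prov_par.
- by move=> x y; rewrite (eW x) (eW y) eqxx.
- move=> e Y red _ _ _; have [x [y [_]]] := reduct_new red.
  by rewrite (eW x) (eW y) /regraph_edge eqxx.
- move=> F F' L /set0Pn[x xL] /eqP LT; case: LT; apply/setP=> y.
  by rewrite inE (eW y) -(eW x) xL.
- move=> P q H r pP P4 _ sq _ _ _.
  have [j [_ [ji _ _ _]]] := prime_nonconst (q w) pP (ltnW P4).
  by have [x qx] := sq j; rewrite -qx (eW x) eqxx in ji.
Qed.

Lemma splitting_tensor (I : finType) (q : W -> I) : (forall x y, q x != q y -> edge x y) -> tensor_split K q.
Proof.
move=> eq.
(* For constant [q] the graph [K] is its own splitting, or the empty graph is one when [W] has no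
   vertices. *)
have [/existsP[w1 /existsP[w2 w12]]|triv] := boolP [exists w1, exists w2, q w1 != q w2]; last first.
  have qc x y : q x = q y.
    by apply/eqP/negPn; move/existsPn: triv => /(_ x)/existsPn.
  have [W0|/card_gt0P[w0 _]] := posnP #|W|.
    exists (empty_graph V), (of_void I); split=> //.
      by move=> i; apply: prov_empty; rewrite card_sum card_sub; apply/eqP; rewrite addn_eq0;
        apply/andP; split; apply/eqP; [|rewrite card_sub]; apply: eq_card0 => x; [case: x|];
        have := card0_eq W0 x; rewrite !inE.
    have pK : prov K by apply: prov_iso pr; apply: iso_sym; exact: par0_iso.
    split; first by exists (of_void K); case.
    move=> D pD; apply: prov_par => //; apply: prov_iso pD; par_ac.
  exists K, (fun _ => q w0); split; [by move=> x y; rewrite eqxx | | exact: le_refl].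
  move=> i; have [->|ni] := eqVneq i (q w0).
    apply: prov_iso pr; apply: par_iso; apply: iso_sym.
      by rewrite (_ : [set x | _] = setT); [exact: subT_iso | apply/setP=> x; rewrite !inE ?eqxx].
    by rewrite (_ : [set x | _] = setT); [exact: subT_iso | apply/setP=> x; rewrite !inE (qc x w0) ?eqxx].
  by apply: prov_par; apply: sub0_prov; apply/setP=> x; rewrite !inE ?(qc x w0) // eq_sym (negbTE ni).
have other (a : W) : exists w, q a != q w.
  by have [e|] := eqVneq (q a) (q w1); [exists w2; rewrite e | exists w1].
have := @graph_skeleton V K W n (fun K' => tensor_split K' q) w1 IH nG pr.
case.
- move=> Z a b _ aZ _ bZ; have [e|n1] := eqVneq (q a) (q b); last first.
    by exists a, b; split; rewrite ?inE //; exact: eq.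
  have [w nw] := other a; have [wZ|wZ] := boolP (w \in Z).
    by exists w, b; split; rewrite ?inE //; apply: eq; rewrite -e eq_sym.
  by exists a, w; split; rewrite ?inE //; exact: eq.
- by move=> K1 K2; exact: tensor_split_le.
- by move=> K' p l; have [h _ _] := IH (ltn_IH l) p; exact: h.
- by [].
- move=> x y _ nx _ _; exfalso; have [w nw] := other x.
  by have := nx w; rewrite edge_sym eq.
- move=> x y nxy lxy exy hxy p.
  have Y0 : [set x; y] != set0 by apply/set0Pn; exists x; rewrite !inE eqxx.
  have qxy : q x = q y by apply/eqP; apply: contraR exy; exact: eq.
  have qY : {in [set x; y] &, forall a b, q a = q b}.
    by move=> a b; rewrite !inE => /orP[] /eqP-> /orP[] /eqP->.
  have [h _ _] := IH (ltn_IH (nonadj_del Y0)) p.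
  have [|H [r [er pr' lH]]] := h I (fun u => q (val u)); first by move=> a b; exact: eq.
  exists H, r; split=> // i.
  apply: (part_prov (Y := [set x; y]) (p := fun w => q w == i)) => //.
  + by move=> a b aY bY; rewrite /= (qY a b).
  + exact: prov_ai.
- move=> e Y red cY YT p.
  (* Nonadjacency is connected on the redex, while distinct factors are completely joined, so the
     redex lies in one factor. *)
  have qY : {in Y &, forall a b, q a = q b}.
    move=> a b aY bY; apply/eqP/negPn/negP=> nab.
    have [||x [y [_ xZ _ yZ]]] := cY [set w | q w == q a] a b aY _ bY _; rewrite ?inE //.
      by rewrite eq_sym.
    rewrite inE in xZ; rewrite inE in yZ.
    by rewrite eq // (eqP xZ) eq_sym.
  have [h _ _] := IH (ltn_IH (nonadj_red red)) p.
  have [|H [r [er pr' lH]]] := h I q; first by move=> a b nab; apply: (reduct_more red); exact: eq.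
  exists H, r; split=> // i; apply: (prov_der (pr' i)); apply: der_par (der_refl _) _.
  apply: (part_red (Y := Y) (p := fun w => q w == i)) => //.
  by move=> a b aY bY; rewrite /= (qY a b).
(* Both parts of [W] are split, and in each factor the share of [L] is inserted as a module. *)
- move=> F F' L L0 LT hL pF pF' lF nF nF'.
  have [h _ _] := IH (ltn_IH nF) pF; have [h' _ _] := IH (ltn_IH nF') pF'.
  have [|H1 [r1 [er1 pr1 lH1]]] := h I (fun u => q (val u)); first by move=> a b; exact: eq.
  have [|H2 [r2 [er2 pr2 lH2]]] := h' I (fun u => q (val u)); first by move=> a b; exact: eq.
  exists (par H1 H2), (sumf r1 r2); split.
  + by case=> x [] y /= nxy; rewrite ?inE ?er1 ?er2.
  + move=> i; pose Fi := [set x | q x == i]; pose A := Fi :&: L.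
    apply: (prov_iso (X := par (par (sub [set x | r1 x == i]) (sub [set x | r2 x == i])) (sub Fi))).
      by apply: par_iso; [apply: iso_sym; exact: fib_par_iso | exact: iso_refl].
    apply: (insert_par (A := A)); first exact: subsetIl.
    * move=> z a b zF; rewrite !inE => zA /andP[aF aL] /andP[bF bL].
      by apply: hL; rewrite ?inE //; move: zA zF; rewrite !inE => h1 h2; rewrite h2 in h1.
    * apply: prov_iso (pr1 i); apply: par_iso; first exact: iso_refl.
      apply: iso_trans (fib_sub_iso q L i) _.
      by rewrite (_ : [set x in L | q x == i] = A) //; apply/setP=> x; rewrite !inE andbC.
    * apply: prov_iso (pr2 i); apply: par_iso; first exact: iso_refl.
      apply: iso_trans (fib_sub_iso q (~: L) i) _.
      rewrite (_ : [set x in ~: L | q x == i] = Fi :\: A) //; apply/setP=> x; rewrite !inE.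
      by case: (q x == i); case: (x \in L).
  + apply: le_trans lF; exact: le_par.
(* A prime quotient makes nonadjacency connected on [W], which two inhabited factors forbid. *)
- move=> P q' H r pP P4 eq' sq' _ _ _; exfalso.
  have [|||||||||x [y [_ xZ _ yZ]]] := @quot_split V W (fun x y => ~~ edge x y) setT (dual P) q'
    [set w | q w == q w1] w1 w2; rewrite ?inE //.
  + by move=> x y; rewrite edge_sym.
  + exact: prime_dual.
  + exact: ltnW.
  + by move=> i; have [x qx] := sq' i; exists x; rewrite ?inE.
  + by move=> x y _ _ nxy; rewrite eq' //= /dual_edge nxy.
  + by rewrite eq_sym.
  rewrite inE in xZ; rewrite inE in yZ.
  by rewrite eq // (eqP xZ) eq_sym.
Qed.

Lemma splitting_prime Q (q : W -> Q) : prime_graph Q -> 4 <= #|Q| -> (forall i, exists x, q x = i) ->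
  (forall x y, q x != q y -> edge x y = edge (q x) (q y)) -> dual_split K q \/ peel_split K q.
Proof.
move=> pQ Q4 sq eq; have Q3 := ltnW Q4.
have /card_gt0P[j0 _] : 0 < #|Q| by exact: leq_trans Q4.
have [w0 _] := sq j0.
have sq' i : exists2 x, x \in [set: W] & q x = i by have [x qx] := sq i; exists x; rewrite ?inE.
have W4 : 4 <= #|W|.
  apply: leq_trans Q4 _; have <- : #|q @: [set: W]| = #|Q|.
    rewrite -cardsT; congr #|pred_of_set _|; apply/setP=> i; rewrite inE.
    by have [x <-] := sq i; rewrite imset_f // inE.
  by rewrite -cardsT; exact: leq_imset_card.
have := @graph_skeleton V K W n (fun K' => dual_split K' q \/ peel_split K' q) w0 IH nG pr.
case.
- move=> Z a b aW aZ bW bZ.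
  apply: (@quot_split V W (@edge V W) setT Q q Z a b) => //; first exact: edge_sym.
  by move=> x y _ _; exact: eq.
- by move=> K1 K2; exact: prime_split_le.
- by move=> K' p l; have [_ h _] := IH (ltn_IH l) p; exact: h.
- by [].
- move=> x y _ nx _ _; exfalso; have [j [_ [ji _ ij _]]] := prime_nonconst (q x) pQ Q3.
  by have [w qw] := sq j; have := nx w; rewrite edge_sym eq qw 1?eq_sym // ij.
- move=> x y nxy lxy exy hxy p.
  have Y0 : [set x; y] != set0 by apply/set0Pn; exists x; rewrite !inE eqxx.
  have YT : [set x; y] != setT.
    by apply: contraTneq W4 => YT; rewrite -cardsT -YT cards2 nxy.
  have qY := prime_const pQ Q4 sq eq hxy YT.
  have xY : x \in [set x; y] by rewrite !inE eqxx.
  have pY : prov (sub [set x; y]) by exact: prov_ai.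
  (* Deleting the pair keeps the quotient map surjective unless the pair is a whole block; in that
     case the block is peeled off with an empty partner. *)
  have [/existsP[u /andP[uY /eqP qu]]|none] :=
      boolP [exists u, (u \notin [set x; y]) && (q u == q x)]; last first.
    have eY : [set x; y] = [set w | q w == q x].
      apply/setP=> w; rewrite [RHS]inE; apply/idP/idP=> [wY|qw]; first by rewrite (qY w x).
      by move/existsPn: none => /(_ w); rewrite qw andbT negbK.
    right; exists (q x), (empty_graph V), K; split.
    + by rewrite -eY; apply: prov_iso pY; par_ac.
    + by rewrite (_ : [set w | q w != q x] = ~: [set x; y]) // eY; apply/setP=> w; rewrite !inE.
    + by apply: le_iso; par_ac.
  have [_ h _] := IH (ltn_IH (nonadj_del Y0)) p.
  have pc i : {in [set x; y] &, forall a b, (q a == i) = (q b == i)}.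
    by move=> a b aY bY; rewrite (qY a b).
  have pc' i : {in [set x; y] &, forall a b, (q a != i) = (q b != i)}.
    by move=> a b aY bY; rewrite (qY a b).
  case: (h Q (fun w => q (val w)) pQ Q4).
  + move=> i; have [w qw] := sq i; have [wY|wY] := boolP (w \in [set x; y]).
      have uY' : u \in ~: [set x; y] by rewrite in_setC.
      by exists (exist _ u uY'); rewrite /= qu -(qY w x).
    have wY' : w \in ~: [set x; y] by rewrite in_setC.
    by exists (exist _ w wY').
  + by move=> a b; exact: eq.
  + move=> [H [r [er pr' lH]]]; left; exists H, r; split=> // i.
    by apply: (part_prov (Y := [set x; y]) (p := fun w => q w == i)).
  + move=> [i [KX [KY [pX pY' l]]]]; right; exists i, KX, KY; split=> //.
      by apply: (part_prov (Y := [set x; y]) (p := fun w => q w == i)).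
    by apply: (part_prov (Y := [set x; y]) (p := fun w => q w != i)).
- move=> e Y red _ YT p.
  have qY := prime_const pQ Q4 sq eq (reduct_homog red) YT.
  have [_ h _] := IH (ltn_IH (nonadj_red red)) p.
  have pc i : {in Y &, forall a b, (q a == i) = (q b == i)}.
    by move=> a b aY bY; rewrite (qY a b).
  have pc' i : {in Y &, forall a b, (q a != i) = (q b != i)}.
    by move=> a b aY bY; rewrite (qY a b).
  case: (h Q q pQ Q4 sq).
  + move=> a b nab; rewrite /= (reduct_agree red) ?eq //.
    by apply: contra nab => /andP[aY bY]; rewrite (qY a b).
  + move=> [H [r [er pr' lH]]]; left; exists H, r; split=> // i.
    apply: (prov_der (pr' i)); apply: der_par (der_refl _) _.
    by apply: (part_red (Y := Y) (p := fun w => q w == i)).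
  + move=> [i [KX [KY [pX pY' l]]]]; right; exists i, KX, KY; split=> //.
      apply: (prov_der pX); apply: der_par (der_refl _) _.
      by apply: (part_red (Y := Y) (p := fun w => q w == i)).
    apply: (prov_der pY'); apply: der_par (der_refl _) _.
    by apply: (part_red (Y := Y) (p := fun w => q w != i)).
- move=> F F' L L0 LT hL pF pF' lF nF nF'.
  have qL := prime_const pQ Q4 sq eq hL LT.
  have /set0Pn[x xL] := L0; pose i0 := q x.
  have [/existsP[u /andP[uL /eqP qu]]|none] :=
      boolP [exists u, (u \notin L) && (q u == q x)]; last first.
    have eL : L = [set w | q w == q x].
      apply/setP=> w; rewrite [RHS]inE; apply/idP/idP=> [wL|qw]; first by rewrite (qL w x).
      by move/existsPn: none => /(_ w); rewrite qw andbT negbK.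
    right; exists (q x), F, F'; split=> //; first by rewrite -eL.
    by rewrite (_ : [set w | q w != q x] = ~: L) // eL; apply/setP=> w; rewrite !inE.
  have [_ h _] := IH (ltn_IH nF') pF'.
  have pc i : {in L &, forall a b, (q a == i) = (q b == i)}.
    by move=> a b aL bL; rewrite (qL a b).
  have pc' i : {in L &, forall a b, (q a != i) = (q b != i)}.
    by move=> a b aL bL; rewrite (qL a b).
  have djL i : i != i0 -> [disjoint L & [set w | q w == i]].
    move=> ni; apply/pred0P=> w /=; rewrite !inE; case wL: (w \in L) => //=.
    by rewrite (qL w x) // eq_sym (negbTE ni).
  case: (h Q (fun w => q (val w)) pQ Q4).
  + move=> i; have [w qw] := sq i; have [wL|wL] := boolP (w \in L).
      have uL' : u \in ~: L by rewrite in_setC.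
      by exists (exist _ u uL'); rewrite /= qu -(qL w x).
    have wL' : w \in ~: L by rewrite in_setC.
    by exists (exist _ w wL').
  + by move=> a b; exact: eq.
  + move=> [H [r [er pr' lH]]]; left.
    (* [F], the partner of [L], is added to the fibre of [i0] and attached as the dual quotient
       prescribes. *)
    pose R := [set y : H | (r y != i0) && ~~ edge (r y) i0].
    exists (plug R F), (sumf r (fun _ => i0)); split.
    * case=> [a|a] [b|b] /= nab; last by rewrite eqxx in nab.
      - exact: er.
      - by rewrite inE nab.
      - by rewrite inE edge_sym eq_sym nab.
    * move=> i; have fI : isomorphic (@sub V (plug R F) [set y | sumf r (fun _ => i0) y == i])
         (par (sub [set y | r y == i]) (sub [set y : F | i0 == i])).
        by apply: fib_plug_iso => a b; rewrite inE => /andP[].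
      apply: (prov_iso (par_iso (iso_sym fI) (iso_refl _))).
      have [<-|ni] := eqVneq i0 i.
        have iF : isomorphic (sub [set _ : F | true]) F.
          by rewrite (_ : [set _ : F | true] = setT); [exact: subT_iso | apply/setP=> z; rewrite !inE].
        apply: (prov_iso (X := par (par F (sub [set y | r y == i0])) (sub [set w | q w == i0]))).
          apply: par_iso; last exact: iso_refl.
          apply: iso_trans (parC _ _) _; apply: par_iso; [exact: iso_refl | exact: iso_sym].
        by apply: (part_insert (Y := L) (p := fun w => q w == i0)) => //; exists x => //=.
      apply: (prov_iso (X := par (sub [set y | r y == i]) (sub [set w | q w == i]))).
        apply: par_iso; last exact: iso_refl.
        by apply: par0_iso; rewrite card_sub; apply: eq_card0 => z; rewrite !inE.
      by apply: (part_skip (Y := L) (p := fun w => q w == i)) => //; apply: djL; rewrite eq_sym.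
    * apply: le_trans (le_plug _ _) _; apply: le_trans _ lF.
      apply: le_trans (le_iso (parC _ _)) _; exact: le_par (le_refl _) lH.
  + move=> [i [KX [KY [pX pY l]]]]; right.
    have lFK : le (par F (par KX KY)) K.
      by apply: le_trans lF; exact: le_par (le_refl _) l.
    have [ei|ni] := eqVneq i i0.
      subst i; exists i0, (par F KX), KY; split.
      * by apply: (part_insert (Y := L) (p := fun w => q w == i0)) => //; exists x => //=.
      * apply: (part_skip (Y := L) (p := fun w => q w != i0)) => //.
        apply/pred0P=> w /=; rewrite !inE; case wL: (w \in L) => //=.
        by rewrite (qL w x) // eqxx.
      * by apply: le_trans lFK; apply: le_iso; par_ac.
    exists i, KX, (par F KY); split.
    * by apply: (part_skip (Y := L) (p := fun w => q w == i)) => //; exact: djL.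
    * by apply: (part_insert (Y := L) (p := fun w => q w != i)) => //; exists x; rewrite // eq_sym.
    * by apply: le_trans lFK; apply: le_iso; par_ac.
- move=> P q' H r pP P4 eq' sP er pr' lH; left.
  (* Prime quotients with at least four blocks have the same blocks: each block of one is a proper
     module, so [prime_const] puts it inside a block of the other. *)
  have uni (T1 T2 : graph V) (f1 : W -> T1) (f2 : W -> T2) : prime_graph T1 -> 4 <= #|T1| ->
      (forall i, exists a, f1 a = i) -> (forall a b, f1 a != f1 b -> edge a b = edge (f1 a) (f1 b)) ->
      prime_graph T2 -> 4 <= #|T2| ->
      (forall i, exists a, f2 a = i) -> (forall a b, f2 a != f2 b -> edge a b = edge (f2 a) (f2 b)) ->
      forall a b, f1 a = f1 b -> f2 a = f2 b.
    move=> p1 c1 s1 e1 p2 c2 s2 e2 a b ab.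
    apply: (prime_const p2 c2 s2 e2 (Y := [set w | f1 w == f1 a])); rewrite ?inE ?ab //.
      move=> z c d _; rewrite !inE => zn /eqP ca /eqP da.
      by rewrite !e1 ?ca ?da.
    have [j [_ [ji _ _ _]]] := prime_nonconst (f1 b) p1 (ltnW c1); have [c fc] := s1 j.
    by apply/eqP=> /setP/(_ c); rewrite !inE fc (negbTE ji).
  have qq' a b : q' a = q' b -> q a = q b by apply: uni.
  have q'q a b : q a = q b -> q' a = q' b by apply: uni.
  (* [s j] picks a vertex in the block [j]; the default [w0] is never reached, since [q'] is
     surjective. *)
  pose s (j : P) := odflt w0 [pick w | q' w == j].
  have sE j : q' (s j) = j.
    rewrite /s; case: pickP => [w /eqP //|no]; have [w qw] := sP j.
    by have := no w; rewrite qw eqxx.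
  exists H, (fun y => q (s (r y))); split=> //.
  + move=> a b nab; have nr : r a != r b by apply: contraNneq nab => ->.
    by rewrite er // -eq // eq' ?sE.
  + move=> i; have [w qw] := sq i.
    have e1 : [set y | q (s (r y)) == i] = [set y | r y == q' w].
      apply/setP=> y; rewrite !inE -qw; apply/eqP/eqP=> [/q'q|->]; first by rewrite sE.
      by apply: qq'; rewrite sE.
    have e2 : [set y | q y == i] = [set y | q' y == q' w].
      by apply/setP=> y; rewrite !inE -qw; apply/eqP/eqP=> [/q'q|/qq'].
    by rewrite e1 e2; exact: pr'.
Qed.

End Step.

Theorem splitting_all n : splitting V n.
Proof.
elim: n => [//|n IH] K W; rewrite ltnS => nG pr; split.
- by move=> I q; exact: (splitting_tensor IH nG pr).
- by move=> Q q; exact: (splitting_prime IH nG pr).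
- by move=> w; exact: (splitting_atom IH nG pr).
Qed.

End SplitAll.

(** * Cut *)

Section Cut.
Variable V : Type.
Implicit Types G P Q H K D : graph V.

Lemma split_tensor K W (I : finType) (q : vertex W -> I) : prov (@par V K W) ->
  (forall x y, q x != q y -> edge x y) -> tensor_split K q.
Proof. by move=> p h; have [t _ _] := splitting_all (ltnSn _) p; exact: t. Qed.

Lemma split_prim K W Q (q : vertex W -> Q) : prov (@par V K W) -> prime_graph Q -> 4 <= #|Q| ->
  (forall i, exists x, q x = i) -> (forall x y, q x != q y -> edge x y = edge (q x) (q y)) ->
  dual_split K q \/ peel_split K q.
Proof. by move=> p; have [_ t _] := splitting_all (ltnSn _) p; exact: t. Qed.

Lemma split_atom K W (w : vertex W) : prov (@par V K W) -> (forall x : W, x = w) ->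
  entails (atom_graph (dual_atom (label w))) K.
Proof. by move=> p; have [_ _ t] := splitting_all (ltnSn _) p; exact: t. Qed.

Lemma dual_iso G H : isomorphic G H -> isomorphic (dual G) (dual H).
Proof.
case=> f [[g fK gK] fe fl].
apply: (isoI (X := dual G) (Y := dual H) (f := f) (g := g)) => // [x y|x].
  by rewrite /= /dual_edge fe (inj_eq (can_inj fK)).
by rewrite /= fl.
Qed.

Lemma dual_sub G (A : {set G}) : isomorphic (@sub V (dual G) A) (dual (sub A)).
Proof.
apply: (isoI (X := @sub V (dual G) A) (Y := dual (sub A)) (f := id) (g := id)) => //.
Qed.

Lemma dualK_iso G : isomorphic (dual (dual G)) G.
Proof.
apply: (isoI (X := dual (dual G)) (Y := G) (f := id) (g := id)) => // [x y|x].
  rewrite /= /dual_edge /= /dual_edge; have [->|n] /= := eqVneq x y; last by rewrite negbK.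
  by rewrite edge_irrefl.
by rewrite /=; case: (@label V G x).
Qed.

Lemma dual_homog G (A : {set G}) : homog A setT -> @homog V (dual G) A setT.
Proof.
move=> h z a b zT zA aA bA; rewrite /= /dual_edge (h z a b) //.
by congr andb; rewrite (contraNneq _ zA) ?(contraNneq _ zA) // => ->.
Qed.

Lemma dual_tensor_iso G H : isomorphic (dual (tensor G H)) (par (dual G) (dual H)).
Proof.
apply: (isoI (X := dual (tensor G H)) (Y := par (dual G) (dual H)) (f := id) (g := id)) => //.
  by case=> a [] b //=; rewrite /dual_edge /= ?inE.
by case.
Qed.

Section CutStep.
Variable m : nat.
Hypothesis IH : forall G H K, #|G| < m -> prov (par H G) -> prov (par K (dual G)) -> prov (par H K).

(** The dual of [G] detaches into the duals of [A] and of its complement, and each is cut in turn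
    against its own partner by induction. *)
Lemma cut_module (G : graph V) (A : {set G}) H K KX KY : #|G| <= m -> homog A setT ->
  A != set0 -> A != setT ->
  prov (par KX (sub A)) -> prov (par KY (sub (~: A))) -> entails (par KX KY) H ->
  prov (par K (dual G)) -> prov (par H K).
Proof.
move=> Gm hA A0 AT pX pY lH pK.
have cA : #|sub A| < m.
  rewrite card_sub; apply: leq_trans Gm; rewrite -cardsT; apply: proper_card.
  by rewrite properT.
have cA' : #|sub (~: A)| < m.
  rewrite card_sub; apply: leq_trans Gm; rewrite -cardsT; apply: proper_card.
  by rewrite properT; apply: contra A0 => /eqP h; rewrite -(setCK A) h setCT.
have p1 : prov (par (par K (dual (sub (~: A)))) (dual (sub A))).
  apply: (prov_iso (X := par K (par (@sub V (dual G) (~: A)) (@sub V (dual G) A)))).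
    apply: iso_trans (parA _ _ _) _; apply: par_iso; last exact: dual_sub.
    by apply: par_iso; [exact: iso_refl | exact: dual_sub].
  by apply: (prov_der pK); apply: der_par (der_refl _) _; apply: detach; exact: dual_homog.
have p2 := IH cA pX p1.
have p3 : prov (par (par KX K) (dual (sub (~: A)))) by apply: prov_iso p2; par_ac.
have p4 := IH cA' pY p3.
by apply: lH; apply: prov_iso p4; par_ac.
Qed.

Lemma cut_tensor (G : graph V) H K (p : pred G) : #|G| <= m ->
  (exists x, p x) -> (exists x, ~~ p x) -> (forall x y, p x != p y -> edge x y) ->
  prov (par H G) -> prov (par K (dual G)) -> prov (par H K).
Proof.
move=> Gm [x px] [y py] ep pH pK.
have [L [r [er pr lL]]] := split_tensor pH ep.
pose A := [set u | p u == true].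
have eC : ~: A = [set u | p u == false] by apply/setP=> u; rewrite !inE; case: (p u).
have eL : ~: [set u | r u == true] = [set u | r u == false].
  by apply/setP=> u; rewrite !inE; case: (r u).
apply: (@cut_module G A H K (sub [set u | r u == true]) (sub [set u | r u == false])) => //.
- by move=> z a b _; rewrite !inE => zp /eqP ap /eqP bp; rewrite !ep ?ap ?bp.
- by apply/set0Pn; exists x; rewrite inE px.
- by apply/eqP=> /setP/(_ y); rewrite !inE (negbTE py).
- by rewrite eC; exact: pr.
- apply: entails_trans lL.2; apply: entails_der; apply: der_iso; rewrite -eL.
  apply: iso_sym; apply: whole_cut => u v; rewrite !inE => /eqP ur vr; apply: er.
  by rewrite ur eq_sym.
Qed.

Lemma cut_peel_split (G Q : graph V) H K (q : G -> Q) : #|G| <= m -> prime_graph Q -> 4 <= #|Q| ->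
  (forall i, exists x, q x = i) -> (forall x y, q x != q y -> edge x y = edge (q x) (q y)) ->
  peel_split H q -> prov (par K (dual G)) -> prov (par H K).
Proof.
move=> Gm pQ Q4 sq eq [i [KX [KY [pX pY l]]]].
apply: (@cut_module G [set x | q x == i] H K KX KY) => //.
- by move=> z a b _; rewrite !inE => zi /eqP ai /eqP bi; rewrite !eq ?ai ?bi.
- by have [x qx] := sq i; apply/set0Pn; exists x; rewrite inE qx.
- have [j [_ [ji _ _ _]]] := prime_nonconst i pQ (ltnW Q4); have [x qx] := sq j.
  by apply/eqP=> /setP/(_ x); rewrite !inE qx (negbTE ji).
- by rewrite (_ : ~: _ = [set x | q x != i]) //; apply/setP=> x; rewrite !inE.
- exact: l.2.
Qed.

End CutStep.

Theorem cut G H K : prov (par H G) -> prov (par K (dual G)) -> prov (par H K).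
Proof.
have [m] := ubnP #|G|; elim: m G H K => // m IH G H K; rewrite ltnS => Gm pH pK.
have pH' : prov (par H (dual (dual G))).
  by apply: prov_iso pH; apply: par_iso; [exact: iso_refl | apply: iso_sym; exact: dualK_iso].
have [G0|/card_gt0P[w _]] := posnP #|G|.
  apply: prov_par.
    by apply: prov_iso pH; apply: iso_sym; exact: par0_iso.
  by apply: prov_iso pK; apply: iso_sym; exact: par0_iso.
have [G1|GT] := eqVneq [set w] setT.
  have eG x : x = w by apply/set1P; rewrite G1 inE.
  apply: (split_atom pH eG); apply: prov_iso pK; apply: iso_trans (parC _ _) _.
  apply: par_iso; last exact: iso_refl.
  apply: (isoI (X := dual G) (Y := atom_graph (dual_atom (label w))) (f := fun _ => tt)
    (g := fun _ => w)) => //.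
  + by case.
  + by move=> x y; rewrite /= /dual_edge (eG x) (eG y) eqxx.
  + by move=> x; rewrite /= (eG x).
(* Any nonempty proper module leads to a prime quotient; a singleton is at hand. *)
have [||Q [q [pQ sq eq _]]] := @prime_quotient V G [set w] _ _ GT.
- by move=> z a b _ _ /set1P-> /set1P->.
- by apply/set0Pn; exists w; rewrite inE.
have Q2 : 2 <= #|Q| by case: pQ.
have [Q4|] := leqP 4 #|Q|; last first.
  move=> Q3; have Q2' : #|Q| = 2.
    by have := prime_not3 pQ; case: #|Q| Q2 Q3 => [|[|[|[|c]]]].
  have : 1 < #|[set: Q]| by rewrite cardsT.
  case/card_gt1P=> i [j [_ _ ij]].
  have cov k : (k == i) || (k == j) by exact: card2_cov.
  have [x qx] := sq i; have [y qy] := sq j.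
  have qd (a b : G) : (q a == i) != (q b == i) ->
      q a != q b /\ ((q a = i /\ q b = j) \/ (q a = j /\ q b = i)).
    have := cov (q a); have := cov (q b).
    case: (eqVneq (q a) i) => [->|_] /=; case: (eqVneq (q b) i) => [->|_] //=.
      by move=> /eqP-> _ _; split=> //; left.
    by move=> _ /eqP-> _; split; [rewrite eq_sym | right].
  have [eij|eij] := boolP (edge i j).
    apply: (@cut_tensor m IH G H K (fun x => q x == i)) => //.
    + by exists x; rewrite qx.
    + by exists y; rewrite qy eq_sym.
    + by move=> a b /qd[n [[ea eb]|[ea eb]]]; rewrite eq // ea eb // edge_sym.
  apply: (prov_iso (parC _ _)).
  apply: (@cut_tensor m IH (dual G) K H (fun x => q x == i)) => //.
  + by exists x; rewrite qx.
  + by exists y; rewrite qy eq_sym.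
  + move=> a b /qd[n h]; rewrite /= /dual_edge.
    have -> : a != b by apply: contraNneq n => ->.
    by case: h => [[ea eb]|[ea eb]]; rewrite eq // ea eb // edge_sym.
have eq' (x y : dual G) : q x != q y -> edge x y = @edge V (dual Q) (q x) (q y).
  move=> n; rewrite /= /dual_edge n eq //.
  by have -> : x != y by apply: contraNneq n => ->.
case: (split_prim pH pQ Q4 sq eq) => [[L [r [er pr lL]]]|p2]; last first.
  exact: (cut_peel_split IH Gm pQ Q4 sq eq p2 pK).
case: (@split_prim K (dual G) (dual Q) q pK (prime_dual pQ) Q4 sq eq') => [[L' [r' [er' pr' lL']]]|p2];
  last first.
  apply: (prov_iso (parC _ _)).
  exact: (@cut_peel_split m IH (dual G) (dual Q) K H q Gm (prime_dual pQ) Q4 sq eq' p2 pH').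
(* Both sides split blockwise. Each block is smaller than [G], so the fibres are cut by induction
   and reassembled by [id_par]. *)
have pL : prov (par L L').
  apply: (@id_par V L L' Q r r') => // [x y n|i].
    by rewrite er' //= /dual_edge n negbK.
  have cF : #|sub [set x | q x == i]| < m.
    rewrite card_sub; apply: leq_trans Gm; rewrite -cardsT; apply: proper_card; rewrite properT.
    have [j [_ [ji _ _ _]]] := prime_nonconst i pQ (ltnW Q4); have [x qx] := sq j.
    by apply/eqP=> /setP/(_ x); rewrite !inE qx (negbTE ji).
  apply: (IH _ _ _ cF (pr i)); apply: prov_iso (pr' i).
  by apply: par_iso; [exact: iso_refl | exact: dual_sub].
have p1 := lL.2 _ pL.
apply: (prov_iso (parC _ _)); apply: lL'.2.
exact: prov_iso (parC _ _) p1.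
Qed.

(** * Identity, factors of a tensor, and p up *)

Lemma atom_sub_iso G (i : G) : isomorphic (atom_graph (label i)) (sub [set x | x == i]).
Proof.
apply: (emb_iso (X := atom_graph (label i)) (Y := G) (f := fun _ => i)) => //.
- by case=> -[].
- by move=> _; rewrite inE.
- by move=> y; rewrite inE => /eqP->; exists tt.
- by move=> a b; rewrite edge_irrefl.
Qed.

(** The identity map is a quotient map with single vertices as blocks, so each block is an axiom. *)
Lemma identity G : prov (par (dual G) G).
Proof.
apply: (@id_par V (dual G) G G id id) => // [x y n|i].
  by rewrite /= /dual_edge n.
apply: (prov_iso (X := par (atom_graph (dual_atom (label i))) (atom_graph (label i)))).
  by apply: par_iso; [exact: (@atom_sub_iso (dual G)) | exact: atom_sub_iso].
apply: prov_der (der_refl _) _; apply: der_rule; apply: Or31; exact: AiDown.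
Qed.

(** In a splitting against the empty graph, the injection contained in [le] forces the fibres of the
    side graph to be empty, which leaves each factor provable alone. *)
Lemma tensor_prov G H : prov (tensor G H) -> prov G /\ prov H.
Proof.
move=> pT; pose q (u : tensor G H) := if u is inl _ then true else false.
have pT' : prov (par (empty_graph V) (tensor G H)) by apply: prov_iso pT; par_ac.
have eq (x y : tensor G H) : q x != q y -> edge x y.
  by case: x y => [x|x] [y|y] //= _; rewrite inE.
have [L [r [_ pr [sL _]]]] := split_tensor pT' eq.
have L0 : #|L| = 0 by have := injects_card sL; rewrite card_empty leqn0 => /eqP.
have pF b : prov (sub [set x | q x == b]).
  apply: prov_iso (pr b); apply: iso_sym; apply: par0x_iso; rewrite card_sub.
  by apply: eq_card0 => x; have := card0_eq L0 x; rewrite !inE.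
split.
- apply: prov_iso (pF true); apply: iso_sym.
  apply: (emb_iso (X := G) (Y := tensor G H) (f := fun x => inl x)) => //.
  + by move=> x y [].
  + by move=> x; rewrite inE.
  + by case=> y; rewrite inE // => _; exists y.
- apply: prov_iso (pF false); apply: iso_sym.
  apply: (emb_iso (X := H) (Y := tensor G H) (f := fun x => inr x)) => //.
  + by move=> x y [].
  + by move=> x; rewrite inE.
  + by case=> y; rewrite inE // => _; exists y.
Qed.

Lemma join_fib_iso (I : finType) (e : rel I) (es : symmetric e) (F : I -> graph V) i :
  isomorphic (F i) (@sub V (join_family es F) [set u | tag u == i]).
Proof.
pose f (x : F i) : join_family es F := existT (fun i => F i : Type) i x.
apply: (emb_iso (f := f)) => //.
- by move=> x y fxy; exact: (@eq_from_Tagged I (fun i => F i : Type) i x y fxy).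
- by move=> x; rewrite inE.
- by case=> j y; rewrite inE /= => /eqP ji; subst j; exists y.
- by move=> x y; rewrite /= /join_edge /= eqxx tagged_asE.
Qed.

Lemma p_up_prov (P : graph V) (M N : P -> graph V) :
  prov (@compose V P M) -> prov (@compose V (dual P) N) ->
  prov (big_par (fun i => tensor (M i) (N i))).
Proof.
move=> pM pN.
pose Z := big_par (fun i => tensor (M i) (N i)).
pose M' := dual (@compose V P M); pose N' := dual (@compose V (dual P) N).
pose X := par Z (par M' N').
pose r : X -> P := sumf (fun u : Z => tag u) (sumf (fun u : M' => tag u) (fun u : N' => tag u)).
pose D : {set X} := [set u : Z + (M' + N') | if u is inl _ then true else false].
pose K : {set X} := [set u : Z + (M' + N') | if u is inr (inl _) then true else false].
have pX : prov X.
  (* [Z] has no edges between blocks, [M'] has the dual quotient and [N'] the quotient [P]. Over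
     each vertex of [P] the block is an identity on [tensor (M i) (N i)]. *)
  apply: (@id3_prov V X P r D K).
  - by case=> [x|[x|x]] [y|[y|y]]; rewrite !inE //= inE.
  - case=> [x|[x|x]] [y|[y|y]]; rewrite !inE //= => _ _ n.
    by rewrite /join_edge (negbTE n).
  - by apply/pred0P; case=> [x|[x|x]]; rewrite /= !inE.
  - by case=> [x|[x|x]] [y|[y|y]]; rewrite !inE //= inE.
  - case=> [x|[x|x]] [y|[y|y]]; rewrite !inE //= => _ _ n.
    rewrite /dual_edge /= /join_edge (negbTE n).
    by have -> : x != y by apply: contraNneq n => ->.
  - case=> [x|[x|x]] [y|[y|y]]; rewrite !inE //= => _ _ n.
    rewrite /dual_edge /= /join_edge (negbTE n) /= /dual_edge n negbK.
    by have -> : x != y by apply: contraNneq n => ->.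
  move=> i; apply: (prov_iso (X := par (tensor (M i) (N i)) (par (dual (M i)) (dual (N i))))).
    apply: iso_trans (iso_sym (fib_par_iso _ _ _)); apply: par_iso; first exact: join_fib_iso.
    apply: iso_trans (iso_sym (fib_par_iso _ _ _)); apply: par_iso.
      apply: iso_trans (iso_sym (dual_sub _)); apply: dual_iso; exact: join_fib_iso.
    apply: iso_trans (iso_sym (dual_sub _)); apply: dual_iso.
    exact: (@join_fib_iso (dual P)).
  apply: (prov_iso (X := par (dual (tensor (M i) (N i))) (tensor (M i) (N i)))).
    apply: iso_trans (parC _ _) _; apply: par_iso; [exact: iso_refl | exact: dual_tensor_iso].
  exact: identity.
have p1 : prov (par (empty_graph V) (@compose V P M)) by apply: prov_iso pM; par_ac.
have p2 : prov (par (empty_graph V) (@compose V (dual P) N)) by apply: prov_iso pN; par_ac.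
have p3 : prov (par (par Z N') M') by apply: prov_iso pX; rewrite /X; par_ac.
have p4 : prov (par Z N') by apply: prov_iso (cut p1 p3); par_ac.
by apply: prov_iso (cut p2 p4); rewrite -/Z; par_ac.
Qed.

End Cut.

Theorem theorem5p5 (V : countType) :
  [/\ admissible (@ai_up V) (@GS V),
      admissible (@ss_up V) (@GS V)
    & admissible (@p_up V) (@GS V)].
Proof.
split.
- by move=> X Y [a] _; apply: prov_empty; exact: card_empty.
- by move=> X Y [B A S _ _] /tensor_prov[pB pA]; exact: prov_plug.
- by move=> X Y [P M N _ _ _] /tensor_prov[pM pN]; exact: p_up_prov.
Qed.
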